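(* Let $d\ge 2$ and $n\ge 1$ be integers and let $c>0$, $t>0$ be real. Let $\underline{\mathbf X}_d(t)$ be the position at time $t$ of the random flight in $\mathbb{R}^d$ with parameter $\nu=1$, speed $c$ and $n$ changes of direction in $[0,t]$ (as defined in the context). Then the law of $\underline{\mathbf X}_d(t)$, which is concentrated in the ball $\{\underline{\mathbf x}_d\in\mathbb{R}^d:\|\underline{\mathbf x}_d\|<ct\}$, has density with respect to Lebesgue measure on $\mathbb{R}^d$ given, for $\underline{\mathbf x}_d=(x_1,\dots,x_d)$ with $\|\underline{\mathbf x}_d\|<ct$, by $$p_n^1(\underline{\mathbf x}_d,t)=\frac{\Gamma((n+1)(d+1))}{\pi^{\frac{d-1}{2}}(2ct)^{(n+1)(d+1)-1}}\sum_{j=0}^{n+1}(-1)^{n+1-j}\binom{n+1}{j}\frac{\left(\frac{d+1}{2}\right)^{n+1-j}}{\Gamma\!\left(\frac{(n+1)(d+3)}{2}-j\right)}\sum_{k=0}^{n+1-j}\frac{(-1)^k a_{k,n+1-j}\,x_d^{2k}}{\Gamma\!\left(\frac{n(d+1)}{2}-k+1\right)}\,(c^2t^2-\|\underline{\mathbf x}_d\|^2)^{\frac{n(d+1)}{2}-k},$$ where the $a_{k,n+1-j}$ are the positive constants defined in the context.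
   Context: Here $\|\cdot\|$ is the Euclidean norm. Constants $a_{j,N}$. For integers $N\ge 0$ and $0\le j\le N$, the constants $a_{j,N}$ (positive) are defined by the requirement that, for all integers $k\ge r\ge 0$, $$\frac{(2(k-r)+2N-1)(2(k-r)+2N-3)\cdots(2(k-r)+1)}{r!\,(k-r)!}=\sum_{j=0}^N\frac{a_{j,N}}{r!\,(k-r-j)!},$$ where the product in the numerator has $N$ factors (and equals $1$ if $N=0$) and $1/q!=0$ for negative integers $q$. With these constants one has $$\int_0^{2\pi}e^{iz(\alpha\cos\theta+\beta\sin\theta)}\sin^{2N}\theta\,d\theta=2\pi\sum_{j=0}^N\frac{(-1)^ja_{j,N}\beta^{2j}}{2^jz^{N-j}(\sqrt{\alpha^2+\beta^2})^{N+j}}J_{N+j}(z\sqrt{\alpha^2+\beta^2}),$$ with $J_\mu$ the Bessel function of the first kind. Random flight with $\nu=1$. A particle starts at the origin of $\mathbb{R}^d$, moves with constant speed $c>0$, and changes direction exactly $n$ times in $[0,t]$. The durations of the $n+1$ straight segments are $\tau_1,\dots,\tau_{n+1}>0$ with $\tau_{n+1}=t-\sum_{j=1}^n\tau_j$, and $(\tau_1,\dots,\tau_n)$ has the rescaled Dirichlet density $$f_{d,1}(\tau_1,\dots,\tau_n)=\frac{\Gamma((n+1)(d+1))}{(\Gamma(d+1))^{n+1}}\,\frac{\prod_{k=1}^{n+1}\tau_k^{d}}{t^{(n+1)(d+1)-1}}$$ on $\{\tau_j>0\ (1\le j\le n),\ \sum_{j=1}^n\tau_j<t\}$. The angle vectors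 $(\theta_{1,k},\dots,\theta_{d-2,k},\phi_k)$, $k=1,\dots,n+1$, are independent of each other and of the times, and each has density $$g_{d,1}(\theta_1,\dots,\theta_{d-2},\phi)=\frac{\Gamma(1+d/2)}{2\pi^{\frac{d-1}{2}}\Gamma(3/2)}\sin^{d}\theta_1\,\sin^{d-1}\theta_2\cdots\sin^{3}\theta_{d-2}\,\sin^{2}\phi$$ on $\theta_j\in[0,\pi]$ $(1\le j\le d-2)$, $\phi\in[0,2\pi]$ (for $d=2$ there is only the angle $\phi$). The position $\underline{\mathbf X}_d(t)=(X_1(t),\dots,X_d(t))$ is given, with the convention $\theta_{d-1,k}=\phi_k$, by $$X_i(t)=c\sum_{k=1}^{n+1}\tau_k\,\sin\theta_{1,k}\cdots\sin\theta_{i-1,k}\,\cos\theta_{i,k}\quad(1\le i\le d-1),\qquad X_d(t)=c\sum_{k=1}^{n+1}\tau_k\,\sin\theta_{1,k}\cdots\sin\theta_{d-2,k}\,\sin\phi_k.$$ *)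

(* Defs.v *)
From HB Require Import structures.
From mathcomp Require Import all_boot all_order all_algebra.
From mathcomp Require Import all_classical all_reals all_analysis.
From mathcomp Require Import measurable_realfun ring.

Set Implicit Arguments.
Unset Strict Implicit.
Unset Printing Implicit Defensive.

Import Order.TTheory GRing.Theory Num.Theory.
Import numFieldNormedType.Exports.

Local Open Scope classical_set_scope.
Local Open Scope ring_scope.

Section sigma_finite_measure_existence.
Context d1 d2 (T1 : measurableType d1) (T2 : measurableType d2) (R : realType).

Lemma product_sigma_finite (m1 : {sigma_finite_measure set T1 -> \bar R})
    (m2 : {sigma_finite_measure set T2 -> \bar R}) :
  sigma_finite setT (m1 \x m2)%E.
Proof.
have /sigma_finiteP[F [TF ndF Foo]] := sigma_finiteT m1.
have /sigma_finiteP[G [TG ndG Goo]] := sigma_finiteT m2.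
exists (fun k => F k `*` G k).
  rewrite -setXTT TF TG predeqE => -[x y]; split.
    move=> [/= [k _ Fkx] [l _ Gly]]; exists (maxn k l) => //; split.
    - by move: x Fkx; exact/subsetPset/ndF/leq_maxl.
    - by move: y Gly; exact/subsetPset/ndG/leq_maxr.
  by move=> [k _ []/= ? ?]; split; exists k.
move=> k; have [? ?] := Foo k; have [? ?] := Goo k.
split; first exact: measurableX.
by rewrite product_measure1E// lte_mul_pinfty// ge0_fin_numE.
Qed.

Lemma pushforward_sigma_finite_measure
    (mu : {measure set T1 -> \bar R}) (f : T1 -> T2) (g : T2 -> T1) :
  sigma_finite setT mu ->
  measurable_fun setT f -> measurable_fun setT g -> cancel f g ->
  exists nu : {sigma_finite_measure set T2 -> \bar R}, pushforward mu f = nu.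
Proof.
move=> [F FT Foo] mf mg fgK.
pose M := measure_function_pushforward__canonical__measure_function_Measure
  mu mf.
have sf : sigma_finite setT (pushforward mu f).
  exists (fun i => g @^-1` F i); first by rewrite -preimage_bigcup -FT.
  move=> i; have [mF Fi] := Foo i; split.
    by rewrite -[X in measurable X]setTI; exact: mg.
  rewrite /pushforward (_ : _ @^-1` _ = F i)//.
  by apply/seteqP; split => x /=; rewrite fgK.
pose S : {sigma_finite_measure set T2 -> \bar R} :=
  HB.pack (Measure.sort M) M
    (Measure_isSigmaFinite.Build _ _ _ (Measure.sort M) sf).
by exists S.
Qed.

End sigma_finite_measure_existence.

Section lebesgue_tuple.
Context {R : realType}.

Definition consp m (p : measurableTypeR R * m.-tuple R) : m.+1.-tuple R :=
  [tuple of p.1 :: p.2].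

Definition unconsp m (x : m.+1.-tuple R) : measurableTypeR R * m.-tuple R :=
  (thead x, [tuple of behead x]).

(* R^m is realized as [m.-tuple R], and its Lebesgue measure is the m-fold
   product of [lebesgue_measure]; on the one-point space R^0 it is the Dirac
   mass. *)
Fixpoint lebesgue_tuple (m : nat) : set (m.-tuple R) -> \bar R :=
  match m with
  | 0 => dirac [tuple]
  | m'.+1 => pushforward (lebesgue_measure \x @lebesgue_tuple m')%E (@consp m')
  end.
Arguments lebesgue_tuple : clear implicits.

Lemma unconspK m : cancel (@consp m) (@unconsp m).
Proof. by case=> x y; congr pair; exact: val_inj. Qed.

Lemma measurable_consp m : measurable_fun setT (@consp m).
Proof.
apply: (@measurable_cons _ _ (measurableTypeR R * m.-tuple R)%type R fst m snd).
  exact: measurable_fst.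
exact: measurable_snd.
Qed.

Lemma measurable_unconsp m : measurable_fun setT (@unconsp m).
Proof.
apply: (@measurable_fun_pair _ _ _ _ (measurableTypeR R) _
  (fun x : m.+1.-tuple R => thead x)).
  exact: (@measurable_tnth _ R m.+1 ord0).
exact: measurable_behead.
Qed.

Lemma lebesgue_tuple_sigma_finite_measure m :
  exists nu : {sigma_finite_measure set (m.-tuple R) -> \bar R},
    lebesgue_tuple m = nu.
Proof.
elim: m => [|m [nu nuE]]; first by exists (dirac ([tuple] : 0.-tuple R)).
have [pf pfE] := pushforward_sigma_finite_measure
  (product_sigma_finite lebesgue_measure nu) (@measurable_consp m)
  (@measurable_unconsp m) (@unconspK m).
by exists pf; rewrite -pfE /= nuE.
Qed.

Section instances.
Variable m : nat.

Let lebesgue_tuple0 : lebesgue_tuple m set0 = 0%E.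
Proof.
by have [nu ->] := lebesgue_tuple_sigma_finite_measure m; exact: measure0.
Qed.

Let lebesgue_tuple_ge0 A : (0 <= lebesgue_tuple m A)%E.
Proof.
by have [nu ->] := lebesgue_tuple_sigma_finite_measure m; exact: measure_ge0.
Qed.

Let lebesgue_tuple_sigma_additive : semi_sigma_additive (lebesgue_tuple m).
Proof.
have [nu ->] := lebesgue_tuple_sigma_finite_measure m.
exact: measure_semi_sigma_additive.
Qed.

HB.instance Definition _ := isMeasure.Build _ _ _ (lebesgue_tuple m)
  lebesgue_tuple0 lebesgue_tuple_ge0 lebesgue_tuple_sigma_additive.

Let lebesgue_tuple_sigma_finite : sigma_finite setT (lebesgue_tuple m).
Proof.
by have [nu ->] := lebesgue_tuple_sigma_finite_measure m; exact: sigma_finiteT.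
Qed.

HB.instance Definition _ := Measure_isSigmaFinite.Build _ _ _
  (lebesgue_tuple m) lebesgue_tuple_sigma_finite.
End instances.

End lebesgue_tuple.
Arguments lebesgue_tuple {R} m _.

(* Nonnegativity is not required of [f]: it is forced almost everywhere by
   the nonnegativity of [mu]. *)
Definition has_density (R : realType) m (mu : set (m.-tuple R) -> \bar R)
    (f : m.-tuple R -> R) : Prop :=
  measurable_fun setT f /\
  forall A, measurable A -> mu A = (\int[lebesgue_tuple m]_(x in A) (f x)%:E)%E.

Definition gamma_fun (R : realType) (s : R) : R :=
  fine (\int[lebesgue_measure]_(x in `]0%R, +oo[)
          (x `^ (s - 1) * expR (- x))%:E)%E.

Definition enorm (R : realType) m (x : m.-tuple R) : R :=
  Num.sqrt (\sum_(i < m) tnth x i ^+ 2).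

(* Each event may be taken to be the whole space, so this product rule also
   covers the subfamilies. *)
Definition mutually_independent d0 d1 d2 (Omega : measurableType d0)
    (T1 : measurableType d1) (T2 : measurableType d2) (R : realType)
    (P : probability Omega R) (X : {RV P >-> T1})
    (m : nat) (Y : 'I_m -> {RV P >-> T2}) : Prop :=
  forall (A : set T1) (B : 'I_m -> set T2),
    measurable A -> (forall k, measurable (B k)) ->
    P (X @^-1` A `&` \bigcap_k (Y k @^-1` B k)) =
    (P (X @^-1` A) * \prod_(k < m) P (Y k @^-1` B k))%E.

(* [a j N] stands for a_{j,N}, which is determined for j <= N only.
   The terms with [k - r < j], for which 1/(k-r-j)! = 0 by convention, are
   left out of the sum. *)
Definition flight_constants (R : realType) (a : nat -> nat -> R) : Prop :=
  forall N k r : nat, (r <= k)%N ->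
    (\prod_(i < N) (2 * (k - r) + 2 * i + 1)%:R) / (r`!%:R * (k - r)`!%:R) =
    \sum_(j < N.+1 | (j <= k - r)%N) a j N / (r`!%:R * (k - r - j)`!%:R).

(* An explicit solution, showing that the requirement is satisfiable. *)
Fixpoint flight_constant (R : realType) (j N : nat) {struct N} : R :=
  match N with
  | 0 => (j == 0)%:R
  | N'.+1 => (2 * j + 2 * N' + 1)%:R * flight_constant R j N' +
      (if j is j'.+1 then 2 * flight_constant R j' N' else 0)
  end.

Lemma flight_constant_eq0 (R : realType) j N :
  (N < j)%N -> flight_constant R j N = 0.
Proof.
elim: N j => [|N IH] [|j]//= Nj.
by rewrite !IH ?mulr0 ?addr0//; apply: ltnW.
Qed.

Lemma flight_constant_ffact (R : realType) (m N : nat) :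
  \prod_(i < N) (2 * m + 2 * i + 1)%:R =
  \sum_(j < N.+1) flight_constant R j N * (m ^_ j)%:R.
Proof.
have ffactS j : (m ^_ j.+1)%:R = (m ^_ j)%:R * (m%:R - j%:R) :> R.
  have [jm|mj] := leqP j m; first by rewrite ffactnSr natrM natrB.
  by rewrite !ffact_small ?mul0r//; exact: ltnW.
elim: N => [|N IH]; first by rewrite big_ord0 big_ord1 /= mul1r ffactn0.
rewrite big_ord_recr/= IH.
under [RHS]eq_bigr do rewrite mulrDl.
rewrite big_split/= [X in _ = X + _]big_ord_recr/=.
rewrite (flight_constant_eq0 _ (ltnSn N)) mulr0 mul0r addr0.
rewrite [X in _ = _ + X]big_ord_recl/= mul0r add0r -big_split/= mulr_suml.
apply: eq_bigr => j _; rewrite /bump/= add1n ffactS add0n !natrD.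
by ring.
Qed.

Lemma flight_constantsP (R : realType) : flight_constants (flight_constant R).
Proof.
move=> N k r _; set m := (k - r)%N; rewrite flight_constant_ffact mulr_suml.
rewrite [RHS]big_mkcond; apply: eq_bigr => j _.
have fr q : q`!%:R != 0 :> R by rewrite pnatr_eq0 -lt0n fact_gt0.
case: ifPn => [jm|]; last first.
  by rewrite -ltnNge => mj; rewrite ffact_small ?mulr0 ?mul0r.
rewrite -(ffact_fact jm) natrM; field.
by rewrite !fr /= pnatr_eq0 -lt0n ffact_gt0.
Qed.

Section flight.
Context {R : realType}.

(* Durations are indexed from 0: the [k]-th segment lasts [s_k] for [k < n],
   and the last one, [k = n], completes the total time to [t]. *)
Definition duration (t : R) n (s : n.-tuple R) (k : nat) : R :=
  if (k < n)%N then s`_k else t - \sum_(i < n) tnth s i.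

Definition times_density (d n : nat) (t : R) (s : n.-tuple R) : R :=
  if [forall i, 0 < tnth s i] && (\sum_(i < n) tnth s i < t) then
    gamma_fun (n.+1 * d.+1)%:R / gamma_fun d.+1%:R ^+ n.+1 *
    ((\prod_(k < n.+1) duration t s k ^+ d) / t ^+ (n.+1 * d.+1).-1)
  else 0.

(* Angles are indexed from 0: [th_j] is theta_{j+1} for [j < d - 2], ranging
   over [0, pi], and [th_(d-2)] is phi, ranging over [0, 2 pi]. *)
Definition angles_density (d : nat) (th : d.-1.-tuple R) : R :=
  if [forall j : 'I_d.-1,
        0 <= tnth th j <= (if (j.+1 < d.-1)%N then pi else 2 * pi)] then
    gamma_fun (1 + d%:R / 2) /
      (2 * pi `^ ((d%:R - 1) / 2) * gamma_fun (3 / 2)) *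
    \prod_(j < d.-1) sin (tnth th j) ^+ (d - j)
  else 0.

(* Spherical coordinates; the coordinate [i = d - 1] has no cosine factor. *)
Definition direction (d : nat) (th : d.-1.-tuple R) (i : nat) : R :=
  (\prod_(j < i) sin th`_j) * (if (i < d.-1)%N then cos th`_i else 1).

Definition position (d n : nat) (c t : R)
    d0 (Omega : measurableType d0) (P : probability Omega R)
    (T : {RV P >-> n.-tuple R}) (Theta : 'I_n.+1 -> {RV P >-> d.-1.-tuple R})
    (w : Omega) : d.-tuple R :=
  [tuple c * \sum_(k < n.+1) duration t (T w) k * direction (Theta k w) i
    | i < d].

Section measurability.
Context (d n : nat) (c t : R) d0 (Omega : measurableType d0)
  (P : probability Omega R) (T : {RV P >-> n.-tuple R})
  (Theta : 'I_n.+1 -> {RV P >-> d.-1.-tuple R}).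

Let measurable_nth m (f : Omega -> m.-tuple R) j :
  measurable_fun setT f -> measurable_fun setT (fun w => (f w)`_j).
Proof.
move=> mf; have [jm|jm] := ltnP j m.
  rewrite (_ : (fun w => _) = (fun x => tnth x (Ordinal jm)) \o f).
    by apply: measurableT_comp => //; exact: measurable_tnth.
  by apply/funext => w /=; rewrite (tnth_nth 0).
rewrite (_ : (fun w => _) = cst 0)//.
by apply/funext => w /=; rewrite nth_default// size_tuple.
Qed.

Let measurable_position : measurable_fun setT (position c t T Theta).
Proof.
apply/measurable_fun_tnthP => i.
apply: (eq_measurable_fun (fun w => c *
    \sum_(k < n.+1) duration t (T w) k * direction (Theta k w) i)).
  by move=> w _ /=; rewrite tnth_mktuple.
apply: measurable_funM => //; apply: measurable_sum => k.
apply: measurable_funM.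
  rewrite /duration; case: (k < n)%N; first exact: measurable_nth.
  apply: measurable_funB => //; apply: measurable_sum => j.
  apply: (eq_measurable_fun (fun w => (T w)`_j)); last exact: measurable_nth.
  by move=> w _; rewrite (tnth_nth 0).
rewrite /direction; apply: measurable_funM.
  apply: measurable_prod => j _.
  apply: (measurableT_comp (f := @sin R)); last exact: measurable_nth.
  apply: continuous_measurable_fun => x; exact: continuous_sin.
case: (i < d.-1)%N => //.
apply: (measurableT_comp (f := @cos R)); last exact: measurable_nth.
by apply: continuous_measurable_fun => x; exact: continuous_cos.
Qed.

HB.instance Definition _ :=
  isMeasurableFun.Build _ _ _ _ (position c t T Theta) measurable_position.
End measurability.

Definition position_density (a : nat -> nat -> R) (d n : nat) (c t : R)
    (x : d.-tuple R) : R :=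
  gamma_fun (n.+1 * d.+1)%:R /
    (pi `^ ((d%:R - 1) / 2) * (2 * c * t) ^+ (n.+1 * d.+1).-1) *
  \sum_(j < n.+2)
    (-1) ^+ (n.+1 - j) * 'C(n.+1, j)%:R *
    ((d%:R + 1) / 2) ^+ (n.+1 - j) /
      gamma_fun ((n.+1 * (d + 3))%:R / 2 - j%:R) *
    \sum_(k < (n.+1 - j).+1)
      (-1) ^+ k * a k (n.+1 - j)%N * x`_d.-1 ^+ (2 * k) /
        gamma_fun ((n * d.+1)%:R / 2 - k%:R + 1) *
      (c ^+ 2 * t ^+ 2 - enorm x ^+ 2) `^ ((n * d.+1)%:R / 2 - k%:R).

End flight.

(* Main.v *)
(* Both measures are compared through their Laplace transforms at p. Take
   c = 1. A segment of duration s contributes the angular average of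
   exp(s p.u); times s^d it is a constant multiple of
   (T_(d+1) + (d+1) p_d^2 T_(d+3))(s), where T_a is the inverse Laplace
   transform in time of z |-> (z^2 - |p|^2)^(-a/2). By independence the
   transform of the law is the integral over the simplex of the product of
   these factors, an (n+1)-fold convolution, and the binomial theorem turns it
   into a combination of the T_((n+1)(d+1)+2l)(t). On the other side the
   transform of x_d^(2k) (t^2 - |x|^2)^e is computed one coordinate at a time,
   and the relation defining the a_(k,M), read as a polynomial identity at
   half-integers, is what collapses the alternating sum over k to one Bessel
   function times p_d^(2M). The negative terms of the candidate density, which
   is not known to be nonnegative, are moved to the side of the law; this
   leaves two finite measures on a box with the same Laplace transform. *)
From HB Require Import structures.
Require Import Defs.
From mathcomp Require Import all_boot all_order all_algebra.
From mathcomp Require Import all_classical all_reals all_analysis.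
From mathcomp Require Import measurable_realfun ring lra zify.
Set Implicit Arguments.
Unset Strict Implicit.
Unset Printing Implicit Defensive.
Import Order.TTheory GRing.Theory Num.Theory.
Import numFieldNormedType.Exports.
Local Open Scope classical_set_scope.
Local Open Scope ring_scope.

(** * Weighted measures and changes of variables *)

(** With Laplace transforms at real [p] in place of Fourier transforms, every kernel becomes a
    series with nonnegative terms, even in each coordinate of [p]. Sums and integrals are then
    exchanged by monotone convergence or Tonelli, with finiteness proved afterwards; on the side of
    the density, signs enter only through the finite sums over j and k.

    The two-term shape of the angular average comes from the weight: relative to the surface measure
    of the sphere, the density of the angles is a constant times u_d^2. Inserting u_d^2 amounts to
    applying the second derivative in p_d to a function of |p|^2, which yields one term without p_d
    and one with the factor p_d^2.

    The kernels appear in two forms, in powers of w = c^2 t^2 - |x|^2 for the space integrals and in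
    powers of the time s for the convolutions. At w = s^2 the duplication formula identifies them up
    to a constant, and this is where the two transforms meet. Since Gamma is only met at halves of
    positive integers, its recurrence and two values are enough. *)

Section weighted_measure.
Local Open Scope ereal_scope.
Context d (T : measurableType d) (R : realType).
Variables (mu : {measure set T -> \bar R}) (f : T -> R).
Hypotheses (f0 : forall x, (0 <= f x)%R) (mf : measurable_fun setT f).

(** Stated as an existence so that [f mu] can be obtained as a bundled measure wherever a weight is
    needed: the substitution rule, the independence argument, the uniqueness theorem. *)
Lemma ex_weighted_measure :
  exists nu : {measure set T -> \bar R},
    forall A, nu A = \int[mu]_(x in A) (f x)%:E.
Proof.
pose nu A := \int[mu]_(x in A) (f x)%:E.
have nu0 : nu set0 = 0 by rewrite /nu integral_set0.
have nu_ge0 A : 0 <= nu A by apply: integral_ge0 => x _; rewrite lee_fin.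
have nu_sigma : semi_sigma_additive nu.
  move=> F mF tF mUF; rewrite /nu ge0_integral_bigcup//.
  - by apply: is_cvg_ereal_nneg_natsum_cond => n _ _; exact: nu_ge0.
  - exact/measurable_EFinP/measurable_funTS.
  - by move=> x _; rewrite lee_fin.
pose S : {measure set T -> \bar R} :=
  HB.pack nu (isMeasure.Build _ _ _ nu nu0 nu_ge0 nu_sigma).
by exists S.
Qed.

Import HBNNSimple.

(** Increasing simple functions reduce the claim to indicators, where it is the hypothesis on
    [nu]. *)
Lemma ge0_integral_weighted (nu : {measure set T -> \bar R}) (F : T -> \bar R) :
  (forall A, measurable A -> nu A = \int[mu]_(x in A) (f x)%:E) ->
  (forall x, 0 <= F x) -> measurable_fun setT F ->
  \int[nu]_x F x = \int[mu]_x (F x * (f x)%:E).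
Proof.
move=> nuE F0 mF.
have mfE : measurable_fun setT (EFin \o f) by exact/measurable_EFinP.
pose h := nnsfun_approx measurableT mF.
have cvgh x : (EFin \o h n) x @[n --> \oo] --> F x.
  by apply: cvg_nnsfun_approx => //.
have ndh x a b : (a <= b)%N -> (h a x <= h b x)%R.
  by move=> ab; exact/lefP/nd_nnsfun_approx.
have -> : \int[nu]_x F x = limn (fun n => \int[nu]_x (h n x)%:E).
  rewrite -monotone_convergence//=.
  - by apply: eq_integral => x _; apply/esym/cvg_lim => //; exact: cvgh.
  - by move=> n; exact/measurable_EFinP.
  - by move=> n x _; rewrite lee_fin.
  - by move=> x _ a b ab; rewrite lee_fin; exact: ndh.
have -> : \int[mu]_x (F x * (f x)%:E) =
    limn (fun n => \int[mu]_x ((h n x)%:E * (f x)%:E)).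
  rewrite -monotone_convergence//=.
  - apply: eq_integral => x _; apply/esym/cvg_lim => //.
    by apply: cvgeZr => //; exact: cvgh.
  - move=> n; apply: emeasurable_funM => //; exact/measurable_EFinP.
  - by move=> n x _; rewrite mule_ge0 ?lee_fin.
  - by move=> x _ a b ab; rewrite lee_wpmul2r ?lee_fin//; exact: ndh.
apply: congr_lim; apply/funext => n.
transitivity (\int[nu]_x
   (\sum_(y \in range (h n)) (y * \1_(h n @^-1` [set y]) x)%:E)).
  by apply: eq_integral => t tE; rewrite /= fimfunE -fsumEFin.
have mindic r : measurable_fun setT (fun x => (r * \1_(h n @^-1` [set r]) x)%:E).
  by apply/measurable_EFinP; exact: measurable_funM.
rewrite ge0_integral_fsum//; last by move=> m y Ey; exact: nnfun_muleindic_ge0.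
transitivity (\int[mu]_x (\sum_(y \in range (h n))
    ((y * \1_(h n @^-1` [set y]) x)%:E * (f x)%:E))); last first.
  apply: eq_integral => x _.
  rewrite -ge0_mule_fsuml => [|y]; last exact: nnfun_muleindic_ge0.
  by rewrite fsumEFin // -(fimfunE _ x).
rewrite ge0_integral_fsum//; last 2 first.
  - by move=> y; apply: emeasurable_funM.
  - by move=> m y _; apply: mule_ge0; rewrite ?lee_fin//; exact: nnfun_muleindic_ge0.
apply: eq_fsbigr => r rhn.
have r0 : (0 <= r)%R by move: rhn; rewrite inE => -[t _ <-].
under [RHS]eq_integral do rewrite EFinM -muleA.
rewrite ge0_integralZl//=; last 2 first.
- by apply: emeasurable_funM => //; exact/measurable_EFinP.
- by move=> x _; rewrite mule_ge0 ?lee_fin.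
rewrite integralZl_indic_nnsfun// integral_indic// setIT nuE//; congr (_ * _).
under [RHS]eq_integral do rewrite muleC.
rewrite [LHS]integral_mkcond; apply: eq_integral => x _.
by rewrite /patch indicE; case: ifPn => _; rewrite ?mule1 ?mule0.
Qed.

End weighted_measure.

Section lebesgue_affine.
Local Open Scope ereal_scope.
Context (R : realType).
Local Notation mu := (@lebesgue_measure R).
Implicit Types (f : R -> \bar R).

(** Lebesgue measure is the only measure with the right values on half-open intervals, and its image
    under a translation has these values. Scaling is treated in the same way, the image measure
    being multiplied by [a]. *)
Lemma ge0_integral_lebesgue_shift f (a : R) :
  (forall x, 0 <= f x) -> measurable_fun setT f ->
  \int[mu]_x f (x + a)%R = \int[mu]_x f x.
Proof.
move=> f0 mf.
have ma : measurable_fun setT (fun x : measurableTypeR R => (x + a)%R : measurableTypeR R).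
  by apply: measurable_funD.
transitivity (\int[pushforward mu (fun x : measurableTypeR R => (x + a)%R : measurableTypeR R)]_x f x).
  by rewrite (ge0_integral_pushforward ma mu measurableT mf).
apply: eq_measure_integral => A mA _; apply/esym.
pose nu : {measure set (measurableTypeR R) -> \bar R} :=
  measure_function_pushforward__canonical__measure_function_Measure mu ma.
apply: (lebesgue_measure_unique (mu := nu)) => //= _ [[x y]] _ <-.
rewrite /pushforward /=.
rewrite (_ : _ @^-1` _ = `]x - a, y - a]%classic)%R.
  by rewrite !lebesgue_measure_itv/= !lte_fin ltrD2r -!EFinD; congr (if _ then _ else _);
     congr EFin; ring.
by apply/seteqP; split => z /=; rewrite !in_itv/= ltrBlDr lerBrDr.
Qed.

Lemma ge0_integral_lebesgue_scale f (a : R) : (0 < a)%R ->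
  (forall x, 0 <= f x) -> measurable_fun setT f ->
  a%:E * \int[mu]_x f (a * x)%R = \int[mu]_x f x.
Proof.
move=> a0 f0 mf.
have ma : measurable_fun setT (fun x : measurableTypeR R => (a * x)%R : measurableTypeR R).
  by apply: measurable_funM.
transitivity (a%:E *
    \int[pushforward mu (fun x : measurableTypeR R => (a * x)%R : measurableTypeR R)]_x f x).
  by rewrite (ge0_integral_pushforward ma mu measurableT mf).
rewrite -(@ge0_integral_mscale _ _ _ _ _ measurableT (NngNum (ltW a0)))//.
apply: eq_measure_integral => A mA _; apply/esym.
pose nu : {measure set (measurableTypeR R) -> \bar R} :=
  mscale (NngNum (ltW a0)) (measure_function_pushforward__canonical__measure_function_Measure mu ma).
apply: (lebesgue_measure_unique (mu := nu)) => //= _ [[x y]] _ <-.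
rewrite /nu /= /mscale /=.
rewrite [X in _ * X](_ : _ = mu (`]x / a, y / a]%classic)%R); last first.
  congr (mu _); apply/seteqP.
  by split => z /=; rewrite !in_itv/= ltr_pdivrMr// ler_pdivlMr// (mulrC z).
rewrite !lebesgue_measure_itv/= !lte_fin ltr_pM2r ?invr_gt0//.
case: ifP => _; last by rewrite mule0.
by rewrite -!EFinD -EFinM; congr EFin; field; rewrite gt_eqF.
Qed.

End lebesgue_affine.

Section lebesgue_tuple_integral.
Local Open Scope ereal_scope.
Context (R : realType).
Local Notation mu := (@lebesgue_measure R).

Lemma ge0_integral_lebesgue_tuple0 (f : 0.-tuple R -> \bar R) :
  (forall x, 0 <= f x) -> \int[lebesgue_tuple 0]_x f x = f [tuple].
Proof.
move=> f0.
have mf : measurable_fun setT f.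
  have -> : f = cst (f [tuple]) by apply/funext => x; rewrite tuple0.
  exact: measurable_cst.
by rewrite /= integral_dirac// diracT mul1e.
Qed.

Lemma ge0_integral_lebesgue_tupleS m (f : m.+1.-tuple R -> \bar R) :
  (forall x, 0 <= f x) -> measurable_fun setT f ->
  \int[lebesgue_tuple m.+1]_x f x =
  \int[mu]_x \int[lebesgue_tuple m]_y f (consp (x, y)).
Proof.
move=> f0 mf /=.
have mc := @measurable_consp R m.
rewrite (ge0_integral_pushforward mc (mu \x lebesgue_tuple m) measurableT mf)//.
rewrite (fubini_tonelli1 (f \o @consp R m))//=.
by apply: measurableT_comp.
Qed.

Lemma measurable_integral_lebesgue_tuple m (f : m.+1.-tuple R -> \bar R) :
  (forall x, 0 <= f x) -> measurable_fun setT f ->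
  measurable_fun setT (fun x : R => \int[lebesgue_tuple m]_y f (consp (x, y))).
Proof.
move=> f0 mf.
apply: (measurable_fun_fubini_tonelli_F (m2 := lebesgue_tuple m) (f \o @consp R m)) => //=.
by apply: measurableT_comp => //; exact: measurable_consp.
Qed.

End lebesgue_tuple_integral.

Lemma ge0_integralMl d (T : measurableType d) (R : realType)
    (mu : {measure set T -> \bar R}) (k : R) (f : T -> R) :
  0 <= k -> (forall x, 0 <= f x) -> measurable_fun setT f ->
  (\int[mu]_x (k * f x)%:E = k%:E * \int[mu]_x (f x)%:E)%E.
Proof.
move=> k0 f0 mf; rewrite -ge0_integralZl//.
- exact/measurable_EFinP.
- by move=> x _; rewrite lee_fin.
Qed.

Lemma ge0_integralD_EFin d (T : measurableType d) (R : realType)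
    (mu : {measure set T -> \bar R}) (f g : T -> R) :
  (forall x, 0 <= f x) -> measurable_fun setT f ->
  (forall x, 0 <= g x) -> measurable_fun setT g ->
  (\int[mu]_x (f x + g x)%:E = \int[mu]_x (f x)%:E + \int[mu]_x (g x)%:E)%E.
Proof.
move=> f0 mf g0 mg; rewrite -ge0_integralD//.
- by move=> x _; rewrite lee_fin.
- exact/measurable_EFinP.
- by move=> x _; rewrite lee_fin.
- exact/measurable_EFinP.
Qed.

Section substitution.
Local Open Scope ereal_scope.
Context (R : realType).
Local Notation mu := (@lebesgue_measure R).

(** Open rays are stable under intersection and generate the Borel sets, and the rays from [- n]
    exhaust the line. Only rays unbounded to the right are used, because indicators of this form are
    what exponentials approximate later. *)
Lemma measure_eq_rays (m1 m2 : {measure set (measurableTypeR R) -> \bar R}) :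
  (forall c : R, m1 `]c, +oo[%classic < +oo) ->
  (forall c : R, m1 `]c, +oo[%classic = m2 `]c, +oo[%classic) ->
  forall A, measurable A -> m1 A = m2 A.
Proof.
move=> fin eqm.
pose g (n : nat) : set R := `](- n%:R)%R, +oo[%classic.
move=> A mA; apply: (@measure_unique _ R (measurableTypeR R) (@RGenOInfty.G R) g _ _ _ _ m1 m2 _ _ A mA).
- exact: RGenOInfty.measurableE.
- move=> _ _ [x ->] [y ->]; exists (Order.max x y).
  apply/seteqP; split=> z /=; rewrite !in_itv/= !andbT gt_max.
    by move=> [-> ->].
  by move=> /andP[].
- by move=> n; exists (- n%:R)%R.
- rewrite -subTset => x _; exists (Num.truncn `|x|).+1 => //=.
  rewrite /g/= in_itv/= andbT ltrNl (le_lt_trans _ (truncnS_gt _))//.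
  by rewrite -normrN ler_norm.
- by move=> _ [x ->].
- by move=> k; exact: fin.
Qed.

Lemma integral_FTC (F g : R -> R) (a b : R) : (a <= b)%R ->
  (forall x : R, is_derive x 1%R F (g x)) -> continuous g ->
  \int[mu]_(x in `[a, b]) (g x)%:E = (F b - F a)%:E.
Proof.
rewrite le_eqVlt => /predU1P[->|ab] dF cg.
  by rewrite set_itv1 integral_set1 subrr.
have cF : continuous F.
  by move=> x; apply: differentiable_continuous; apply/derivable1_diffP/ex_derive.
rewrite (@continuous_FTC2 _ g F)//.
- exact: continuous_subspaceT.
- split; first by move=> x _; exact: ex_derive.
  + by apply: cvg_at_right_filter; exact: cF.
  + by apply: cvg_at_left_filter; exact: cF.
- by move=> x _; rewrite derive1E derive_val.
Qed.

Variables (F g : R -> R) (a b : R).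
Hypotheses (ab : (a <= b)%R) (dF : forall x : R, is_derive x 1%R F (g x))
  (cg : continuous g) (g0 : forall x, (a <= x <= b)%R -> (0 <= g x)%R)
  (incrF : forall x y, (a <= x)%R -> (x < y)%R -> (y <= b)%R -> (F x < F y)%R).

(** As [f] is merely measurable, the rule is proved for measures: the image under [F] of [g] times
    Lebesgue measure on [[a, b]] is compared with Lebesgue measure on [[F a, F b]], on rays. Strict
    monotonicity is assumed separately because [g] vanishes at endpoints in the applications. *)
Lemma ge0_integral_substitution (f : R -> \bar R) :
  (forall x, 0 <= f x) -> measurable_fun setT f ->
  \int[mu]_(x in `[a, b]) (f (F x) * (g x)%:E) =
  \int[mu]_(y in `[F a, F b]) f y.
Proof.
move=> f0 mf.
have cF : continuous F.
  by move=> x; apply: differentiable_continuous; apply/derivable1_diffP/ex_derive.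
have mF : measurable_fun setT (F : measurableTypeR R -> measurableTypeR R).
  exact: continuous_measurable_fun.
have mg : measurable_fun setT g by exact: continuous_measurable_fun.
pose gab : R -> R := g \_ `[a, b].
have mgab : measurable_fun setT gab.
  by apply/(measurable_restrictT _ _).1 => //; exact: measurable_funTS.
have gab0 x : (0 <= gab x)%R.
  by rewrite /gab /patch; case: ifPn => //; rewrite inE/= in_itv/= => /g0.
have [nu nuE] := ex_weighted_measure mu gab0 mgab.
have nuE' A : nu A = \int[mu]_(x in A `&` `[a, b]) (g x)%:E.
  rewrite nuE [RHS]integral_mkcondr; apply: eq_integral => x _.
  by rewrite /gab /patch/=; case: ifPn.
pose nuF : {measure set (measurableTypeR R) -> \bar R} :=
  measure_function_pushforward__canonical__measure_function_Measure nu mF.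
pose muF : {measure set (measurableTypeR R) -> \bar R} :=
  measure_function_mrestr__canonical__measure_function_Measure mu
    (measurable_itv `[F a, F b]).
transitivity (\int[nuF]_y f y).
  rewrite (ge0_integral_pushforward mF nu measurableT mf)//.
  rewrite preimage_setT.
  have -> := @ge0_integral_weighted _ _ _ mu gab gab0 mgab nu (f \o F)
    (fun A _ => nuE A) (fun x => f0 (F x)) (measurableT_comp mf mF).
  rewrite [LHS]integral_mkcond; apply: eq_integral => x _.
  by rewrite /gab /patch/=; case: ifPn => //; rewrite mule0.
have leF x y : (a <= x)%R -> (x <= y)%R -> (y <= b)%R -> (F x <= F y)%R.
  by move=> ax; rewrite le_eqVlt => /predU1P[->//|xy] yb; exact/ltW/incrF.
transitivity (\int[muF]_y f y); last first.
  rewrite [RHS]integral_mkcond [RHS](_ : _ = \int[mu]_x (f x * ((\1_(`[F a, F b]%classic) x : R))%:E)); last first.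
    apply: eq_integral => x _; rewrite /patch indicE.
    by case: ifPn => _; rewrite ?mule1 ?mule0.
  apply: ge0_integral_weighted => // A mA.
  by rewrite integral_indic//= /mrestr setIC.
apply: eq_measure_integral => A mA _; apply: measure_eq_rays => //.
  move=> c; apply: le_lt_trans (_ : nuF setT < +oo).
    by apply: le_measure; rewrite ?inE//=; exact: measurable_itv.
  rewrite /= /pushforward preimage_setT nuE' setTI.
  by rewrite (integral_FTC ab dF cg) ltry.
move=> c; rewrite /= /pushforward /mrestr.
rewrite nuE'.
have [cFa|Fac] := ltP c (F a).
  rewrite (_ : _ `&` _ = `[a, b]%classic); last first.
    apply/seteqP; split => [x []//|x /=]; rewrite !in_itv/= andbT => /andP[ax xb].
    by split; [exact: (lt_le_trans cFa (leF _ _ _ ax xb))|rewrite ax xb].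
  rewrite (integral_FTC ab dF cg) (_ : _ `&` _ = `[F a, F b]%classic).
    by rewrite lebesgue_measure_itv/= lte_fin lt_neqAle leF// andbT; case: eqP => //= ->; rewrite subrr.
  apply/seteqP; split => [x []//|x /=]; rewrite !in_itv/= andbT => /andP[ax xb].
  by split; [exact: lt_le_trans ax|rewrite ax xb].
have [Fbc|cFb] := leP (F b) c.
  rewrite (_ : _ `&` _ = set0); last first.
    apply/seteqP; split => // x /=; rewrite !in_itv/= andbT => -[+ /andP[ax xb]].
    by rewrite ltNge (le_trans (leF _ _ ax xb (lexx _)) Fbc).
  rewrite (_ : _ `&` _ = set0) ?integral_set0 ?measure0//.
  apply/seteqP; split => // x /=; rewrite !in_itv/= andbT => -[+ /andP[ax xb]].
  by rewrite ltNge (le_trans xb Fbc).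
(* For [c] inside the range, the preimage of the ray is the interval from the point [t] over [c] to
   [b], and the fundamental theorem of calculus measures it. *)
have [t] : exists2 t, t \in `[a, b] & F t = c.
  apply: IVT => //; first exact: continuous_subspaceT.
  by rewrite (min_idPl _) ?(max_idPr _) ?Fac ?(ltW cFb)//; exact: leF.
rewrite in_itv/= => /andP[at_ tb] Ftc.
rewrite (_ : _ `&` _ = `]t, b]%classic); last first.
  apply/seteqP; split => x /=; rewrite !in_itv/= andbT.
    move=> [cx /andP[ax ->]]; rewrite andbT ltNge; apply/negP => xt.
    by move: cx; rewrite -Ftc ltNge leF.
  by move=> /andP[tx xb]; rewrite xb (le_trans at_ (ltW tx)) -Ftc incrF.
rewrite integral_itv_obnd_cbnd; last exact/measurable_EFinP/measurable_funTS.
rewrite (integral_FTC tb dF cg) (_ : _ `&` _ = `]c, F b]%classic).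
  by rewrite lebesgue_measure_itv/= lte_fin cFb Ftc.
apply/seteqP; split => x /=; rewrite !in_itv/= andbT.
  by move=> [-> /andP[_ ->]].
by move=> /andP[cx ->]; rewrite cx (le_trans Fac (ltW cx)).
Qed.

End substitution.

(** * Half-integer values of Gamma *)

Section gauss_moments.
Local Open Scope ereal_scope.
Context (R : realType).
Local Notation mu := (@lebesgue_measure R).

(** Kept in the extended reals: finiteness is a consequence of the recursion below, not an input to
    it. *)
Definition gauss_moment (k : nat) : \bar R :=
  \int[mu]_(x in `[0%R, +oo[) (x ^+ k * gauss_fun x)%:E.

Lemma is_derive_gauss_fun (x : R) :
  is_derive x 1%R (@gauss_fun R) (- (2 * x * gauss_fun x))%R.
Proof.
apply: is_derive_eq; rewrite /gauss_fun /GRing.scale/=.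
by ring.
Qed.

Lemma gauss_moment0 : gauss_moment 0 = (Num.sqrt pi / 2)%:E.
Proof.
rewrite /gauss_moment -integral0y_gauss; apply: eq_integral => x _.
by rewrite expr0 mul1r.
Qed.

Lemma integral_gauss_tail (x : R) : (0 <= x)%R ->
  \int[mu]_(y in `[x, +oo[) (2 * y * gauss_fun y)%:E = (gauss_fun x)%:E.
Proof.
move=> x0.
have dN (y : R) : is_derive y 1%R (\- @gauss_fun R)%R (2 * y * gauss_fun y)%R.
  have := is_derive_gauss_fun y => h.
  by apply: is_derive_eq; rewrite opprK.
have cN : continuous (\- @gauss_fun R)%R.
  by move=> y; apply: differentiable_continuous; apply/derivable1_diffP/ex_derive.
rewrite (@ge0_continuous_FTC2y _ _ (\- @gauss_fun R)%R _ 0%R)//.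
- by rewrite sub0e /=; congr EFin; rewrite opprK.
- by move=> y xy; rewrite !mulr_ge0 ?gauss_fun_ge0// (le_trans x0).
- apply: continuous_subspaceT => y.
  apply: (@continuousM _ R (fun y : R => 2 * y)%R (@gauss_fun R)).
    by apply: continuousM; [exact: cst_continuous|exact: cvg_id].
  exact: continuous_gauss_fun.
- by rewrite -oppr0; apply: cvgN; exact: cvg_gauss_fun.
- by apply: cvg_at_right_filter; exact: cN.
- by move=> y _; rewrite derive1E derive_val.
Qed.

Lemma integral_monomial (k : nat) (y : R) : (0 <= y)%R ->
  \int[mu]_(x in `[0%R, y]) (x ^+ k)%:E = (y ^+ k.+1 / k.+1%:R)%:E.
Proof.
move=> y0.
have dF (x : R) :
    is_derive x 1%R (k.+1%:R^-1 \*: (fun x : R => x ^+ k.+1))%R (x ^+ k)%R.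
  have dX : is_derive x 1%R (fun x : R => x ^+ k.+1)%R (k.+1%:R * x ^+ k)%R.
    apply: DeriveDef; first exact: exprn_derivable.
    by rewrite exp_derive /GRing.scale/= mulr1.
  apply: is_derive_eq; rewrite /GRing.scale/= mulrA mulVf ?mul1r//.
rewrite (integral_FTC y0 dF); last exact: exprn_continuous.
by rewrite /= expr0n/= scaler0 subr0 /GRing.scale/= mulrC.
Qed.

(** Tonelli replaces integration by parts: x^k 2y exp(-y^2) is integrated over 0 <= x <= y in both
    orders. No boundary term appears and nothing needs to be finite. *)
Lemma gauss_moment_rec (k : nat) :
  k.+1%:R%:E * gauss_moment k = 2%:E * gauss_moment k.+2.
Proof.
pose F (z : R * R) :=
  (if (0 <= z.1)%R && (z.1 <= z.2)%R then z.1 ^+ k * (2 * z.2 * gauss_fun z.2)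
   else 0)%R%:E.
have F0 z : 0 <= F z.
  rewrite /F lee_fin; case: ifP => // /andP[z1 z12].
  by rewrite !mulr_ge0 ?exprn_ge0 ?gauss_fun_ge0// (le_trans z1).
have mF : measurable_fun setT F.
  apply/measurable_EFinP; apply: measurable_fun_ifT => //.
    by apply: measurable_and; apply: measurable_fun_ler.
  apply: measurable_funM; first exact: measurable_funX.
  apply: measurable_funM; first exact: measurable_funM.
  by apply: measurableT_comp => //; exact: measurable_gauss_fun.
have := fubini_tonelli (m1 := mu) (m2 := mu) F mF F0.
have -> : \int[mu]_x fubini_F mu F x = gauss_moment k.
  rewrite /gauss_moment [RHS]integral_mkcond; apply: eq_integral => x _.
  rewrite /fubini_F /F /patch /= mem_setE in_itv/= andbT.
  case: ifPn => [x0|x0]; last by rewrite /= integral0.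
  rewrite EFinM -integral_gauss_tail// -ge0_integralZl//; last 3 first.
  - by apply/measurable_EFinP/measurable_funTS; apply: measurable_funM;
      [exact: measurable_funM|exact: measurable_gauss_fun].
  - move=> y /=; rewrite in_itv/= andbT => xy.
    by rewrite lee_fin !mulr_ge0 ?gauss_fun_ge0// (le_trans x0).
  - by rewrite lee_fin exprn_ge0.
  rewrite [RHS]integral_mkcond; apply: eq_integral => y _.
  by rewrite /patch mem_setE in_itv/= andbT; case: ifP.
have -> : \int[mu]_y fubini_G mu F y = (2 / k.+1%:R)%:E * gauss_moment k.+2.
  rewrite /gauss_moment -ge0_integralZl//; last 2 first.
  - by apply/measurable_EFinP/measurable_funTS; apply: measurable_funM => //; exact: measurable_gauss_fun.
  - move=> y /=; rewrite in_itv/= andbT => y0.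
    by rewrite lee_fin mulr_ge0 ?gauss_fun_ge0// exprn_ge0.
  rewrite [RHS]integral_mkcond; apply: eq_integral => y _.
  rewrite /fubini_G /F /patch /= mem_setE in_itv/= andbT.
  case: ifPn => [y0|y0]; last first.
    rewrite integral0_eq// => x _; case: ifP => // /andP[x0 xy].
    by rewrite (le_trans x0 xy) in y0.
  transitivity (\int[mu]_(x in `[0%R, y]) ((2 * y * gauss_fun y)%:E * (x ^+ k)%:E)).
    rewrite [RHS]integral_mkcond; apply: eq_integral => x _.
    by rewrite /patch mem_setE in_itv/=; case: ifP => // _; rewrite -EFinM mulrC.
  rewrite ge0_integralZl//; last 3 first.
  - exact/measurable_EFinP/measurable_funTS.
  - by move=> x /=; rewrite in_itv/= => /andP[x0 _]; rewrite lee_fin exprn_ge0.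
  - by rewrite lee_fin !mulr_ge0 ?gauss_fun_ge0.
  by rewrite integral_monomial// -!EFinM; congr EFin; rewrite [(y ^+ k.+2)%R]exprS;
      field; rewrite ?(addrC 1%R) ?natr1 pnatr_eq0.
move=> ->; rewrite muleA -EFinM; congr (_%:E * _).
by field; rewrite ?(addrC 1%R) ?natr1 pnatr_eq0.
Qed.

End gauss_moments.

(** Indexing by the doubled argument keeps all Gamma arguments in [nat]. The definition is locked so
    that the integral behind it never unfolds. *)
HB.lock Definition half_gamma (R : realType) (k : nat) : R := gamma_fun (k%:R / 2).

Lemma half_gammaE (R : realType) k : half_gamma R k = gamma_fun (k%:R / 2).
Proof. by rewrite unlock. Qed.

Section half_integer_gamma.
Local Open Scope ereal_scope.
Context (R : realType).
Local Notation mu := (@lebesgue_measure R).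

Lemma is_derive_sqr (x : R) : is_derive x 1%R (fun x : R => x ^+ 2)%R (2 * x)%R.
Proof.
apply: DeriveDef; first exact: exprn_derivable.
by rewrite exp_derive /GRing.scale/= mulr1 expr1.
Qed.

Lemma gamma_integrand_sqr (k : nat) (x : R) : (0 < x)%R ->
  ((x ^+ 2) `^ (k.+1%:R / 2 - 1) * expR (- x ^+ 2) * (2 * x) =
   2 * (x ^+ k * gauss_fun x))%R.
Proof.
move=> x0; rewrite /gauss_fun -powR_mulrn ?ltW// -powRrM.
have -> : (2%:R * (k.+1%:R / 2 - 1) = k%:R - 1 :> R)%R by rewrite -natr1; field.
have -> : (x ^+ k = x `^ (k%:R - 1) * x)%R.
  by rewrite -[X in (_ * X)%R]powRr1 ?ltW// -powRD ?subrK ?powR_mulrn ?ltW// (gt_eqF x0) implybT.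
by rewrite powR_mulrn ?ltW//; ring.
Qed.

(** The substitution u = x^2, carried out on [[0, n]] and passed to the limit. *)
Lemma integral_gamma_gauss (k : nat) :
  \int[mu]_(u in `[0%R, +oo[) (u `^ (k.+1%:R / 2 - 1) * expR (- u))%:E =
  2%:E * gauss_moment R k.
Proof.
set f := fun u : R => (u `^ (k.+1%:R / 2 - 1) * expR (- u))%R.
have f0 u : (0 <= f u)%R by rewrite mulr_ge0 ?powR_ge0 ?expR_ge0.
have mf : measurable_fun setT f.
  apply: measurable_funM; first exact: measurable_powR.
  by apply: measurableT_comp => //; exact: measurableT_comp.
have mg : measurable_fun setT (fun x : R => 2 * (x ^+ k * gauss_fun x))%R.
  apply: measurable_funM => //; apply: measurable_funM => //.
  exact: measurable_gauss_fun.
(* The absolute value makes [g] nonnegative on the whole line, as the exhaustion by [[0, n]]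
   requires. *)
pose g x : R := (2 * (`|x| ^+ k * gauss_fun x))%R.
have g0 x : (0 <= g x)%R.
  by rewrite /g !mulr_ge0 ?exprn_ge0 ?gauss_fun_ge0.
have mg' : measurable_fun setT g.
  apply: measurable_funM => //; apply: measurable_funM => //.
    exact: measurable_funX.
  exact: measurable_gauss_fun.
have -> : 2%:E * gauss_moment R k = \int[mu]_(x in `[0%R, +oo[) (g x)%:E.
  rewrite /gauss_moment -ge0_integralZl//; last 2 first.
  - apply/measurable_EFinP/measurable_funTS; apply: measurable_funM => //.
    exact: measurable_gauss_fun.
  - move=> x /=; rewrite in_itv/= andbT => x0.
    by rewrite lee_fin mulr_ge0 ?gauss_fun_ge0 ?exprn_ge0.
  apply: eq_integral => x; rewrite inE/= in_itv/= andbT => x0.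
  by rewrite /g ger0_norm// -EFinM.
have h1 := ge0_cvgn_integral (mu := mu) g0 mg'.
(* In the variable u the interval [[0, n]] becomes [[0, n ^ 2]], hence the limit along a
   subsequence. *)
have h2 : \int[mu]_(x in `[0%R, (n ^ 2)%N%:R]) (f x)%:E @[n --> \oo] -->
    \int[mu]_(x in `[0%R, +oo[) (f x)%:E.
  apply: (cvg_comp (fun n => n ^ 2)%N
    (fun m => \int[mu]_(x in `[0%R, m%:R]) (f x)%:E) _ (ge0_cvgn_integral (mu := mu) f0 mf)).
  move=> A [N _ NA]; exists N => // m /= Nm; apply: NA => /=.
  by case: m Nm => [//|m] Nm; rewrite (leq_trans Nm)// expnS expn1 leq_pmull.
suff e : (fun n : nat => \int[mu]_(x in `[0%R, (n ^ 2)%N%:R]) (f x)%:E) =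
    (fun n : nat => \int[mu]_(x in `[0%R, n%:R]) (g x)%:E).
  by apply: (cvg_unique _ h2) => //; rewrite e; exact: h1.
apply/funext => n.
have cd : continuous (fun x : R => 2 * x)%R.
  exact: mulrl_continuous.
have d0 (x : R) : (0 <= x <= n%:R)%R -> (0 <= 2 * x)%R.
  by move=> /andP[x0 _]; rewrite mulr_ge0.
have incr (x y : R) : (0 <= x)%R -> (x < y)%R -> (y <= n%:R)%R -> (x ^+ 2 < y ^+ 2)%R.
  by move=> x0 xy yn; rewrite ltr_pXn2r// nnegrE// (le_trans x0 (ltW xy)).
have f0' x : 0 <= (f x)%:E by rewrite lee_fin.
have := ge0_integral_substitution (ler0n _ _) is_derive_sqr cd d0 incr f0'.
rewrite expr0n/= -natrX => <-; last exact/measurable_EFinP.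
(* At [x = 0] the two integrands need not agree, so the left endpoint is dropped on both sides. *)
rewrite -integral_itv_obnd_cbnd; last first.
  apply: emeasurable_funM; first by apply/measurable_EFinP/measurable_funTS; apply: measurableT_comp => //.
  by apply/measurable_EFinP/measurable_funTS; exact: measurable_funM.
rewrite -[RHS]integral_itv_obnd_cbnd; last exact/measurable_EFinP/measurable_funTS.
apply: eq_integral => x; rewrite inE/= in_itv/= => /andP[x0 _].
by rewrite -EFinM /f gamma_integrand_sqr// /g gtr0_norm.
Qed.

Let double_eq (x y : \bar R) : 2%:E * x = y -> x = (2^-1)%:E * y.
Proof. by move=> <-; rewrite muleA -EFinM mulVf ?mul1e. Qed.

Lemma gauss_moment1 : gauss_moment R 1 = (2^-1)%:E.
Proof.
have := integral_gauss_tail (lexx (0%R : R)).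
rewrite [gauss_fun 0%R](_ : _ = 1%R); last by rewrite /gauss_fun expr0n oppr0 expR0.
under eq_integral do rewrite -mulrA EFinM.
rewrite ge0_integralZl//; last 2 first.
- apply/measurable_EFinP/measurable_funTS; apply: measurable_funM => //.
  exact: measurable_gauss_fun.
- by move=> x /=; rewrite in_itv/= andbT => x0; rewrite lee_fin mulr_ge0 ?expR_ge0.
rewrite -/(gauss_moment R 1) => h.
by rewrite (double_eq h) mule1.
Qed.

Lemma gauss_moment_fin_num k : gauss_moment R k \is a fin_num.
Proof.
elim/ltn_ind: k => -[|[|k]] IH.
- by rewrite gauss_moment0.
- by rewrite gauss_moment1.
have := gauss_moment_rec R k; have := IH k (ltnW (ltnSn _)).
move=> /fineK <-; rewrite -EFinM => h.
by rewrite (double_eq (esym h)) -EFinM.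
Qed.

Lemma gauss_momentE k : gauss_moment R k = (half_gamma R k.+1 / 2)%:E.
Proof.
rewrite half_gammaE /gamma_fun integral_itv_obnd_cbnd; last first.
  apply/measurable_EFinP/measurable_funTS; apply: measurable_funM.
    exact: measurable_powR.
  by apply: measurableT_comp => //; exact: measurableT_comp.
rewrite integral_gamma_gauss.
rewrite -{1 2}(fineK (gauss_moment_fin_num k)) -EFinM/=.
by congr EFin; field.
Qed.

Lemma integral_half_gamma k :
  \int[mu]_(u in `[0%R, +oo[) (u `^ (k.+1%:R / 2 - 1) * expR (- u))%:E =
  (half_gamma R k.+1)%:E.
Proof.
by rewrite integral_gamma_gauss gauss_momentE -EFinM; congr EFin; field.
Qed.

Lemma half_gamma1 : half_gamma R 1 = Num.sqrt pi.
Proof.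
have := gauss_momentE 0; rewrite gauss_moment0 => -[] h.
by apply: (@mulIf _ 2^-1%R) => //; rewrite invr_neq0.
Qed.

Lemma half_gamma2 : half_gamma R 2 = 1%R.
Proof.
have := gauss_momentE 1; rewrite gauss_moment1 => -[] h.
by apply: (@mulIf _ 2^-1%R); rewrite ?invr_neq0// -h mul1r.
Qed.

Lemma half_gammaSS k : half_gamma R k.+3 = (k.+1%:R / 2 * half_gamma R k.+1)%R.
Proof.
have := gauss_moment_rec R k; rewrite !gauss_momentE -!EFinM => -[] h.
have -> : (half_gamma R k.+3 = 2 * (half_gamma R k.+3 / 2))%R by field.
by rewrite -h; field.
Qed.

Lemma half_gamma_gt0 k : (0 < half_gamma R k.+1)%R.
Proof.
elim/ltn_ind: k => -[|[|k]] IH.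
- by rewrite half_gamma1 sqrtr_gt0 pi_gt0.
- by rewrite half_gamma2.
by rewrite half_gammaSS mulr_gt0// IH.
Qed.

Lemma half_gamma_neq0 k : half_gamma R k.+1 != 0%R.
Proof. by rewrite gt_eqF// half_gamma_gt0. Qed.

Lemma integral_even_gauss j :
  \int[mu]_x (x ^+ (2 * j) * gauss_fun x)%:E = (half_gamma R (2 * j).+1)%:E.
Proof.
rewrite ge0_symfun_integralT//.
- rewrite (_ : [set x | _] = `[0%R, +oo[%classic); last first.
    by apply/seteqP; split => x/=; rewrite in_itv/= andbT.
  by rewrite -/(gauss_moment R (2 * j)) gauss_momentE -EFinM; congr EFin; field.
- move=> x; apply: mulr_ge0; last exact: gauss_fun_ge0.
  by rewrite exprM; apply: exprn_ge0; exact: sqr_ge0.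
- move=> x; apply: (@continuousM R R (fun x => x ^+ (2 * j))%R (@gauss_fun R)); first exact: exprn_continuous.
  exact: continuous_gauss_fun.
- by move=> x /=; rewrite /gauss_fun !exprM sqrrN.
Qed.

End half_integer_gamma.

(** * Laplace transforms of the terms of the density *)

Section half_kernel.
Local Open Scope ereal_scope.
Context (R : realType).
Local Notation mu := (@lebesgue_measure R).

(* The kernel whose Laplace transform is [z |-> z `^ (- (h + 1) / 2)]. *)
Definition riesz (h : nat) (w : R) : R :=
  (if 0 < w then w `^ ((h%:R - 1) / 2) / half_gamma R h.+1 else 0)%R.

Lemma riesz_ge0 h w : (0 <= riesz h w)%R.
Proof.
by rewrite /riesz; case: ifP => // _; rewrite divr_ge0 ?powR_ge0// ltW// half_gamma_gt0.
Qed.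

Lemma measurable_riesz h : measurable_fun setT (riesz h).
Proof.
apply: measurable_fun_ifT => //; first exact: measurable_fun_ltr.
by apply: measurable_funM => //; exact: measurable_powR.
Qed.

Lemma riesz_le0 h w : (w <= 0)%R -> riesz h w = 0%R.
Proof. by rewrite /riesz ltNge => ->. Qed.

Lemma rieszM h a w : (0 < a)%R ->
  riesz h (a * w) = (a `^ ((h%:R - 1) / 2) * riesz h w)%R.
Proof.
move=> a0; rewrite /riesz pmulr_rgt0//; case: ifP => w0; last by rewrite mulr0.
by rewrite powRM ?ltW// mulrA.
Qed.

Lemma integral_riesz_expR h : \int[mu]_w (riesz h w * expR (- w))%:E = 1.
Proof.
transitivity (\int[mu]_(w in `]0%R, +oo[)
   ((half_gamma R h.+1)^-1%:E * (w `^ (h.+1%:R / 2 - 1) * expR (- w))%:E)).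
  rewrite [RHS]integral_mkcond; apply: eq_integral => w _.
  rewrite /patch mem_setE in_itv/= andbT /riesz; case: ifP; last by rewrite mul0r.
  move=> _; rewrite -EFinM; congr EFin.
  have -> : (h.+1%:R / 2 - 1 = (h%:R - 1) / 2 :> R)%R by rewrite -natr1; field.
  by ring.
have mf : measurable_fun setT (fun u : R => (u `^ (h.+1%:R / 2 - 1) * expR (- u))%R).
  apply: measurable_funM; first exact: measurable_powR.
  by apply: measurableT_comp => //; exact: measurableT_comp.
rewrite ge0_integralZl//.
- rewrite integral_itv_obnd_cbnd; last exact/measurable_EFinP/measurable_funTS.
  by rewrite integral_half_gamma -EFinM mulVf// half_gamma_neq0.
- exact/measurable_EFinP/measurable_funTS.
- by move=> w _; rewrite lee_fin mulr_ge0 ?powR_ge0 ?expR_ge0.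
- by rewrite lee_fin invr_ge0 ltW// half_gamma_gt0.
Qed.

End half_kernel.

(** * Series with nonnegative terms *)

Section nneseries_tools.
Local Open Scope ereal_scope.
Context (R : realType).

(** Cauchy's rearrangement: the inner index is shifted to [i = m + l], extended by zero below [m],
    and the sums are exchanged. *)
Lemma nneseries_diag (f : nat -> nat -> \bar R) : (forall m l, 0 <= f m l) ->
  \sum_(m <oo) \sum_(l <oo) f m l = \sum_(i <oo) \sum_(m < i.+1) f m (i - m)%N.
Proof.
move=> f0.
transitivity (\sum_(m <oo) \sum_(i <oo) (if (m <= i)%N then f m (i - m)%N else 0)).
  apply: eq_eseriesr => m _; rewrite [RHS](nneseries_split _ m); last first.
    by move=> k _; case: ifP.
  rewrite add0n big1_seq ?add0e; last first.
    by move=> k /=; rewrite mem_index_iota => /andP[_ km]; rewrite leqNgt km.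
  rewrite -(nneseries_addn m (f := fun i => if (m <= i)%N then f m (i - m)%N else 0)); last first.
    by move=> k; case: ifP.
  by apply: eq_eseriesr => k _; rewrite leq_addl addnK.
rewrite nneseries_interchange; last by move=> m i; case: ifP.
apply: eq_eseriesr => i _; rewrite (nneseries_split _ i.+1); last first.
  by move=> k _; case: ifP.
rewrite add0n [X in _ + X]eseries0 ?adde0; last first.
  by move=> k ik _; rewrite leqNgt ik.
by rewrite big_mkord; apply: eq_bigr => m _; rewrite -ltnS ltn_ord.
Qed.

Lemma nneseries_EFin (u : nat -> R) (l : R) :
  series u @ \oo --> l -> \sum_(n <oo) (u n)%:E = l%:E.
Proof.
move=> ul; apply/cvg_lim => //.
rewrite (_ : (fun _ => _) = EFin \o series u); last first.
  by apply/funext => n; rewrite /series/= sumEFin.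
by apply: cvg_EFin => //; exact: nearW.
Qed.

Lemma nneseries_cosh (y : R) :
  \sum_(l <oo) (exp_coeff y (2 * l)%N)%:E = ((expR y + expR (- y)) / 2)%:E.
Proof.
apply: nneseries_EFin.
have cvg2 (x : R) : series (exp_coeff x) (2 * n)%N @[n --> \oo] --> expR x.
  apply: (cvg_comp (fun n => 2 * n)%N (series (exp_coeff x)) _
     (is_cvg_series_exp_coeff x)).
  move=> A [N _ NA]; exists N => // m /= Nm; apply: NA => /=.
  by rewrite (leq_trans Nm)// leq_pmull.
rewrite (_ : series _ = (fun n => (series (exp_coeff y) (2 * n)%N +
   series (exp_coeff (- y)) (2 * n)%N) / 2)%R).
  by apply: cvgM; [apply: cvgD; exact: cvg2|exact: cvg_cst].
apply/funext; elim=> [|n IH]; first by rewrite /series/= muln0 !big_geq ?addr0 ?mul0r.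
rewrite seriesSr IH mulnS add2n !seriesSr /exp_coeff/= exprNn exprNn.
by rewrite !exprS !exprM !sqrrN !expr1n; field; rewrite !pnatr_eq0 -!lt0n !fact_gt0.
Qed.

Lemma exp_coeffD (x y : R) n :
  exp_coeff (x + y)%R n = (\sum_(m < n.+1) exp_coeff x m * exp_coeff y (n - m)%N)%R.
Proof.
rewrite /exp_coeff/= addrC exprDn mulr_suml; apply: eq_bigr => -[m /=]; rewrite ltnS => mn _.
rewrite -mulr_natr.
have -> : (n`!%:R = 'C(n, m)%:R * (m`!%:R * (n - m)`!%:R) :> R)%R.
  by rewrite -!natrM bin_fact.
by field; rewrite !pnatr_eq0 -!lt0n !fact_gt0 bin_gt0.
Qed.

End nneseries_tools.

(** * One-dimensional integrals of the kernels *)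

Section beta_integrals.
Local Open Scope ereal_scope.
Context (R : realType).
Local Notation mu := (@lebesgue_measure R).
Local Notation G := (half_gamma R).

Lemma measurable_riesz_comp d (T : measurableType d) h (f : T -> R) :
  measurable_fun setT f -> measurable_fun setT (fun x => riesz h (f x)).
Proof. by move=> mf; apply: measurableT_comp => //; exact: measurable_riesz. Qed.

(** A Beta integral. Scaling shows that the left side is a constant times a power of [w]; the
    constant is found by integrating in [w] against exp(-w), where the double integral splits into a
    Gaussian moment and the normalization of [riesz]. *)
Lemma integral_even_riesz j h (w : R) :
  \int[mu]_x (x ^+ (2 * j) * riesz h (w - x ^+ 2))%:E =
  (G (2 * j).+1 * riesz (h + 2 * j).+1 w)%:E.
Proof.
have f0 w' (x : R) : (0 <= x ^+ (2 * j) * riesz h (w' - x ^+ 2))%R.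
  by apply: mulr_ge0; rewrite ?riesz_ge0// exprM exprn_ge0// sqr_ge0.
have mf w' : measurable_fun setT (fun x : R => x ^+ (2 * j) * riesz h (w' - x ^+ 2))%R.
  apply: measurable_funM; first exact: measurable_funX.
  by apply: measurable_riesz_comp; apply: measurable_funB.
have mfE w' : measurable_fun setT (fun x : R => (x ^+ (2 * j) * riesz h (w' - x ^+ 2))%:E).
  exact/measurable_EFinP.
(* The unknown constant, possibly infinite for now; it is solved for in the extended reals at the
   end. *)
pose B := \int[mu]_y (y ^+ (2 * j) * riesz h (1 - y ^+ 2))%:E.
have scaleB (v : R) : (0 < v)%R ->
    \int[mu]_x (x ^+ (2 * j) * riesz h (v - x ^+ 2))%:E =
    (v `^ ((h + 2 * j)%:R / 2))%:E * B.
  move=> v0; have [a a0 va] : exists2 a : R, (0 < a)%R & (v = a ^+ 2)%R.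
    by exists (Num.sqrt v); rewrite ?sqrtr_gt0// sqr_sqrtr// ltW.
  rewrite -(ge0_integral_lebesgue_scale a0); last 2 first.
  - by move=> x; rewrite lee_fin.
  - exact: mfE.
  transitivity (\int[mu]_x (a * ((a * x) ^+ (2 * j) * riesz h (v - (a * x) ^+ 2)))%:E).
    have ma : measurable_fun setT (fun x : R => a * x)%R by exact: measurable_funM.
    by rewrite (ge0_integralMl mu (ltW a0) (fun x => f0 v (a * x)%R) (measurableT_comp (mf v) ma)).
  transitivity (\int[mu]_x (v `^ ((h + 2 * j)%:R / 2) *
      (x ^+ (2 * j) * riesz h (1 - x ^+ 2)))%:E); last first.
    exact: (ge0_integralMl mu (powR_ge0 _ _) (f0 1%R) (mf 1%R)).
  apply: eq_integral => x _; congr EFin.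
  have -> : (v - (a * x) ^+ 2 = v * (1 - x ^+ 2))%R by rewrite va; ring.
  rewrite rieszM// exprMn.
  have <- : (a * a ^+ (2 * j) * v `^ ((h%:R - 1) / 2) = v `^ ((h + 2 * j)%:R / 2))%R.
    rewrite va -exprS -!powR_mulrn ?(ltW a0)// -!powRrM.
    rewrite -powRD; last by rewrite (gt_eqF a0) implybT.
    by congr (_ `^ _)%R; rewrite -natr1 natrD; field.
  by ring.
have B0 : 0 <= B by apply: integral_ge0 => x _; rewrite lee_fin.
clearbody B.
suff BE : B = (G (2 * j).+1 / G (h + 2 * j).+2)%:E.
  have [w0|w0] := ltP 0%R w.
    rewrite scaleB// BE -EFinM /riesz w0; congr EFin.
    have -> : ((h + 2 * j).+1%:R - 1 = (h + 2 * j)%:R :> R)%R by rewrite -natr1 addrK.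
    by ring.
  rewrite riesz_le0// mulr0 integral0_eq// => x _.
  by rewrite riesz_le0 ?mulr0// (le_trans _ w0)// lerBlDr lerDl sqr_ge0.
(* Here [z.1] plays the role of [w]. Integrating over [z.2] first gives a Gamma value times [B];
   integrating over [z.1] first, shifted by [z.2 ^+ 2], gives the Gaussian moment. *)
pose F (z : R * R) := (z.2 ^+ (2 * j) * riesz h (z.1 - z.2 ^+ 2) * expR (- z.1))%:E.
have F0 z : 0 <= F z.
  by rewrite lee_fin; apply: mulr_ge0; [exact: f0|exact: expR_ge0].
have mF : measurable_fun setT F.
  apply/measurable_EFinP; apply: measurable_funM.
    apply: measurable_funM; first exact: measurable_funX.
    by apply: measurable_riesz_comp; apply: measurable_funB => //; exact: measurable_funX.
  by apply: measurableT_comp => //; exact: measurableT_comp.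
have e1 : \int[mu]_x fubini_F mu F x = (G (h + 2 * j).+2)%:E * B.
  have mr : measurable_fun setT (fun v : R => riesz (h + 2 * j).+1 v * expR (- v))%R.
    apply: measurable_funM; first exact: measurable_riesz.
    by apply: measurableT_comp => //; exact: measurableT_comp.
  transitivity (\int[mu]_v ((G (h + 2 * j).+2)%:E * B *
      (riesz (h + 2 * j).+1 v * expR (- v))%:E)); last first.
    rewrite ge0_integralZl; first by rewrite integral_riesz_expR mule1.
    - exact: measurableT.
    - exact/measurable_EFinP.
    - by move=> x _; rewrite lee_fin mulr_ge0 ?riesz_ge0 ?expR_ge0.
    - apply: mule_ge0; last exact: B0.
      by rewrite lee_fin ltW// half_gamma_gt0.
  apply: eq_integral => v _; rewrite /fubini_F /F/=.
  under eq_integral do rewrite mulrC.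
  rewrite (ge0_integralMl mu (expR_ge0 _) (f0 v) (mf v)).
  have [v0|v0] := ltP 0%R v.
    rewrite scaleB// /riesz v0.
    have -> : ((h + 2 * j).+1%:R - 1 = (h + 2 * j)%:R :> R)%R by rewrite -natr1 addrK.
    rewrite [RHS]muleAC -EFinM muleA -EFinM; congr (_%:E * _).
    by field; exact: half_gamma_neq0.
  rewrite [riesz _ v]riesz_le0// mul0r mule0 integral0_eq ?mule0// => x _.
  by rewrite riesz_le0 ?mulr0// (le_trans _ v0)// lerBlDr lerDl sqr_ge0.
have e2 : \int[mu]_y fubini_G mu F y = (G (2 * j).+1)%:E.
  rewrite -integral_even_gauss; apply: eq_integral => x _.
  rewrite /fubini_G /F/=.
  rewrite -(ge0_integral_lebesgue_shift (x ^+ 2)%R); last 2 first.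
  - by move=> v; exact: (F0 (v, x)).
  - exact: (measurableT_comp mF (pair2_measurable x)).
  have mr : measurable_fun setT (fun v : R => riesz h v * expR (- v))%R.
    apply: measurable_funM; first exact: measurable_riesz.
    by apply: measurableT_comp => //; exact: measurableT_comp.
  transitivity (\int[mu]_v (x ^+ (2 * j) * gauss_fun x * (riesz h v * expR (- v)))%:E); last first.
    rewrite ge0_integralMl; first by rewrite integral_riesz_expR mule1.
    - by rewrite mulr_ge0 ?gauss_fun_ge0// exprM exprn_ge0// sqr_ge0.
    - by move=> v; rewrite mulr_ge0 ?riesz_ge0 ?expR_ge0.
    - exact: mr.
  apply: eq_integral => v _; congr EFin.
  by rewrite /= addrK opprD expRD /gauss_fun; ring.
have FG := fubini_tonelli (m1 := mu) (m2 := mu) F mF F0.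
have h1 := etrans (esym e1) (etrans FG e2).
move: h1 (half_gamma_neq0 R (h + 2 * j).+1); clear.
move=> h1 G0; transitivity (((G (h + 2 * j).+2)^-1)%:E * ((G (h + 2 * j).+2)%:E * B)).
  by rewrite muleA -EFinM mulVf ?mul1e.
by rewrite h1 -EFinM mulrC.
Qed.

End beta_integrals.

Section exponential_integrals.
Local Open Scope ereal_scope.
Context (R : realType).
Local Notation mu := (@lebesgue_measure R).
Local Notation G := (half_gamma R).

Lemma ge0_integral_lebesgue_opp (f : R -> \bar R) :
  (forall x, 0 <= f x) -> measurable_fun setT f ->
  \int[mu]_x f (- x)%R = \int[mu]_x f x.
Proof.
move=> f0 mf.
have mN : measurable_fun setT (fun x : measurableTypeR R => (- x)%R : measurableTypeR R).
  exact: measurable_funN.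
transitivity (\int[pushforward mu (fun x : measurableTypeR R => (- x)%R : measurableTypeR R)]_x f x).
  by rewrite (ge0_integral_pushforward mN mu measurableT mf).
by apply: eq_measure_integral => A mA _; exact: lebesgue_measureN.
Qed.

Lemma exp_coeff_even_ge0 (p : R) l : (0 <= exp_coeff p (2 * l)%N)%R.
Proof. by rewrite /exp_coeff/= divr_ge0// exprM exprn_ge0// sqr_ge0. Qed.

(** Averaging over [x] and [- x] replaces exp(px) by cosh(px), whose terms are nonnegative, so that
    termwise integration is monotone convergence. *)
Lemma ge0_integral_even_expR (f : R -> R) (p : R) :
  (forall x, 0 <= f x)%R -> measurable_fun setT f ->
  (forall x, f (- x) = f x)%R ->
  \int[mu]_x (f x * expR (p * x))%:E =
  \sum_(l <oo) (exp_coeff p (2 * l)%N)%:E * \int[mu]_x (x ^+ (2 * l) * f x)%:E.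
Proof.
move=> f0 mf evf.
have me (q : R) : measurable_fun setT (fun x : R => f x * expR (q * x))%R.
  by apply: measurable_funM => //; apply: measurableT_comp => //; exact: measurable_funM.
have fe0 (q x : R) : (0 <= f x * expR (q * x))%R by rewrite mulr_ge0 ?expR_ge0.
have opp : \int[mu]_x (f x * expR (- p * x))%:E = \int[mu]_x (f x * expR (p * x))%:E.
  rewrite -[RHS]ge0_integral_lebesgue_opp; last 2 first.
  - by move=> x; rewrite lee_fin.
  - exact/measurable_EFinP.
  by apply: eq_integral => x _; rewrite evf mulrN mulNr.
transitivity (\int[mu]_x (2^-1 * (f x * expR (p * x) + f x * expR (- p * x)))%:E).
  have fee0 x : (0 <= f x * expR (p * x) + f x * expR (- p * x))%R by rewrite addr_ge0.
  rewrite (ge0_integralMl mu _ fee0 (measurable_funD (me p) (me _)))//.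
  rewrite (ge0_integralD_EFin mu (fe0 p) (me p) (fe0 _) (me _)).
  by rewrite opp -mule2n -mule_natl muleA -EFinM mulVf ?mul1e.
have mt l : measurable_fun setT (fun x : R => x ^+ (2 * l) * f x)%R.
  by apply: measurable_funM => //; exact: measurable_funX.
have t0 l (x : R) : (0 <= x ^+ (2 * l) * f x)%R.
  by rewrite mulr_ge0// exprM exprn_ge0// sqr_ge0.
transitivity (\int[mu]_x \sum_(l <oo) (exp_coeff p (2 * l)%N * (x ^+ (2 * l) * f x))%:E).
  apply: eq_integral => x _.
  transitivity ((f x)%:E * \sum_(l <oo) (exp_coeff (p * x) (2 * l)%N)%:E).
    by rewrite nneseries_cosh -EFinM mulNr; congr EFin; ring.
  rewrite -nneseriesZl; last by move=> l _; rewrite lee_fin exp_coeff_even_ge0.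
  by apply: eq_eseriesr => l _; rewrite -EFinM; congr EFin; rewrite /exp_coeff/= exprMn; ring.
have mct l : measurable_fun setT
    (fun x : R => (exp_coeff p (2 * l)%N * (x ^+ (2 * l) * f x))%:E).
  by apply/measurable_EFinP; exact: (measurable_funM (measurable_cst _) (mt l)).
have ct0 l (x : R) : [set: R] x ->
    0 <= (exp_coeff p (2 * l)%N * (x ^+ (2 * l) * f x))%:E.
  by move=> _; rewrite lee_fin mulr_ge0 ?exp_coeff_even_ge0.
rewrite (integral_nneseries mu measurableT mct ct0).
apply: eq_eseriesr => l _.
exact: (ge0_integralMl mu (exp_coeff_even_ge0 _ _) (t0 l) (mt l)).
Qed.

Lemma integral_riesz_expR_even k h (w p : R) :
  \int[mu]_x (x ^+ (2 * k) * riesz h (w - x ^+ 2) * expR (p * x))%:E =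
  \sum_(l <oo) (exp_coeff p (2 * l)%N * G (2 * (l + k)).+1 *
                riesz (h + 2 * (l + k)).+1 w)%:E.
Proof.
rewrite (@ge0_integral_even_expR (fun x => x ^+ (2 * k) * riesz h (w - x ^+ 2))%R).
- apply: eq_eseriesr => l _; rewrite -mulrA [RHS]EFinM -integral_even_riesz.
  by congr (_ * _); apply: eq_integral => x _; rewrite mulrA -exprD mulnDr.
- move=> x; apply: mulr_ge0; rewrite ?riesz_ge0// exprM exprn_ge0//.
  exact: sqr_ge0.
- apply: measurable_funM; first exact: measurable_funX.
  by apply: measurable_riesz_comp; apply: measurable_funB.
- by move=> x; rewrite exprM sqrrN -exprM.
Qed.

Lemma half_gamma_odd l :
  G (2 * l).+1 = (Num.sqrt pi * (2 * l)`!%:R / (4 ^+ l * l`!%:R))%R.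
Proof.
elim: l => [|l IH].
  by rewrite muln0 half_gamma1 !fact0 expr0 !mulr1 divr1.
rewrite mulnS add2n half_gammaSS IH !factS !natrM exprS.
have -> : ((2 * l).+2%:R = 2 * l.+1%:R :> R)%R by rewrite -natrM mulnS.
by field; rewrite (addrC 1%R) natr1 !pnatr_eq0 -!lt0n fact_gt0 expf_neq0.
Qed.

(** The factorial of 2l cancels, and an even series in [p] becomes an exponential series in p^2 / 4,
    the variable of [bessel_kernel]. *)
Lemma exp_coeff_half_gamma (p : R) l :
  (exp_coeff p (2 * l)%N * G (2 * l).+1 =
   Num.sqrt pi * exp_coeff (p ^+ 2 / 4) l)%R.
Proof.
rewrite half_gamma_odd /exp_coeff/= exprMn exprVn -exprM.
by field; rewrite !pnatr_eq0 -!lt0n !fact_gt0 expf_neq0.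
Qed.

(* [bessel_kernel h r w] is, up to a constant, [(w / r) `^ (c / 2) I_c (sqrt (r w))]
   for [c = (h - 1) / 2], with [I_c] the modified Bessel function. *)
Definition bessel_kernel (h : nat) (r w : R) : \bar R :=
  \sum_(m <oo) (exp_coeff (r / 4)%R m * riesz (h + 2 * m) w)%:E.

Lemma exp_coeff_ge0 (x : R) m : (0 <= x)%R -> (0 <= exp_coeff x m)%R.
Proof. by move=> x0; rewrite /exp_coeff/= divr_ge0// exprn_ge0. Qed.

Lemma exp_coeff_riesz_ge0 (r : R) m h w : (0 <= r)%R ->
  (0 <= exp_coeff (r / 4) m * riesz h w)%R.
Proof.
move=> r0; apply: mulr_ge0; last exact: riesz_ge0.
by apply: exp_coeff_ge0; rewrite divr_ge0.
Qed.

Lemma bessel_kernel_ge0 h r w : (0 <= r)%R -> 0 <= bessel_kernel h r w.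
Proof.
by move=> r0; apply: nneseries_ge0 => m _ _; rewrite lee_fin exp_coeff_riesz_ge0.
Qed.

Lemma bessel_kernel_le0 h r w : (w <= 0)%R -> bessel_kernel h r w = 0.
Proof. by move=> w0; apply: eseries0 => m _ _; rewrite riesz_le0 ?mulr0. Qed.

Lemma measurable_bessel_kernel h r : (0 <= r)%R ->
  measurable_fun setT (bessel_kernel h r).
Proof.
move=> r0; apply: (ge0_emeasurable_sum (P := xpredT)) => //.
- by move=> m w _ _; rewrite lee_fin exp_coeff_riesz_ge0.
- move=> m _; apply/measurable_EFinP; apply: measurable_funM => //.
  exact: measurable_riesz.
Qed.

(** Formally the kernel is exp(r S / 4) applied to [riesz h], where S raises the index by 2, so the
    parameters add. On the diagonals of the double series this is the binomial theorem. *)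
Lemma bessel_kernelD h (r q w : R) : (0 <= r)%R -> (0 <= q)%R ->
  \sum_(l <oo) (exp_coeff (q / 4)%R l)%:E * bessel_kernel (h + 2 * l) r w =
  bessel_kernel h (r + q) w.
Proof.
move=> r0 q0.
have c0 l : (0 <= exp_coeff (q / 4) l)%R by apply: exp_coeff_ge0; rewrite divr_ge0.
transitivity (\sum_(l <oo) \sum_(m <oo)
  (exp_coeff (q / 4) l * (exp_coeff (r / 4) m * riesz (h + 2 * l + 2 * m) w))%:E).
  apply: eq_eseriesr => l _; rewrite -nneseriesZl//.
  by move=> m _; rewrite lee_fin exp_coeff_riesz_ge0.
rewrite nneseries_diag; last first.
  by move=> l m; rewrite lee_fin mulr_ge0// exp_coeff_riesz_ge0.
apply: eq_eseriesr => i _; rewrite sumEFin; congr EFin.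
rewrite mulrDl addrC exp_coeffD mulr_suml; apply: eq_bigr => -[m /=].
by rewrite ltnS => mi _; rewrite mulrA -addnA -mulnDr subnKC.
Qed.

(** The engine of all the space integrals: removing one coordinate raises the index by one and adds
    its p^2 to [r], which is why transforms of radial functions depend on |p|^2 only. *)
Lemma integral_bessel_kernel_expR h (r p w : R) : (0 <= r)%R ->
  \int[mu]_x (bessel_kernel h r (w - x ^+ 2) * (expR (p * x))%:E) =
  (Num.sqrt pi)%:E * bessel_kernel h.+1 (r + p ^+ 2) w.
Proof.
move=> r0.
have c0 m : (0 <= exp_coeff (r / 4) m)%R by apply: exp_coeff_ge0; rewrite divr_ge0.
have mw i : measurable_fun setT (fun x : R => riesz i (w - x ^+ 2) * expR (p * x))%R.
  apply: measurable_funM; first by apply: measurable_riesz_comp; exact: measurable_funB.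
  by apply: measurableT_comp => //; exact: measurable_funM.
have w0 i (x : R) : (0 <= riesz i (w - x ^+ 2) * expR (p * x))%R.
  by rewrite mulr_ge0 ?riesz_ge0 ?expR_ge0.
transitivity (\int[mu]_x \sum_(m <oo) (exp_coeff (r / 4)%R m *
    (riesz (h + 2 * m) (w - x ^+ 2) * expR (p * x)))%:E).
  apply: eq_integral => x _; rewrite muleC -nneseriesZl; last first.
    by move=> m _; rewrite lee_fin exp_coeff_riesz_ge0.
  by apply: eq_eseriesr => m _; rewrite -EFinM; congr EFin; ring.
have mct m : measurable_fun setT (fun x : R => (exp_coeff (r / 4)%R m *
    (riesz (h + 2 * m) (w - x ^+ 2) * expR (p * x)))%:E).
  by apply/measurable_EFinP; exact: (measurable_funM (measurable_cst _) (mw _)).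
have ct0 m (x : R) : [set: R] x ->
    0 <= (exp_coeff (r / 4)%R m * (riesz (h + 2 * m) (w - x ^+ 2) * expR (p * x)))%:E.
  by move=> _; rewrite lee_fin mulr_ge0.
rewrite (integral_nneseries mu measurableT mct ct0).
rewrite addrC -bessel_kernelD ?sqr_ge0// -nneseriesZl; last first.
  move=> l _; rewrite mule_ge0 ?lee_fin ?exp_coeff_ge0 ?divr_ge0 ?sqr_ge0//.
  by rewrite bessel_kernel_ge0// sqr_ge0.
apply: eq_eseriesr => m _.
rewrite (ge0_integralMl mu (c0 m) (w0 _) (mw _)) muleCA; congr (_ * _).
rewrite /bessel_kernel -nneseriesZl; last first.
  by move=> l _; rewrite lee_fin exp_coeff_riesz_ge0// sqr_ge0.
(* A trivial zeroth power is inserted to match the even-moment formula at [k = 0]. *)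
under eq_integral do rewrite -[riesz _ _]mul1r -(expr0 (1%R : R)).
have := integral_riesz_expR_even 0 (h + 2 * m) w p; rewrite muln0 => ->.
apply: eq_eseriesr => l _; rewrite -EFinM addn0 exp_coeff_half_gamma mulrA.
by rewrite !addSn mulrA /exp_coeff/= mulrA.
Qed.

End exponential_integrals.

(** * Laplace transforms on R^m, one coordinate at a time *)

Section tuple_laplace.
Local Open Scope ereal_scope.
Context (R : realType).
Local Notation mu := (@lebesgue_measure R).
Local Notation G := (half_gamma R).
Local Notation spi := (Num.sqrt (pi : R)).

(** The parameter [p] is a sequence rather than a tuple, so that dropping the first coordinate is
    just [p \o succn] and one [p] serves every dimension. *)
Definition dotp (p : nat -> R) m (x : m.-tuple R) : R := (\sum_(i < m) p i * x`_i)%R.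
Definition sqn m (x : m.-tuple R) : R := (\sum_(i < m) x`_i ^+ 2)%R.
Definition sqp (p : nat -> R) m : R := (\sum_(i < m) p i ^+ 2)%R.

Lemma sqp_ge0 p m : (0 <= sqp p m)%R.
Proof. by apply: sumr_ge0 => i _; exact: sqr_ge0. Qed.

Lemma sqpS p m : (sqp p m.+1 = sqp (p \o succn) m + p 0%N ^+ 2)%R.
Proof. by rewrite /sqp big_ord_recl addrC. Qed.

Lemma sqn_ge0 m (x : m.-tuple R) : (0 <= sqn x)%R.
Proof. by apply: sumr_ge0 => i _; exact: sqr_ge0. Qed.

Lemma enormE m (x : m.-tuple R) : enorm x = Num.sqrt (sqn x).
Proof. by congr Num.sqrt; apply: eq_bigr => i _; rewrite (tnth_nth 0%R). Qed.

Lemma sqn_consp m x0 (x : m.-tuple R) : sqn (consp (x0, x)) = (x0 ^+ 2 + sqn x)%R.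
Proof. by rewrite /sqn big_ord_recl. Qed.

Lemma dotp_consp p m x0 (x : m.-tuple R) :
  dotp p (consp (x0, x)) = (p 0%N * x0 + dotp (p \o succn) x)%R.
Proof. by rewrite /dotp big_ord_recl. Qed.

Lemma measurable_tuple_nth m j : measurable_fun setT (fun x : m.-tuple R => x`_j : R).
Proof.
have [jm|jm] := ltnP j m.
  rewrite (_ : (fun x => _) = (fun x => tnth x (Ordinal jm))).
    exact: measurable_tnth.
  by apply/funext => x /=; rewrite (tnth_nth 0%R).
rewrite (_ : (fun x => _) = cst 0%R)//.
by apply/funext => x /=; rewrite nth_default// size_tuple.
Qed.

Lemma measurable_sqn m : measurable_fun setT (@sqn m).
Proof.
by apply: measurable_sum => i; apply: measurable_funX; exact: measurable_tuple_nth.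
Qed.

Lemma measurable_dotp p m : measurable_fun setT (@dotp p m).
Proof.
by apply: measurable_sum => i; apply: measurable_funM => //; exact: measurable_tuple_nth.
Qed.

Lemma bessel_kernel0 h (w : R) : bessel_kernel h 0 w = (riesz h w)%:E.
Proof.
rewrite /bessel_kernel (nneseries_split _ 1); last first.
  by move=> k _; rewrite lee_fin exp_coeff_riesz_ge0.
rewrite add0n big_nat1 [X in _ + X]eseries0 ?adde0.
  by rewrite /exp_coeff/= expr0 fact0 divr1 mul1r muln0 addn0.
by move=> [//|k] _ _; rewrite /exp_coeff/= mul0r expr0n/= !mul0r.
Qed.

Lemma measurable_riesz_tuple (p : nat -> R) m k h (w : R) :
  measurable_fun setT (fun x : m.+1.-tuple R =>
    x`_m ^+ (2 * k) * riesz h (w - sqn x) * expR (dotp p x))%R.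
Proof.
apply: measurable_funM.
  apply: measurable_funM; first by apply: measurable_funX; exact: measurable_tuple_nth.
  by apply: measurable_riesz_comp; apply: measurable_funB => //; exact: measurable_sqn.
by apply: measurableT_comp => //; exact: measurable_dotp.
Qed.

Lemma riesz_tuple_ge0 (p : nat -> R) m k h (w : R) (x : m.+1.-tuple R) :
  (0 <= x`_m ^+ (2 * k) * riesz h (w - sqn x) * expR (dotp p x))%R.
Proof.
apply: mulr_ge0; last exact: expR_ge0.
by apply: mulr_ge0; rewrite ?riesz_ge0// exprM exprn_ge0// sqr_ge0.
Qed.

Lemma exp_coeff_even_gamma_ge0 (p : R) l k : (0 <= exp_coeff p (2 * l)%N * G k.+1)%R.
Proof.
apply: mulr_ge0; first exact: exp_coeff_even_ge0.
exact: (ltW (half_gamma_gt0 R k)).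
Qed.

(** The induction removes coordinates from the front, so the last one, which carries the power, is
    the base case. Its series in [l] is deliberately left unsummed: the constants a_(k,M) act on it
    for each [l] separately. *)
Lemma integral_riesz_tuple (p : nat -> R) m k h (w : R) :
  \int[lebesgue_tuple m.+1]_x
    (x`_m ^+ (2 * k) * riesz h (w - sqn x) * expR (dotp p x))%:E =
  \sum_(l <oo) (exp_coeff (p m) (2 * l)%N * G (2 * (l + k)).+1)%:E *
     ((spi ^+ m)%:E * bessel_kernel (h + 2 * (l + k) + m).+1 (sqp p m) w).
Proof.
elim: m p w => [|m IH] p w.
  rewrite ge0_integral_lebesgue_tupleS; last 2 first.
  - by move=> x; rewrite lee_fin; exact: riesz_tuple_ge0.
  - by apply/measurable_EFinP; exact: measurable_riesz_tuple.
  transitivity (\int[mu]_x (x ^+ (2 * k) * riesz h (w - x ^+ 2) * expR (p 0%N * x))%:E).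
    apply: eq_integral => x _; rewrite ge0_integral_lebesgue_tuple0; last first.
      by move=> y; rewrite lee_fin; exact: riesz_tuple_ge0.
    by rewrite sqn_consp dotp_consp /sqn /dotp !big_ord0 !addr0.
  rewrite integral_riesz_expR_even; apply: eq_eseriesr => l _.
  by rewrite /sqp big_ord0 bessel_kernel0 expr0 mul1e addn0.
rewrite ge0_integral_lebesgue_tupleS; last 2 first.
- by move=> x; rewrite lee_fin; exact: riesz_tuple_ge0.
- by apply/measurable_EFinP; exact: measurable_riesz_tuple.
pose c l := (exp_coeff (p m.+1) (2 * l)%N * G (2 * (l + k)).+1)%R.
have c0 l : (0 <= c l)%R by exact: exp_coeff_even_gamma_ge0.
pose K l x := (spi ^+ m)%:E *
  bessel_kernel (h + 2 * (l + k) + m).+1 (sqp (p \o succn) m) (w - x ^+ 2).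
have K0 l x : 0 <= K l x.
  apply: mule_ge0; first by rewrite lee_fin exprn_ge0// sqrtr_ge0.
  by apply: bessel_kernel_ge0; exact: sqp_ge0.
transitivity (\int[mu]_x \sum_(l <oo) (c l)%:E * (K l x * (expR (p 0%N * x))%:E)).
  apply: eq_integral => x _.
  transitivity ((expR (p 0%N * x))%:E * \int[lebesgue_tuple m.+1]_y
    (y`_m ^+ (2 * k) * riesz h ((w - x ^+ 2) - sqn y) * expR (dotp (p \o succn) y))%:E).
    rewrite -(ge0_integralMl _ (expR_ge0 _) (riesz_tuple_ge0 _ _ _ _) (measurable_riesz_tuple _ _ _ _)).
    apply: eq_integral => y _; congr EFin.
    by rewrite sqn_consp dotp_consp expRD opprD addrA /=; ring.
  rewrite IH -nneseriesZl; last first.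
    by move=> l _; apply: mule_ge0; [rewrite lee_fin; exact: c0|exact: K0].
  by apply: eq_eseriesr => l _; rewrite muleC -muleA.
have mK l : measurable_fun setT (fun x : R => K l x * (expR (p 0%N * x))%:E).
  apply: emeasurable_funM; last first.
    by apply/measurable_EFinP; apply: measurableT_comp => //; exact: measurable_funM.
  apply: measurable_funeM.
  apply: (measurableT_comp (measurable_bessel_kernel _ (sqp_ge0 _ _))).
  by apply: measurable_funB => //; exact: measurable_funX.
have mcK l : measurable_fun setT (fun x : R => (c l)%:E * (K l x * (expR (p 0%N * x))%:E)).
  exact: measurable_funeM.
have Ke0 l (x : R) : [set: R] x -> 0 <= K l x * (expR (p 0%N * x))%:E.
  by move=> _; apply: mule_ge0; [exact: K0|rewrite lee_fin expR_ge0].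
have cK0 l (x : R) : [set: R] x -> 0 <= (c l)%:E * (K l x * (expR (p 0%N * x))%:E).
  by move=> xT; apply: mule_ge0; [rewrite lee_fin; exact: c0|exact: (Ke0 l x xT)].
rewrite (integral_nneseries mu measurableT mcK cK0); apply: eq_eseriesr => l _.
rewrite (ge0_integralZl mu measurableT (mK l) (Ke0 l)); last by rewrite lee_fin; exact: c0.
congr (_ * _).
have mB : measurable_fun setT (fun x : R =>
    bessel_kernel (h + 2 * (l + k) + m).+1 (sqp (p \o succn) m) (w - x ^+ 2) *
    (expR (p 0%N * x))%:E).
  apply: emeasurable_funM; last first.
    by apply/measurable_EFinP; apply: measurableT_comp => //; exact: measurable_funM.
  apply: (measurableT_comp (measurable_bessel_kernel _ (sqp_ge0 _ _))).
  by apply: measurable_funB => //; exact: measurable_funX.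
have B0 (x : R) : [set: R] x -> 0 <=
    bessel_kernel (h + 2 * (l + k) + m).+1 (sqp (p \o succn) m) (w - x ^+ 2) *
    (expR (p 0%N * x))%:E.
  move=> _; apply: mule_ge0; last by rewrite lee_fin expR_ge0.
  by apply: bessel_kernel_ge0; exact: sqp_ge0.
transitivity ((spi ^+ m)%:E * ((spi)%:E *
    bessel_kernel (h + 2 * (l + k) + m).+2 (sqp (p \o succn) m + p 0%N ^+ 2) w)).
  rewrite -(integral_bessel_kernel_expR _ _ _ (sqp_ge0 _ _)).
  rewrite -(ge0_integralZl mu measurableT mB B0); last by rewrite lee_fin exprn_ge0// sqrtr_ge0.
  by apply: eq_integral => x _; rewrite muleA.
by rewrite muleA -EFinM -exprSr sqpS addnS.
Qed.

End tuple_laplace.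

(** * The constants a_(j,N) at half-integers *)

Section flight_constants_theory.
Context (R : realType) (a : nat -> nat -> R).
Hypothesis aP : flight_constants a.
Local Notation G := (half_gamma R).

(** The defining relation at r = 0, multiplied by M!. The terms it omits are those where the falling
    factorial vanishes. *)
Lemma flight_constants_ffact N M :
  \prod_(i < N) (2 * M + 2 * i + 1)%:R = \sum_(j < N.+1) a j N * (M ^_ j)%:R :> R.
Proof.
have fr q : q`!%:R != 0 :> R by rewrite pnatr_eq0 -lt0n fact_gt0.
have := aP N (leq0n M); rewrite subn0 fact0 mul1r.
move=> /(congr1 (fun x => x * M`!%:R)); rewrite divfK// => ->.
rewrite mulr_suml [RHS](bigID (fun j : 'I_N.+1 => (j <= M)%N))/=.
rewrite [X in _ = _ + X]big1 ?addr0; last first.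
  by move=> j; rewrite -ltnNge => Mj; rewrite ffact_small ?mulr0.
apply: eq_bigr => j jM; rewrite -(ffact_fact jM) natrM; field.
by rewrite fr.
Qed.

(* Both sides are polynomials in [x], equal at every natural number. *)
Lemma flight_constants_poly N (x : R) :
  \prod_(i < N) (2 * x + 2 * i%:R + 1) =
  \sum_(j < N.+1) a j N * \prod_(i < j) (x - i%:R).
Proof.
pose p : {poly R} := \prod_(i < N) (2 *: 'X + (2 * i%:R + 1)%:P) -
  \sum_(j < N.+1) a j N *: \prod_(i < j) ('X - i%:R%:P).
have pE y : p.[y] = \prod_(i < N) (2 * y + 2 * i%:R + 1) -
    \sum_(j < N.+1) a j N * \prod_(i < j) (y - i%:R).
  rewrite hornerD hornerN horner_prod horner_sum; congr (_ - _).
    by apply: eq_bigr => i _; rewrite hornerD hornerZ hornerX hornerC addrA.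
  apply: eq_bigr => j _; rewrite hornerZ horner_prod; congr (_ * _).
  by apply: eq_bigr => i _; rewrite hornerD hornerN hornerX hornerC.
have p0 : p = 0.
  (* A nonzero polynomial has fewer than [size p] roots, and [size p] distinct natural numbers are
     exhibited. *)
  apply: (@roots_geq_poly_eq0 _ p [seq i%:R | i <- iota 0 (size p)]).
  - apply/allP => _ /mapP[M _ ->]; rewrite /root pE subr_eq0; apply/eqP.
    have prodE j : \prod_(i < j) (M%:R - i%:R) = (M ^_ j)%:R :> R.
      elim: j => [|j IH]; first by rewrite big_ord0 ffactn0.
      rewrite big_ord_recr/= IH; have [jM|Mj] := leqP j M.
        by rewrite ffactnSr natrM natrB.
      by rewrite !ffact_small ?mul0r//; exact: ltnW.
    under [RHS]eq_bigr do rewrite prodE.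
    by rewrite -flight_constants_ffact; apply: eq_bigr => i _; rewrite -!natrM -natrD natr1 addn1.
  - by rewrite map_inj_uniq ?iota_uniq// => i j /eqP; rewrite eqr_nat => /eqP.
  - by rewrite size_map size_iota.
by apply/eqP; rewrite -subr_eq0 -pE p0 horner0.
Qed.

Lemma half_gamma_shift l j :
  G (2 * (l + j)).+1 = G (2 * l).+1 * \prod_(i < j) (l%:R + 2^-1 + i%:R).
Proof.
elim: j => [|j IH]; first by rewrite addn0 big_ord0 mulr1.
rewrite addnS mulnS add2n half_gammaSS IH big_ord_recr/= mulrCA; congr (_ * _).
by rewrite mulrC; congr (_ * _); rewrite -natr1 natrM natrD; field.
Qed.

(** The polynomial identity at x = -(l + 1/2). There x - i is minus a factor of the ratio of Gamma
    values, which absorbs the sign (-1)^k, while 2x + 2i + 1 becomes -2(l - i). The result vanishes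
    for [l < N]. *)
Lemma flight_constants_half_gamma N l :
  \sum_(k < N.+1) (-1) ^+ k * a k N * G (2 * (l + k)).+1 =
  (- 2) ^+ N * (l ^_ N)%:R * G (2 * l).+1.
Proof.
transitivity (G (2 * l).+1 *
    \sum_(j < N.+1) a j N * \prod_(i < j) (- (l%:R + 2^-1) - i%:R)).
  rewrite mulr_sumr; apply: eq_bigr => j _; rewrite half_gamma_shift.
  under [in RHS]eq_bigr do rewrite -opprD -mulN1r.
  by rewrite big_split/= prodr_const card_ord; ring.
rewrite -flight_constants_poly mulrC; congr (_ * _).
transitivity (\prod_(i < N) (-2 * (l%:R - i%:R)) : R).
  by apply: eq_bigr => i _; field.
rewrite big_split/= prodr_const card_ord; congr (_ * _).
elim: N => [|N IH]; first by rewrite big_ord0 ffactn0.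
rewrite big_ord_recr/= IH; have [jM|Mj] := leqP N l.
  by rewrite ffactnSr natrM natrB.
by rewrite !ffact_small ?mul0r//; exact: ltnW.
Qed.

End flight_constants_theory.

(** * Signed combinations of nonnegative series *)

Section signed_combination.
Local Open Scope ereal_scope.
Context (R : realType).

Lemma nneseries_cvg (u : nat -> R) (l : R) : (forall n, 0 <= u n)%R ->
  \sum_(n <oo) (u n)%:E = l%:E -> series u @ \oo --> l.
Proof.
move=> u0 ul.
have : cvg ((\sum_(0 <= i < n) (u i)%:E) @[n --> \oo]).
  by apply: is_cvg_nneseries => n _ _; rewrite lee_fin.
rewrite /cvg_to ul => h.
have -> : series u = fine \o (fun n => \sum_(0 <= i < n) (u i)%:E).
  by apply/funext => n; rewrite /= sumEFin.
exact: fine_cvg.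
Qed.

(** The coefficients [s k] may have either sign, so the combination is taken on the real partial
    sums; this is why every series is required to have a finite value. *)
Lemma nneseries_lincomb M (s : nat -> R) (u : nat -> nat -> R) (v t : nat -> R)
    (sg T : R) :
  (forall k l, 0 <= u k l)%R -> (forall l, 0 <= t l)%R ->
  (forall k, (k <= M)%N -> \sum_(l <oo) (u k l)%:E = (v k)%:E) ->
  \sum_(l <oo) (t l)%:E = T%:E ->
  (forall l, \sum_(k < M.+1) s k * u k l = sg * t l)%R ->
  (\sum_(k < M.+1) s k * v k = sg * T)%R.
Proof.
move=> u0 t0 uv tT ut.
have h1 : (sg * series t n)%R @[n --> \oo] --> (sg * T)%R.
  by apply: cvgM; [exact: cvg_cst|exact: nneseries_cvg].
have h2 : (\sum_(k < M.+1) s k * series (u k) n)%R @[n --> \oo] -->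
    (\sum_(k < M.+1) s k * v k)%R.
  apply: cvg_big => [|k _]; first exact: add_continuous.
  apply: cvgM; first exact: cvg_cst.
  by apply: nneseries_cvg => //; apply: uv; rewrite -ltnS.
apply: (cvg_unique _ h2) => //.
rewrite (_ : (fun n => _) = (fun n => sg * series t n)%R)//.
apply/funext => n; rewrite /series/= mulr_sumr.
under eq_bigr do rewrite mulr_sumr.
by rewrite exchange_big/=; apply: eq_bigr => l _.
Qed.

Local Notation G := (half_gamma R).

(** Each factor of the recurrence is at least 1/2. This is crude, but against the 4^(-m) in the
    kernel it still leaves 2^(-m), enough for an exponential majorant. *)
Lemma half_gamma_ge h m : (2^-1 ^+ m * G h.+2 <= G (h + 2 * m).+2)%R.
Proof.
elim: m => [|m IH]; first by rewrite expr0 mul1r muln0 addn0.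
rewrite mulnS addnCA add2n half_gammaSS exprS -mulrA.
apply: ler_pM => //; first by rewrite mulr_ge0 ?exprn_ge0// ltW// half_gamma_gt0.
by rewrite -[leLHS]mul1r ler_pM2r ?invr_gt0// ler1n.
Qed.

Lemma bessel_kernel_lty h (r w : R) : (0 <= r)%R -> bessel_kernel h.+1 r w < +oo.
Proof.
move=> r0; have [w0|w0] := ltP 0%R w; last first.
  by rewrite bessel_kernel_le0.
(* The value of [riesz h.+1 w], the leading term; the series is dominated by [C] times the
   exponential series at rw/2. *)
pose C := (w `^ (h%:R / 2) / G h.+2)%R.
have C0 : (0 <= C)%R by rewrite divr_ge0 ?powR_ge0// ltW// half_gamma_gt0.
have e0 m : (0 <= exp_coeff (r * w / 2) m)%R.
  by apply: exp_coeff_ge0; rewrite !mulr_ge0// ltW.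
apply: (@le_lt_trans _ _ (\sum_(m <oo) (C * exp_coeff (r * w / 2)%R m)%:E)).
  apply: lee_nneseries => [m _ _|m _].
    by rewrite lee_fin exp_coeff_riesz_ge0.
  rewrite lee_fin /riesz w0 addSn.
  have -> : (((h + 2 * m).+1%:R - 1) / 2 = h%:R / 2 + m%:R :> R)%R.
    by rewrite -natr1 natrD natrM; field.
  rewrite powRD ?(gt_eqF w0) ?implybT// powR_mulrn ?(ltW w0)//.
  rewrite /C /exp_coeff/= !exprMn.
  have G1 := half_gamma_gt0 R h.+1; have G2 := half_gamma_gt0 R (h + 2 * m).+1.
  have hG := half_gamma_ge h m.
  have -> : (r ^+ m * 4^-1 ^+ m / m`!%:R *
     (w `^ (h%:R / 2) * w ^+ m / G (h + 2 * m).+2) =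
     (r ^+ m * w ^+ m / m`!%:R * w `^ (h%:R / 2)) *
     (4^-1 ^+ m / G (h + 2 * m).+2))%R by ring.
  have -> : (w `^ (h%:R / 2) / G h.+2 * (r ^+ m * w ^+ m * 2^-1 ^+ m / m`!%:R) =
     (r ^+ m * w ^+ m / m`!%:R * w `^ (h%:R / 2)) *
     (2^-1 ^+ m / G h.+2))%R by ring.
  apply: ler_wpM2l.
    by rewrite !mulr_ge0 ?powR_ge0 ?exprn_ge0 ?invr_ge0// ltW.
  rewrite ler_pdivrMr// mulrAC ler_pdivlMr//.
  have -> : (4^-1 ^+ m = 2^-1 ^+ m * 2^-1 ^+ m :> R)%R.
    by rewrite -exprMn -invfM -natrM.
  by rewrite -mulrA ler_wpM2l// exprn_ge0.
under eq_eseriesr do rewrite EFinM.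
rewrite nneseriesZl//; last by move=> m _; rewrite lee_fin.
have /nneseries_EFin -> := is_cvg_series_exp_coeff (r * w / 2)%R.
by rewrite -EFinM ltry.
Qed.

Lemma bessel_kernel_fin_num h (r w : R) : (0 <= r)%R ->
  bessel_kernel h.+1 r w \is a fin_num.
Proof.
by move=> r0; rewrite ge0_fin_numE ?bessel_kernel_lty// bessel_kernel_ge0.
Qed.

End signed_combination.

Section flight_combination.
Local Open Scope ereal_scope.
Context (R : realType).
Local Notation G := (half_gamma R).
Local Notation spi := (Num.sqrt (pi : R)).
Implicit Types (p : nat -> R) (w : R).

Lemma sqpSr p m : (sqp p m.+1 = sqp p m + p m ^+ 2)%R.
Proof. by rewrite /sqp big_ord_recr. Qed.

Lemma spi_ge0 m : (0 <= spi ^+ m)%R.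
Proof. by rewrite exprn_ge0// sqrtr_ge0. Qed.

(** Without the power of the last coordinate the series in [l] sums up: the duplication formula puts
    it in the form of [bessel_kernelD], which adds the missing p_m^2. *)
Lemma integral_riesz_tuple0 p m h w :
  \int[lebesgue_tuple m.+1]_x (riesz h (w - sqn x) * expR (dotp p x))%:E =
  (spi ^+ m.+1)%:E * bessel_kernel (h + m).+1 (sqp p m.+1) w.
Proof.
transitivity (\int[lebesgue_tuple m.+1]_x
    (x`_m ^+ (2 * 0) * riesz h (w - sqn x) * expR (dotp p x))%:E).
  by apply: eq_integral => x _; rewrite muln0 expr0 mul1r.
have b0 l : 0 <= (exp_coeff (p m ^+ 2 / 4)%R l)%:E *
    bessel_kernel ((h + m).+1 + 2 * l) (sqp p m) w.
  apply: mule_ge0; last by apply: bessel_kernel_ge0; exact: sqp_ge0.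
  by rewrite lee_fin exp_coeff_ge0// divr_ge0// sqr_ge0.
rewrite integral_riesz_tuple sqpSr -bessel_kernelD ?sqp_ge0 ?sqr_ge0//.
rewrite -nneseriesZl//; apply: eq_eseriesr => l _.
rewrite addn0 exp_coeff_half_gamma addSn addnAC (exprS spi m)
  (EFinM spi (exp_coeff _ _)) (EFinM spi (spi ^+ m)%R).
by rewrite -!muleA; congr (_ * _); rewrite muleCA.
Qed.

(** On the support of the integrand the last coordinate has square at most |w|, so comparison with
    the case [k = 0] suffices. *)
Lemma integral_riesz_tuple_fin_num p m k h w : (0 < m)%N ->
  \int[lebesgue_tuple m]_x
    (x`_m.-1 ^+ (2 * k) * riesz h (w - sqn x) * expR (dotp p x))%:E \is a fin_num.
Proof.
case: m => // m _; rewrite -[m.+1.-1]/m.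
have U0 (x : m.+1.-tuple R) := riesz_tuple_ge0 p k h w x.
rewrite ge0_fin_numE; last by apply: integral_ge0 => x _; rewrite lee_fin.
have mU := @measurable_riesz_tuple R p m k h w.
have V0 (x : m.+1.-tuple R) : (0 <= riesz h (w - sqn x) * expR (dotp p x))%R.
  by rewrite mulr_ge0 ?riesz_ge0 ?expR_ge0.
have mV : measurable_fun setT
    (fun x : m.+1.-tuple R => riesz h (w - sqn x) * expR (dotp p x))%R.
  apply: measurable_funM; last by apply: measurableT_comp => //; exact: measurable_dotp.
  by apply: measurable_riesz_comp; apply: measurable_funB => //; exact: measurable_sqn.
have wk0 : (0 <= `|w| ^+ k)%R by rewrite exprn_ge0.
apply: (@le_lt_trans _ _ (\int[lebesgue_tuple m.+1]_x
    (`|w| ^+ k * (riesz h (w - sqn x) * expR (dotp p x)))%:E)).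
  apply: ge0_le_integral => //.
  - by move=> x _; rewrite lee_fin.
  - exact/measurable_EFinP.
  - by apply/measurable_EFinP; exact: measurable_funM.
  move=> x _; rewrite lee_fin -mulrA.
  have [wx|wx] := ltP 0%R (w - sqn x)%R; last first.
    by rewrite riesz_le0// !mul0r !mulr0.
  apply: ler_wpM2r => //; rewrite exprM lerXn2r ?nnegrE ?sqr_ge0//.
  have h1 : (x`_m ^+ 2 <= sqn x)%R.
    rewrite /sqn big_ord_recr/= lerDr; apply: sumr_ge0 => i _; exact: sqr_ge0.
  rewrite (le_trans h1)// (le_trans _ (ler_norm _))// ltW//.
  by rewrite -subr_gt0.
rewrite (ge0_integralMl _ wk0 V0 mV) integral_riesz_tuple0.
apply: lte_mul_pinfty => //; rewrite ?lee_fin//.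
apply: lte_mul_pinfty; rewrite ?lee_fin ?spi_ge0//.
by apply: bessel_kernel_lty; exact: sqp_ge0.
Qed.

Lemma ffact_exp_coeff (q : R) l M :
  (((l + M) ^_ M)%:R * exp_coeff q (l + M)%N = q ^+ M * exp_coeff q l)%R.
Proof.
rewrite /exp_coeff/= -(ffact_fact (leq_addl l M)) addnK natrM exprD.
field; rewrite !pnatr_eq0 -!lt0n fact_gt0/= ffact_gt0 leq_addl//.
Qed.

(** The index [D - 2 * k] compensates the 2k that the power of the last coordinate adds. In the l-th
    term only the Gamma factor then depends on k, and the alternating sum is known. It contains the
    falling factorial of [l] of order [M], which kills the terms below [M]; re-indexing the rest by
    [l + M] produces the M-th power and raises the index by 2M. *)
Lemma flight_combination (a : nat -> nat -> R) p m D M w :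
  flight_constants a -> (2 * M <= D)%N ->
  (\sum_(k < M.+1) (-1) ^+ k * a k M *
    fine (\int[lebesgue_tuple m.+1]_x
      (x`_m ^+ (2 * k) * riesz (D - 2 * k) (w - sqn x) * expR (dotp p x))%:E) =
  (- 2) ^+ M * (spi ^+ m.+1 * ((p m ^+ 2 / 4) ^+ M *
     fine (bessel_kernel (D + m + 2 * M).+1 (sqp p m.+1) w))))%R.
Proof.
move=> aP MD.
pose q := (p m ^+ 2 / 4)%R.
have q0 : (0 <= q)%R by rewrite divr_ge0 ?sqr_ge0.
pose T l := fine (bessel_kernel (D + 2 * l + m).+1 (sqp p m) w).
have TE l : (T l)%:E = bessel_kernel (D + 2 * l + m).+1 (sqp p m) w.
  by rewrite fineK// bessel_kernel_fin_num// sqp_ge0.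
have T0 l : (0 <= T l)%R by rewrite -lee_fin TE bessel_kernel_ge0// sqp_ge0.
pose u k l := (exp_coeff (p m) (2 * l)%N * G (2 * (l + k)).+1 * (spi ^+ m * T l))%R.
pose t l := (spi ^+ m.+1 * ((l ^_ M)%:R * exp_coeff q l * T l))%R.
apply: (nneseries_lincomb (s := fun k => ((-1) ^+ k * a k M)%R) (u := u) (t := t)
  (v := fun k => fine (\int[lebesgue_tuple m.+1]_x
      (x`_m ^+ (2 * k) * riesz (D - 2 * k) (w - sqn x) * expR (dotp p x))%:E))).
- move=> k l; apply: mulr_ge0; first exact: exp_coeff_even_gamma_ge0.
  by rewrite mulr_ge0 ?spi_ge0.
- move=> l; rewrite mulr_ge0 ?spi_ge0// mulr_ge0// mulr_ge0//.
  exact: exp_coeff_ge0.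
- move=> k kM; rewrite fineK; last exact: (@integral_riesz_tuple_fin_num p m.+1).
  rewrite integral_riesz_tuple; apply: eq_eseriesr => l _.
  have -> : (D - 2 * k + 2 * (l + k) + m = D + 2 * l + m)%N.
    by move: kM MD; clear; lia.
  by rewrite -TE -!EFinM.
- rewrite (nneseries_split _ M); last first.
    move=> l _; rewrite lee_fin mulr_ge0 ?spi_ge0// mulr_ge0// mulr_ge0//.
    exact: exp_coeff_ge0.
  rewrite add0n big1_seq ?add0e; last first.
    move=> l /=; rewrite mem_index_iota => /andP[_ lM].
    by rewrite /t ffact_small// !mul0r mulr0.
  rewrite -(@nneseries_addn _ (fun l => (t l)%:E)); last first.
    move=> l; rewrite lee_fin mulr_ge0 ?spi_ge0// mulr_ge0// mulr_ge0//.
    exact: exp_coeff_ge0.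
  rewrite EFinM [in RHS](EFinM (_ ^+ M)%R) fineK; last first.
    by rewrite bessel_kernel_fin_num// sqp_ge0.
  rewrite sqpSr -bessel_kernelD ?sqp_ge0 ?sqr_ge0// -/q.
  have b0 l : 0 <= (exp_coeff q l)%:E *
      bessel_kernel ((D + m + 2 * M).+1 + 2 * l) (sqp p m) w.
    apply: mule_ge0; first by rewrite lee_fin exp_coeff_ge0.
    by apply: bessel_kernel_ge0; exact: sqp_ge0.
  rewrite -!nneseriesZl//; last first.
    by move=> l _; apply: mule_ge0 => //; rewrite lee_fin exprn_ge0.
  apply: eq_eseriesr => l _; rewrite /t ffact_exp_coeff -mulrA EFinM; congr (_ * _).
  have -> : ((D + m + 2 * M).+1 + 2 * l = (D + 2 * (l + M) + m).+1)%N.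
    by clear; lia.
  by rewrite -TE -!EFinM mulrA.
- move=> l; transitivity (exp_coeff (p m) (2 * l)%N * (spi ^+ m * T l) *
    \sum_(k < M.+1) (-1) ^+ k * a k M * G (2 * (l + k)).+1)%R.
    by rewrite mulr_sumr; apply: eq_bigr => k _; rewrite /u; ring.
  rewrite flight_constants_half_gamma// /t.
  transitivity ((- 2) ^+ M * ((spi ^+ m * (l ^_ M)%:R * T l) *
    (exp_coeff (p m) (2 * l)%N * G (2 * l).+1)))%R; first by ring.
  by rewrite exp_coeff_half_gamma (exprS spi m) -/q; ring.
Qed.

End flight_combination.

(** * The angular integral *)

Section sphere_kernel.
Local Open Scope ereal_scope.
Context (R : realType).
Local Notation mu := (@lebesgue_measure R).
Local Notation G := (half_gamma R).
Local Notation spi := (Num.sqrt (pi : R)).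
Implicit Types (p : nat -> R) (w : R).

(* [spi ^+ d] is [pi^(d/2)]. *)
Definition sphere_kernel d p w : \bar R :=
  (spi ^+ d)%:E * (bessel_kernel d.+1 (sqp p d) w +
    (p d.-1 ^+ 2 / 2)%:E * bessel_kernel d.+3 (sqp p d) w).

Lemma sphere_kernel_ge0 d p w : 0 <= sphere_kernel d p w.
Proof.
apply: mule_ge0; first by rewrite lee_fin spi_ge0.
apply: adde_ge0; first by apply: bessel_kernel_ge0; exact: sqp_ge0.
apply: mule_ge0; first by rewrite lee_fin divr_ge0// sqr_ge0.
by apply: bessel_kernel_ge0; exact: sqp_ge0.
Qed.

Lemma sphere_kernel_le0 d p w : (w <= 0)%R -> sphere_kernel d p w = 0.
Proof. by move=> w0; rewrite /sphere_kernel !bessel_kernel_le0// !mule0 adde0 mule0. Qed.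

Lemma measurable_sphere_kernel d p : measurable_fun setT (sphere_kernel d p).
Proof.
apply: measurable_funeM; apply: emeasurable_funD.
  exact: (measurable_bessel_kernel _ (sqp_ge0 _ _)).
by apply: measurable_funeM; exact: (measurable_bessel_kernel _ (sqp_ge0 _ _)).
Qed.

(** Both terms obey the one-coordinate rule with the same parameter, and [p \o succn] keeps the last
    coordinate in last place, so the factor p_d^2 is carried along unchanged. *)
Lemma integral_sphere_kernel_expR d p w :
  \int[mu]_x (sphere_kernel d.+1 (p \o succn) (w - x ^+ 2) * (expR (p 0%N * x))%:E) =
  sphere_kernel d.+2 p w.
Proof.
have r0 := sqp_ge0 (p \o succn) d.+1.
have mb h : measurable_fun setT (fun x : R =>
    bessel_kernel h (sqp (p \o succn) d.+1) (w - x ^+ 2) * (expR (p 0%N * x))%:E).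
  apply: emeasurable_funM; last first.
    by apply/measurable_EFinP; apply: measurableT_comp => //; exact: measurable_funM.
  apply: (measurableT_comp (measurable_bessel_kernel _ r0)).
  by apply: measurable_funB => //; exact: measurable_funX.
have b0 h (x : R) : [set: R] x -> 0 <=
    bessel_kernel h (sqp (p \o succn) d.+1) (w - x ^+ 2) * (expR (p 0%N * x))%:E.
  move=> _; apply: mule_ge0; last by rewrite lee_fin expR_ge0.
  exact: bessel_kernel_ge0.
pose c := (p d.+1 ^+ 2 / 2)%R.
have c0 : 0 <= c%:E by rewrite lee_fin divr_ge0// sqr_ge0.
have s0 n : 0 <= (spi ^+ n)%:E by rewrite lee_fin spi_ge0.
transitivity (\int[mu]_x ((spi ^+ d.+1)%:E *
   (bessel_kernel d.+2 (sqp (p \o succn) d.+1) (w - x ^+ 2) * (expR (p 0%N * x))%:E +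
   c%:E * (bessel_kernel d.+4 (sqp (p \o succn) d.+1) (w - x ^+ 2) *
     (expR (p 0%N * x))%:E)))).
  apply: eq_integral => x _; rewrite /sphere_kernel -muleA; congr (_ * _).
  rewrite ge0_muleDl; last 2 first.
  - exact: bessel_kernel_ge0.
  - by apply: mule_ge0; [exact: c0|exact: bessel_kernel_ge0].
  by rewrite -muleA.
have mcb : measurable_fun setT (fun x : R => c%:E *
   (bessel_kernel d.+4 (sqp (p \o succn) d.+1) (w - x ^+ 2) * (expR (p 0%N * x))%:E)).
  by apply: measurable_funeM; exact: mb.
have cb0 (x : R) : [set: R] x -> 0 <= c%:E *
   (bessel_kernel d.+4 (sqp (p \o succn) d.+1) (w - x ^+ 2) * (expR (p 0%N * x))%:E).
  by move=> xT; apply: mule_ge0; [exact: c0|exact: (b0 _ x xT)].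
have mD := emeasurable_funD (mb d.+2) mcb.
rewrite (ge0_integralZl mu measurableT mD _ (s0 _)); last first.
  by move=> x xT; apply: adde_ge0; [exact: (b0 _ x xT)|exact: (cb0 x xT)].
rewrite (ge0_integralD mu measurableT (b0 d.+2) (mb d.+2) cb0 mcb).
rewrite (ge0_integralZl mu measurableT (mb d.+4) (b0 d.+4) c0).
rewrite !integral_bessel_kernel_expR// -sqpS /sphere_kernel muleCA -ge0_muleDr; last 2 first.
- by apply: bessel_kernel_ge0; exact: sqp_ge0.
- by apply: mule_ge0; [exact: c0|apply: bessel_kernel_ge0; exact: sqp_ge0].
by rewrite muleA -EFinM -exprSr.
Qed.

(** In dimension one the sphere is two points. Shifted by one, the second series contributes 2l to
    the l-th coefficient; together with the first this is 2l + 1, which cancels the factor coming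
    from the recurrence of Gamma. *)
Lemma sphere_kernel1 p w : (0 < w)%R ->
  sphere_kernel 1 p w =
  (Num.sqrt w * (expR (p 0%N * Num.sqrt w) + expR (- (p 0%N * Num.sqrt w))))%:E.
Proof.
move=> w0; set q := p 0%N; set s := Num.sqrt w.
have sw : (w = s ^+ 2)%R by rewrite sqr_sqrtr// ltW.
have s0 : (0 < s)%R by rewrite sqrtr_gt0.
have -> : (s * (expR (q * s) + expR (- (q * s))) =
    2 * s * ((expR (q * s) + expR (- (q * s))) / 2))%R by field.
rewrite EFinM -nneseries_cosh -nneseriesZl; last first.
  by move=> l _; rewrite lee_fin exp_coeff_even_ge0.
rewrite /sphere_kernel expr1 -/q.
have -> : sqp p 1 = (q ^+ 2)%R by rewrite /sqp big_ord1.
have q0 := sqr_ge0 q.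
have q4 : (0 <= q ^+ 2 / 4)%R by rewrite divr_ge0.
have t0 l : (0 <= (2 * l%:R) * exp_coeff (q ^+ 2 / 4) l * riesz (2 + 2 * l) w)%R.
  apply: mulr_ge0; last exact: riesz_ge0.
  by apply: mulr_ge0; [rewrite mulr_ge0|exact: exp_coeff_ge0].
have h2 : (q ^+ 2 / 2)%:E * bessel_kernel 4 (q ^+ 2) w =
  \sum_(l <oo) ((2 * l%:R) * exp_coeff (q ^+ 2 / 4)%R l * riesz (2 + 2 * l) w)%:E.
  rewrite [RHS](nneseries_split _ 1); last first.
    by move=> l _; rewrite lee_fin; exact: t0.
  rewrite add0n big_nat1 mulr0 !mul0r add0e -(@nneseries_addn _ (fun l =>
    ((2 * l%:R) * exp_coeff (q ^+ 2 / 4)%R l * riesz (2 + 2 * l) w)%:E)); last first.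
    by move=> l; rewrite lee_fin; exact: t0.
  rewrite /bessel_kernel -nneseriesZl; last first.
    by move=> l _; rewrite lee_fin exp_coeff_riesz_ge0.
  apply: eq_eseriesr => l _; rewrite -EFinM; congr EFin.
  have -> : (2 + 2 * (l + 1) = 4 + 2 * l)%N by clear; lia.
  rewrite /exp_coeff/= addn1 factS natrM (exprS (q ^+ 2 / 4) l).
  by field; rewrite (addrC 1%R) natr1 !pnatr_eq0 -lt0n fact_gt0.
rewrite h2 /bessel_kernel -nneseriesD; last 2 first.
- by move=> l _ _; rewrite lee_fin exp_coeff_riesz_ge0.
- by move=> l _ _; rewrite lee_fin; exact: t0.
rewrite -nneseriesZl; last first.
  move=> l _; apply: adde_ge0; rewrite lee_fin; last exact: t0.
  exact: exp_coeff_riesz_ge0.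
apply: eq_eseriesr => l _; rewrite -EFinD -!EFinM; congr EFin.
rewrite /riesz w0 add2n half_gammaSS.
have -> : (((2 * l).+2%:R - 1) / 2 = l%:R + 2^-1 :> R)%R.
  by rewrite -add2n natrD natrM; field.
rewrite powRD ?(gt_eqF w0) ?implybT// powR_mulrn ?(ltW w0)// powR12_sqrt ?(ltW w0)// -/s.
have Gl := half_gamma_neq0 R (2 * l).
have -> : (exp_coeff (q * s) (2 * l)%N = s ^+ (2 * l) * exp_coeff q (2 * l)%N)%R.
  by rewrite /exp_coeff/= exprMn; ring.
have -> : (exp_coeff q (2 * l)%N = spi * exp_coeff (q ^+ 2 / 4) l / G (2 * l).+1)%R.
  by rewrite -exp_coeff_half_gamma mulfK.
rewrite exprM -sw.
have -> : ((2 * l).+1%:R = 2 * l%:R + 1 :> R)%R by rewrite -natr1 natrM.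
have n0 : ((2 * l%:R + 1) != 0 :> R)%R by rewrite -natrM natr1 pnatr_eq0.
by field; rewrite n0 Gl.
Qed.

End sphere_kernel.

Section sphere_substitution.
Local Open Scope ereal_scope.
Context (R : realType).
Local Notation mu := (@lebesgue_measure R).

(** The polar angle is traded for the height [y = - s * cos x], the sign making it increasing on
    [[0, pi]]; a reflection undoes the sign at the end. As [H] vanishes on [w <= 0], the height may
    range over the whole line. *)
Lemma integral_sphere_substitution (s q : R) (H : R -> \bar R) : (0 < s)%R ->
  (forall w, 0 <= H w) -> (forall w, (w <= 0)%R -> H w = 0) ->
  measurable_fun setT H ->
  \int[mu]_(x in `[0%R, pi])
     ((s * sin x * expR (q * (s * cos x)))%:E * H ((s * sin x) ^+ 2)%R) =
  \int[mu]_y (H (s ^+ 2 - y ^+ 2)%R * (expR (q * y))%:E).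
Proof.
move=> s0 H0 Hle0 mH.
pose f y := H (s ^+ 2 - y ^+ 2)%R * (expR (- q * y))%:E.
have f0 y : 0 <= f y by apply: mule_ge0; rewrite // lee_fin expR_ge0.
have mf : measurable_fun setT f.
  apply: emeasurable_funM.
    apply: measurableT_comp => //; apply: measurable_funB => //.
  by apply/measurable_EFinP; apply: measurableT_comp => //; exact: measurable_funM.
have dF (x : R) : is_derive x 1%R (fun x : R => - (s * cos x))%R (s * sin x)%R.
  apply: is_derive_eq; rewrite /GRing.scale/=; ring.
have cg : continuous (fun x : R => s * sin x)%R.
  by move=> x; apply: cvgM; [exact: cvg_cst|exact: continuous_sin].
have g0 (x : R) : (0 <= x <= pi)%R -> (0 <= s * sin x)%R.
  by move=> x0; rewrite mulr_ge0 ?(ltW s0)// sin_ge0_pi.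
have incr (x y : R) : (0 <= x)%R -> (x < y)%R -> (y <= pi)%R ->
    (- (s * cos x) < - (s * cos y))%R.
  move=> x0 xy ypi; rewrite ltrN2 ltr_pM2l//.
  by rewrite ltr_cos// in_itv/= ?x0 ?ypi ?(le_trans x0 (ltW xy)) ?(le_trans (ltW xy) ypi).
have := ge0_integral_substitution (pi_ge0 R) dF cg g0 incr f0 mf.
rewrite cos0 cospi mulr1 mulrN1 opprK => h.
transitivity (\int[mu]_(x in `[0%R, pi]) (f (- (s * cos x))%R * (s * sin x)%:E)).
  apply: eq_integral => x _; rewrite /f.
  have -> : (s ^+ 2 - (- (s * cos x)) ^+ 2 = (s * sin x) ^+ 2)%R.
    by rewrite sqrrN !exprMn sin2cos2; ring.
  by rewrite mulrNN EFinM [RHS]muleC muleA muleAC.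
rewrite h integral_mkcond -[RHS]ge0_integral_lebesgue_opp; last 2 first.
- by move=> y; apply: mule_ge0; rewrite // lee_fin expR_ge0.
- apply: emeasurable_funM.
    apply: measurableT_comp => //; apply: measurable_funB => //.
  by apply/measurable_EFinP; apply: measurableT_comp => //; exact: measurable_funM.
apply: eq_integral => y _; rewrite /patch mem_setE in_itv/= /f sqrrN mulrN mulNr.
case: ifPn => // yI; rewrite Hle0 ?mul0e// subr_le0.
rewrite -real_normK ?num_real// -[leRHS]real_normK ?num_real// lerXn2r ?nnegrE//.
by rewrite (ger0_norm (ltW s0)) leNgt; apply: contra yI => /ltW; rewrite ler_norml.
Qed.

End sphere_substitution.

Section angles.
Local Open Scope ereal_scope.
Context (R : realType).
Local Notation mu := (@lebesgue_measure R).
Implicit Types (p : nat -> R).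

(** The density of the angles in dimension [d = m.+2], without its constant. The shift makes the
    number of angles visibly positive, so that they can be integrated from the front. *)
Definition angles_weight m (th : m.+1.-tuple R) : R :=
  (if [forall j : 'I_m.+1,
        (0 <= tnth th j <= if (j.+1 < m.+1)%N then pi else 2 * pi)%R] then
    \prod_(j < m.+1) sin (tnth th j) ^+ (m.+2 - j) else 0)%R.

Definition dir_dotp p m (th : m.+1.-tuple R) : R :=
  (\sum_(i < m.+2) p i * @direction R m.+2 th i)%R.

Lemma angles_weight0 (x : R) :
  angles_weight (consp (x, [tuple])) =
  (if (0 <= x <= 2 * pi)%R then sin x ^+ 2 else 0)%R.
Proof.
rewrite /angles_weight big_ord1; congr (if _ then _ else _).
by apply/forallP/idP => [/(_ ord0)//|h j]; rewrite ord1.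
Qed.

Lemma angles_weightS m x (th : m.+1.-tuple R) :
  angles_weight (consp (x, th)) =
  ((if (0 <= x <= pi)%R then sin x ^+ m.+3 else 0) * angles_weight th)%R.
Proof.
rewrite /angles_weight big_ord_recl/= subn0.
set P := [forall j, _]; set Q := [forall j, _].
have tl (j : 'I_m.+1) : tnth (consp (x, th)) (lift ord0 j) = tnth th j.
  by rewrite !(tnth_nth 0%R).
have -> : P = (0 <= x <= pi)%R && Q.
  apply/forallP/andP => [h|[x0 /forallP h] j].
    split; first exact: (h ord0).
    by apply/forallP => j; have := h (lift ord0 j); rewrite tl.
  case: (unliftP ord0 j) => [i|] ->; last exact: x0.
  by rewrite tl; exact: h.
case: (0 <= x <= pi)%R => /=; last by rewrite mul0r.
case: Q; last by rewrite mulr0.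
by congr (_ * _)%R; apply: eq_bigr => j _; rewrite tl.
Qed.

Lemma dir_dotp0 p (x : R) :
  dir_dotp p (consp (x, [tuple])) = (p 0%N * cos x + p 1%N * sin x)%R.
Proof.
rewrite /dir_dotp big_ord_recl big_ord1 /direction/= big_ord0 big_ord1/=.
by rewrite mul1r mulr1.
Qed.

Lemma dir_dotpS p m x (th : m.+1.-tuple R) :
  dir_dotp p (consp (x, th)) = (p 0%N * cos x + sin x * dir_dotp (p \o succn) th)%R.
Proof.
rewrite /dir_dotp big_ord_recl; congr (_ + _)%R.
  by rewrite /direction/= big_ord0 mul1r.
rewrite mulr_sumr; apply: eq_bigr => i _.
have -> : @direction R m.+3 (consp (x, th)) (lift ord0 i) =
    (sin x * @direction R m.+2 th i)%R.
  by rewrite /direction/= /bump/= add1n big_ord_recl/= mulrA.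
by rewrite /= mulrCA.
Qed.

Lemma angles_weight_ge0 m (th : m.+1.-tuple R) : (0 <= angles_weight th)%R.
Proof.
rewrite /angles_weight; case: ifP => // /forallP h; apply: prodr_ge0 => j _.
have := h j; case: ifPn => [_ /sin_ge0_pi s0|jm _]; first exact: exprn_ge0.
have -> : (m.+2 - j = 2)%N by move: jm (ltn_ord j); clear; lia.
exact: sqr_ge0.
Qed.

Lemma measurable_angles_weight m : measurable_fun setT (@angles_weight m).
Proof.
have msin : measurable_fun setT (@sin R).
  by apply: continuous_measurable_fun => x; exact: continuous_sin.
have mth k : measurable_fun setT (fun th : k.+1.-tuple R => thead th).
  exact: (@measurable_tnth _ R k.+1 ord0).
have mif (k : nat) (b : R) : measurable_fun setT
    (fun x : R => (if 0 <= x <= b then sin x ^+ k else 0)%R : R).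
  apply: measurable_fun_ifT => //; last exact: measurable_funX.
  by apply: measurable_and; apply: measurable_fun_ler.
elim: m => [|m IH].
  rewrite (_ : @angles_weight 0 = (fun x : R => (if 0 <= x <= 2 * pi then sin x ^+ 2 else 0)%R : R) \o
     (fun th : 1.-tuple R => thead th)).
    by apply: measurableT_comp; [exact: mif|exact: mth].
  apply/funext => th /=; case/tupleP: th => x th.
  rewrite theadE -angles_weight0; congr angles_weight.
  by apply: val_inj; rewrite /= (tuple0 th).
rewrite (_ : @angles_weight m.+1 = (fun th : m.+2.-tuple R =>
   (if (0 <= thead th <= pi)%R then sin (thead th) ^+ m.+3 else 0) *
   angles_weight [tuple of behead th])%R); last first.
  apply/funext => th /=; case/tupleP: th => x th.
  by rewrite theadE -angles_weightS; congr angles_weight; exact: val_inj.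
apply: measurable_funM.
  exact: (measurableT_comp (mif m.+3 pi) (mth m.+1)).
by apply: measurableT_comp => //; exact: measurable_behead.
Qed.

Lemma measurable_direction d i :
  measurable_fun setT (fun th : d.-1.-tuple R => @direction R d th i).
Proof.
rewrite /direction; apply: measurable_funM.
  apply: measurable_prod => j _.
  apply: (measurableT_comp (f := @sin R)); last exact: measurable_tuple_nth.
  by apply: continuous_measurable_fun => x; exact: continuous_sin.
case: (i < d.-1)%N => //.
apply: (measurableT_comp (f := @cos R)); last exact: measurable_tuple_nth.
by apply: continuous_measurable_fun => x; exact: continuous_cos.
Qed.

Lemma measurable_dir_dotp p m : measurable_fun setT (@dir_dotp p m).
Proof.
apply: measurable_sum => i; apply: measurable_funM => //.
exact: (@measurable_direction m.+2).
Qed.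

(** Contribution of one half of the circle at height [y], with w = s^2 - y^2. One of the two factors
    s sin x is used up by the Jacobian and the other remains as the square root. The halves [e] and
    [- e] add up to [sphere_kernel 1]. *)
Definition semicircle_kernel (e w : R) : \bar R :=
  (if 0 < w then Num.sqrt w * expR (e * Num.sqrt w) else 0)%R%:E.

Lemma semicircle_kernel_ge0 e w : 0 <= semicircle_kernel e w.
Proof.
by rewrite /semicircle_kernel lee_fin; case: ifP => // _; rewrite mulr_ge0 ?sqrtr_ge0 ?expR_ge0.
Qed.

Lemma measurable_semicircle_kernel e : measurable_fun setT (semicircle_kernel e).
Proof.
have msq : measurable_fun setT (@Num.sqrt R).
  by apply: continuous_measurable_fun; exact: sqrt_continuous.
apply/measurable_EFinP; apply: measurable_fun_ifT => //.
  exact: measurable_fun_ltr.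
by apply: measurable_funM => //; apply: measurableT_comp => //; exact: measurable_funM.
Qed.

Lemma integral_semicircle (s q e : R) : (0 < s)%R ->
  \int[mu]_(x in `[0%R, pi])
    (s ^+ 2 * (sin x ^+ 2 * expR (s * (q * cos x + e * sin x))))%:E =
  \int[mu]_y (semicircle_kernel e (s ^+ 2 - y ^+ 2) * (expR (q * y))%:E).
Proof.
move=> s0.
rewrite -(integral_sphere_substitution q s0 (semicircle_kernel_ge0 e) _
  (measurable_semicircle_kernel e)); last first.
  by move=> w w0; rewrite /semicircle_kernel ltNge w0.
apply: eq_integral => x; rewrite inE/= in_itv/= => /sin_ge0_pi.
rewrite le_eqVlt => /predU1P[<-|sx].
  by rewrite expr0n/= mul0r mulr0 mulr0 mul0r mul0e.
have ssx : (0 < s * sin x)%R by rewrite mulr_gt0.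
rewrite /semicircle_kernel exprn_gt0// sqrtr_sqr gtr0_norm// -EFinM; congr EFin.
rewrite mulrDr expRD (mulrCA s q) (mulrCA s e).
by ring.
Qed.

(** Only the last angle runs over [[0, 2 * pi]]. A translation by [pi] maps the lower half circle to
    the upper one with both components of [p] negated, and evenness in the height restores the sign
    of the first. *)
Lemma integral_circle_weight p (s : R) : (0 < s)%R ->
  \int[mu]_(x in `[0%R, (2 * pi)%R])
    (s ^+ 2 * (sin x ^+ 2 * expR (s * (p 0%N * cos x + p 1%N * sin x))))%:E =
  sphere_kernel 2 p (s ^+ 2).
Proof.
move=> s0.
have msin : measurable_fun setT (@sin R).
  by apply: continuous_measurable_fun => x; exact: continuous_sin.
have mcos : measurable_fun setT (@cos R).
  by apply: continuous_measurable_fun => x; exact: continuous_cos.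
pose g (q e x : R) := (s ^+ 2 * (sin x ^+ 2 * expR (s * (q * cos x + e * sin x))))%R.
have mg q e : measurable_fun setT (g q e).
  apply: measurable_funM => //; apply: measurable_funM; first exact: measurable_funX.
  apply: measurableT_comp => //; apply: measurable_funM => //.
  by apply: measurable_funD; exact: measurable_funM.
have g0 q e x : (0 <= g q e x)%R.
  by apply: mulr_ge0; [exact: sqr_ge0|apply: mulr_ge0; [exact: sqr_ge0|exact: expR_ge0]].
have mgE q e : measurable_fun setT (EFin \o g q e) by exact/measurable_EFinP.
have pi0 := pi_ge0 R.
have split_itv : `[0%R, (2 * pi)%R]%classic = `[0%R, pi]%classic `|` `]pi, (2 * pi)%R]%classic :> set R.
  apply/seteqP; split => x /=; rewrite !in_itv/=.
    by move=> /andP[-> ->]; rewrite andbT/=; case: leP => _; [left|right].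
  move=> [/andP[-> xpi]|/andP[pix ->]].
    by rewrite (le_trans xpi)//; lra.
  by rewrite andbT (le_trans pi0 (ltW pix)).
rewrite split_itv ge0_integral_setU//=; last 3 first.
- exact: (measurable_funTS (mgE _ _)).
- by move=> x _; rewrite lee_fin; exact: g0.
- apply/disj_setPLR => x /=; rewrite !in_itv/= => /andP[_ xpi].
  by rewrite ltNge xpi.
rewrite integral_semicircle//.
have -> : \int[mu]_(x in `]pi, (2 * pi)%R]) (g (p 0%N) (p 1%N) x)%:E =
    \int[mu]_(x in `[0%R, pi]) (g (- p 0%N) (- p 1%N) x)%:E.
  rewrite -[RHS]integral_itv_obnd_cbnd; last exact: (measurable_funTS (mgE _ _)).
  rewrite integral_mkcond [RHS]integral_mkcond -(ge0_integral_lebesgue_shift pi).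
  - apply: eq_integral => x _; rewrite /patch !mem_setE !in_itv/=.
    rewrite ltrDr (_ : (x + pi <= 2 * pi) = (x <= pi))%R; last by apply/idP/idP; lra.
    case: ifP => // _; rewrite /g sinDpi cosDpi sqrrN; congr EFin.
    by rewrite !mulrN !mulNr.
  - by move=> x; rewrite /patch; case: ifP => // _; rewrite lee_fin; exact: g0.
  - by apply/(measurable_restrictT _ _).1 => //; exact: (measurable_funTS (mgE _ _)).
rewrite integral_semicircle//.
have msk q e : measurable_fun setT (fun y : R =>
    semicircle_kernel e (s ^+ 2 - y ^+ 2) * (expR (q * y))%:E).
  apply: emeasurable_funM.
    apply: (measurableT_comp (measurable_semicircle_kernel e)).
    by apply: measurable_funB => //; exact: measurable_funX.
  by apply/measurable_EFinP; apply: measurableT_comp => //; exact: measurable_funM.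
have sk0 q e (y : R) : 0 <= semicircle_kernel e (s ^+ 2 - y ^+ 2) * (expR (q * y))%:E.
  by apply: mule_ge0; [exact: semicircle_kernel_ge0|rewrite lee_fin expR_ge0].
have -> : \int[mu]_y (semicircle_kernel (- p 1%N) (s ^+ 2 - y ^+ 2) * (expR (- p 0%N * y))%:E) =
    \int[mu]_y (semicircle_kernel (- p 1%N) (s ^+ 2 - y ^+ 2) * (expR (p 0%N * y))%:E).
  rewrite -ge0_integral_lebesgue_opp; [|exact: sk0|exact: msk].
  by apply: eq_integral => y _; rewrite sqrrN mulrNN.
rewrite -(ge0_integralD mu measurableT (fun y _ => sk0 _ _ y) (msk _ _)
  (fun y _ => sk0 _ _ y) (msk _ _)).
rewrite -integral_sphere_kernel_expR; apply: eq_integral => y _.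
rewrite -ge0_muleDl ?semicircle_kernel_ge0//; congr (_ * _).
have [w0|w0] := ltP 0%R (s ^+ 2 - y ^+ 2)%R; last first.
  by rewrite /semicircle_kernel ltNge w0/= adde0 sphere_kernel_le0.
by rewrite sphere_kernel1// /semicircle_kernel w0 -EFinD -mulrDr mulNr.
Qed.

(** Fixing the first angle x leaves a sphere of radius s sin x in one dimension less. The power of s
    sin x has one factor more than the induction hypothesis asks for, and this factor is the
    Jacobian of the change to the height. *)
Lemma integral_angles_weight p m (s : R) : (0 < s)%R ->
  (s ^+ m.+2)%:E * \int[lebesgue_tuple m.+1]_th
    (angles_weight th * expR (s * dir_dotp p th))%:E =
  sphere_kernel m.+2 p (s ^+ 2).
Proof.
have msin : measurable_fun setT (@sin R).
  by apply: continuous_measurable_fun => x; exact: continuous_sin.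
have mcos : measurable_fun setT (@cos R).
  by apply: continuous_measurable_fun => x; exact: continuous_cos.
have w0 n q r (th : n.+1.-tuple R) : (0 <= angles_weight th * expR (r * dir_dotp q th))%R.
  by rewrite mulr_ge0 ?angles_weight_ge0 ?expR_ge0.
have mw n q r : measurable_fun setT (fun th : n.+1.-tuple R =>
    (angles_weight th * expR (r * dir_dotp q th))%R).
  apply: measurable_funM; first exact: measurable_angles_weight.
  apply: measurableT_comp => //; apply: measurable_funM => //.
  exact: measurable_dir_dotp.
elim: m p s => [|m IH] p s s0.
  rewrite -integral_circle_weight// ge0_integral_lebesgue_tupleS; last 2 first.
  - by move=> th; rewrite lee_fin; exact: w0.
  - by apply/measurable_EFinP; exact: mw.
  pose g (x : R) := (sin x ^+ 2 * expR (s * (p 0%N * cos x + p 1%N * sin x)))%R.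
  have mg : measurable_fun setT g.
    apply: measurable_funM; first exact: measurable_funX.
    apply: measurableT_comp => //; apply: measurable_funM => //.
    by apply: measurable_funD; exact: measurable_funM.
  have g0 (x : R) : `[0%R, (2 * pi)%R]%classic x -> 0 <= (g x)%:E.
    by move=> _; rewrite lee_fin; apply: mulr_ge0; [exact: sqr_ge0|exact: expR_ge0].
  have s2 : 0 <= (s ^+ 2)%:E by rewrite lee_fin sqr_ge0.
  have mgE : measurable_fun `[0%R, (2 * pi)%R]%classic (EFin \o g).
    by apply: measurable_funTS; exact/measurable_EFinP.
  have := ge0_integralZl mu (measurable_itv _) mgE g0 s2.
  under eq_integral do rewrite /= -EFinM.
  move=> ->; congr (_ * _); rewrite [RHS]integral_mkcond; apply: eq_integral => x _.
  rewrite ge0_integral_lebesgue_tuple0; last by move=> th; rewrite lee_fin; exact: w0.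
  rewrite angles_weight0 dir_dotp0 /patch mem_setE in_itv/=.
  by case: ifP => // _; rewrite mul0r.
rewrite ge0_integral_lebesgue_tupleS; last 2 first.
- by move=> th; rewrite lee_fin; exact: w0.
- by apply/measurable_EFinP; exact: mw.
have mI : measurable_fun setT (fun x : R => \int[lebesgue_tuple m.+1]_th
    (angles_weight (consp (x, th)) * expR (s * dir_dotp p (consp (x, th))))%:E).
  apply: (measurable_integral_lebesgue_tuple
    (f := fun th => (angles_weight th * expR (s * dir_dotp p th))%:E)).
    by move=> th; rewrite lee_fin; exact: w0.
  by apply/measurable_EFinP; exact: mw.
have I0 (x : R) : [set: R] x -> 0 <= \int[lebesgue_tuple m.+1]_th
    (angles_weight (consp (x, th)) * expR (s * dir_dotp p (consp (x, th))))%:E.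
  by move=> _; apply: integral_ge0 => th _; rewrite lee_fin; exact: w0.
have sm0 : 0 <= (s ^+ m.+3)%:E by rewrite lee_fin exprn_ge0// ltW.
rewrite -(ge0_integralZl mu measurableT mI I0 sm0).
rewrite -integral_sphere_kernel_expR.
rewrite -(integral_sphere_substitution (p 0%N) s0 (H := sphere_kernel m.+2 (p \o succn))); last 3 first.
- by move=> w; exact: sphere_kernel_ge0.
- by move=> w; exact: sphere_kernel_le0.
- exact: measurable_sphere_kernel.
rewrite [RHS]integral_mkcond; apply: eq_integral => x _.
rewrite /patch mem_setE in_itv/=.
case: ifPn => x0pi; last first.
  rewrite (_ : \int[lebesgue_tuple m.+1]_th
    (angles_weight (consp (x, th)) * expR (s * dir_dotp p (consp (x, th))))%:E = 0).
    by rewrite mule0.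
  apply: integral0_eq => th _.
  by rewrite angles_weightS (negbTE x0pi) !mul0r.
transitivity ((s ^+ m.+3 * (sin x ^+ m.+3 * expR (s * (p 0%N * cos x))))%:E *
  \int[lebesgue_tuple m.+1]_th
    (angles_weight th * expR ((s * sin x) * dir_dotp (p \o succn) th))%:E).
  rewrite (EFinM (s ^+ m.+3)) -muleA; congr (_ * _).
  have k0 : (0 <= sin x ^+ m.+3 * expR (s * (p 0%N * cos x)))%R.
    by rewrite mulr_ge0 ?expR_ge0// exprn_ge0// sin_ge0_pi.
  transitivity (\int[lebesgue_tuple m.+1]_th
    (sin x ^+ m.+3 * expR (s * (p 0%N * cos x)) *
      (angles_weight th * expR ((s * sin x) * dir_dotp (p \o succn) th)))%:E); last first.
    exact: (ge0_integralMl _ k0 (w0 m (p \o succn) (s * sin x)%R) (mw m (p \o succn) (s * sin x)%R)).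
  congr (integral _ _ _); apply/funext => th; congr EFin.
  by rewrite angles_weightS x0pi dir_dotpS mulrDr expRD (mulrA s (sin x)); ring.
(* At the poles the radius is zero and the induction hypothesis does not apply, but both sides
   vanish. *)
have := sin_ge0_pi x0pi; rewrite le_eqVlt => /predU1P[<-|sx].
  by rewrite mulr0 !mul0r expr0n/= !mul0r mulr0 !mul0e.
rewrite -(IH (p \o succn) (s * sin x)%R) ?mulr_gt0// [RHS]muleA -EFinM.
by congr (_%:E * _); rewrite !exprMn !exprS (mulrCA s (p 0%N)); ring.
Qed.

End angles.

(** * Convolutions in time *)

Section time_kernel.
Local Open Scope ereal_scope.
Context (R : realType).
Local Notation mu := (@lebesgue_measure R).
Local Notation G := (half_gamma R).
Local Notation spi := (Num.sqrt (pi : R)).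

(** The inverse Laplace transform of z^(-k-1). *)
Definition pos_monomial (k : nat) (s : R) : R := (if 0 < s then s ^+ k / k`!%:R else 0)%R.

Lemma pos_monomial_ge0 k s : (0 <= pos_monomial k s)%R.
Proof. by rewrite /pos_monomial; case: ifP => // /ltW s0; rewrite divr_ge0 ?exprn_ge0. Qed.

Lemma pos_monomial_le0 k s : (s <= 0)%R -> pos_monomial k s = 0%R.
Proof. by rewrite /pos_monomial ltNge => ->. Qed.

Lemma measurable_pos_monomial k : measurable_fun setT (pos_monomial k).
Proof.
apply: measurable_fun_ifT => //; first exact: measurable_fun_ltr.
by apply: measurable_funM => //; exact: measurable_funX.
Qed.

(** Scaling by [t] reduces this to the Beta integral with integer arguments. *)
Lemma pos_monomial_conv j k t :
  \int[mu]_s (pos_monomial j s * pos_monomial k (t - s))%:E =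
  (pos_monomial (j + k).+1 t)%:E.
Proof.
have [t0|t0] := ltP 0%R t; last first.
  rewrite pos_monomial_le0// integral0_eq// => s _.
  have [s0|s0] := ltP 0%R s; last by rewrite pos_monomial_le0// mul0r.
  by rewrite [X in (_ * X)%R]pos_monomial_le0 ?mulr0//; lra.
have f0 s : (0 <= pos_monomial j s * pos_monomial k (t - s))%R.
  by rewrite mulr_ge0 ?pos_monomial_ge0.
have mf : measurable_fun setT (fun s : R => pos_monomial j s * pos_monomial k (t - s))%R.
  apply: measurable_funM; first exact: measurable_pos_monomial.
  by apply: (measurableT_comp (measurable_pos_monomial k)); exact: measurable_funB.
rewrite -(ge0_integral_lebesgue_scale t0); last 2 first.
- by move=> s; rewrite lee_fin.
- exact/measurable_EFinP.
pose c := (t ^+ (j + k) / (j`!%:R * k`!%:R))%R.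
have c0 : (0 <= c)%R by rewrite divr_ge0 ?exprn_ge0 ?(ltW t0).
pose X : R -> R := @XMonemX R j k.
pose Xr : R -> R := X \_ `[0%R, 1%R].
have mX : measurable_fun setT Xr.
  by apply/(measurable_restrictT _ _).1 => //; exact: measurable_XMonemX.
have X0 (x : R) : (0 <= Xr x)%R.
  by rewrite /Xr /patch; case: ifPn => //; rewrite inE => x01; rewrite /X XMonemX_ge0.
transitivity (t%:E * \int[mu]_x (c * Xr x)%:E).
  congr (_ * _).
  transitivity (\int[mu]_(x in `]0%R, 1%R[) (c * X x)%:E).
    rewrite [RHS]integral_mkcond; apply: eq_integral => x _.
    rewrite /patch mem_setE in_itv/= /pos_monomial pmulr_rgt0//.
    have -> : (0 < t - t * x)%R = (x < 1)%R.
      by rewrite subr_gt0 -[ltRHS]mulr1 ltr_pM2l.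
    case: (0 < x)%R; last by rewrite mul0r.
    case: (x < 1)%R => /=; last by rewrite mulr0.
    congr EFin; have -> : (t - t * x = t * (1 - x))%R by ring.
    have -> : (X x = x ^+ j * (1 - x) ^+ k)%R by [].
    rewrite /c !exprMn exprD.
    by field; rewrite !pnatr_eq0 -!lt0n !fact_gt0.
  have mcX : measurable_fun setT (fun x : R => (c * X x)%:E).
    by apply/measurable_EFinP; apply: measurable_funM => //; exact: measurable_XMonemX.
  rewrite -(@integral_itv_bndoo _ _ _ _ true false); last exact: measurable_funTS.
  rewrite [LHS]integral_mkcond; apply: eq_integral => x _.
  rewrite /Xr /patch; case: (x \in `[0%R, 1%R]%classic) => //=.
  exact: (congr1 EFin (esym (mulr0 c))).
rewrite (ge0_integralMl mu c0 X0 mX).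
have := @EFin_beta_fun R j.+1 k.+1; rewrite [j.+1.-1]/= [k.+1.-1]/= => <-.
rewrite beta_fun_fact -!EFinM /pos_monomial t0; congr EFin.
rewrite /c exprS natrM; field.
by rewrite !pnatr_eq0 -!lt0n !fact_gt0.
Qed.

(** The coefficient of u^m in (1 - u)^(-x). *)
Definition rising (x : R) m : R := (\prod_(i < m) (x + i%:R) / m`!%:R)%R.

Lemma rising_ge0 x m : (0 <= x)%R -> (0 <= rising x m)%R.
Proof. by move=> x0; rewrite divr_ge0//; apply: prodr_ge0 => i _; rewrite addr_ge0. Qed.

Lemma risingS x m : (m.+1%:R * rising x m.+1 = (x + m%:R) * rising x m)%R.
Proof.
rewrite /rising big_ord_recr/= factS natrM; field.
by rewrite (addrC 1%R) natr1 !pnatr_eq0 -lt0n fact_gt0.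
Qed.

(** The product of (1 - u)^(-x) and (1 - u)^(-y). In the induction the factor m + 1 is split as i +
    (m + 1 - i), and each part is absorbed by one of the two recurrences. *)
Lemma rising_vandermonde x y m :
  (\sum_(i < m.+1) rising x i * rising y (m - i)%N = rising (x + y) m)%R.
Proof.
elim: m => [|m IH].
  by rewrite big_ord1 /rising !big_ord0 fact0 divr1 mulr1.
apply: (@mulfI _ m.+1%:R%R); first by rewrite pnatr_eq0.
rewrite risingS -IH mulr_sumr.
transitivity (\sum_(i < m.+2) (i%:R * rising x i * rising y (m.+1 - i)%N +
   rising x i * ((m.+1 - i)%:R * rising y (m.+1 - i)%N)))%R.
  apply: eq_bigr => i _; rewrite natrB; last by rewrite -ltnS.
  by ring.
rewrite big_split/= big_ord_recl/= !mul0r add0r.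
rewrite [X in (_ + X)%R]big_ord_recr/= subnn mul0r mulr0 addr0 -big_split/=.
rewrite mulr_sumr; apply: eq_bigr => -[i /=]; rewrite ltnS => im _.
rewrite /bump/= add1n risingS subSS subSn// risingS natrB//.
by ring.
Qed.

(** Legendre's duplication formula at integers. *)
Lemma half_gammaMS k : (G k.+1 * G k.+2 = spi * k`!%:R / 2 ^+ k)%R.
Proof.
elim: k => [|k IH]; first by rewrite half_gamma1 half_gamma2 fact0 expr0 divr1.
rewrite half_gammaSS factS natrM exprS.
transitivity (k.+1%:R / 2 * (G k.+1 * G k.+2))%R; first by ring.
by rewrite IH; field; rewrite expf_neq0.
Qed.

Lemma half_gamma_rising a m :
  (G (a.+1 + 2 * m) = G a.+1 * (rising (a.+1%:R / 2) m * m`!%:R))%R.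
Proof.
elim: m => [|m IH].
  by rewrite /rising big_ord0 fact0 muln0 addn0 divr1 !mulr1.
have -> : (a.+1 + 2 * m.+1 = (a + 2 * m).+3)%N by clear; lia.
rewrite half_gammaSS -addSn IH factS natrM.
transitivity (G a.+1 * m`!%:R * (m.+1%:R * rising (a.+1%:R / 2) m.+1))%R; last by ring.
rewrite risingS addSn; have -> : ((a + 2 * m).+1%:R = a.+1%:R + 2 * m%:R :> R)%R.
  by rewrite -addSn natrD natrM.
by field.
Qed.

(* The inverse Laplace transform of [z |-> (z ^+ 2 - r) `^ (- a%:R / 2)]. *)
Definition time_kernel (a : nat) (r s : R) : \bar R :=
  \sum_(m <oo) (rising (a%:R / 2)%R m * r ^+ m * pos_monomial (a.-1 + 2 * m) s)%:E.

Lemma time_kernel_term_ge0 a r s m : (0 <= r)%R ->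
  (0 <= rising (a%:R / 2) m * r ^+ m * pos_monomial (a.-1 + 2 * m) s)%R.
Proof.
move=> r0; apply: mulr_ge0; last exact: pos_monomial_ge0.
by apply: mulr_ge0; [rewrite rising_ge0// divr_ge0|exact: exprn_ge0].
Qed.

Lemma time_kernel_ge0 a r s : (0 <= r)%R -> 0 <= time_kernel a r s.
Proof.
by move=> r0; apply: nneseries_ge0 => m _ _; rewrite lee_fin; exact: time_kernel_term_ge0.
Qed.

Lemma time_kernel_le0 a r s : (s <= 0)%R -> time_kernel a r s = 0.
Proof. by move=> s0; apply: eseries0 => m _ _; rewrite pos_monomial_le0 ?mulr0. Qed.

Lemma measurable_time_kernel a r : (0 <= r)%R -> measurable_fun setT (time_kernel a r).
Proof.
move=> r0; apply: (ge0_emeasurable_sum (P := xpredT)) => //.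
- by move=> m w _ _; rewrite lee_fin; exact: time_kernel_term_ge0.
- move=> m _; apply/measurable_EFinP; apply: measurable_funM => //.
  exact: measurable_pos_monomial.
Qed.

(** At [s ^+ 2] the half-integer powers become monomials in [s], and the duplication formula turns
    their Gamma values into the factorials of [pos_monomial] and the coefficients [rising]. *)
Lemma bessel_kernel_sqr a r s : (0 < s)%R -> (0 <= r)%R ->
  bessel_kernel a.+1 r (s ^+ 2) =
  (2 ^+ a * G a.+1 / spi)%:E * time_kernel a.+1 r s.
Proof.
move=> s0 r0; rewrite /time_kernel -nneseriesZl; last first.
  by move=> m _; rewrite lee_fin; exact: time_kernel_term_ge0.
apply: eq_eseriesr => m _; rewrite -EFinM; congr EFin.
rewrite /riesz exprn_gt0// /pos_monomial s0 addSn.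
have -> : ((s ^+ 2) `^ (((a + 2 * m).+1%:R - 1) / 2) = s ^+ (a + 2 * m))%R.
  rewrite -[(s ^+ 2)%R]powR_mulrn ?(ltW s0)// -powRrM -powR_mulrn ?(ltW s0)//.
  by congr (_ `^ _)%R; rewrite -natr1; field.
have spi0 : spi != 0%R by rewrite gt_eqF// sqrtr_gt0 pi_gt0.
have G1 := half_gamma_neq0 R (a + 2 * m).
have G2 := half_gamma_neq0 R (a + 2 * m).+1.
have -> : (G (a + 2 * m).+2 = spi * (a + 2 * m)`!%:R / 2 ^+ (a + 2 * m) / G (a + 2 * m).+1)%R.
  by rewrite -half_gammaMS mulrAC divff ?mul1r.
rewrite -[(a + 2 * m).+1]addSn half_gamma_rising /exp_coeff/=.
have ri0 : (rising (a.+1%:R / 2) m != 0)%R.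
  rewrite mulf_neq0 ?invr_neq0 ?pnatr_eq0 -?lt0n ?fact_gt0//.
  by rewrite prodf_seq_neq0; apply/allP => i _; rewrite implyTb gt_eqF// ltr_wpDr// divr_gt0.
rewrite exprMn exprVn (exprD s) (exprD 2%R) !exprM.
have -> : (4 = 2 ^+ 2 :> R)%R by rewrite -natrX.
have Ga := half_gamma_neq0 R a.
field.
rewrite spi0 ri0 Ga !expf_neq0// !pnatr_eq0 -!lt0n !fact_gt0 //.
Qed.

Lemma time_kernel_fin_num a r s : (0 < a)%N -> (0 <= r)%R ->
  time_kernel a r s \is a fin_num.
Proof.
case: a => // a _ r0; have [s0|s0] := ltP 0%R s; last by rewrite time_kernel_le0.
have := bessel_kernel_fin_num a (s ^+ 2)%R r0; rewrite bessel_kernel_sqr//.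
have c0 : (0 < 2 ^+ a * G a.+1 / spi)%R.
  by rewrite divr_gt0 ?sqrtr_gt0 ?pi_gt0// mulr_gt0 ?exprn_gt0 ?half_gamma_gt0.
rewrite !ge0_fin_numE ?time_kernel_ge0//; last first.
  by apply: mule_ge0; [rewrite lee_fin ltW|exact: time_kernel_ge0].
have := time_kernel_ge0 a.+1 s r0.
by case: (time_kernel a.+1 r s) => [v| |]//; rewrite ?ltry// gt0_muley ?lte_fin.
Qed.

(** On the transform side two powers of z^2 - r are multiplied. On the series this is the
    convolution of monomials followed by the Vandermonde identity along the diagonals. *)
Lemma time_kernel_conv a b r t : (0 < a)%N -> (0 < b)%N -> (0 <= r)%R ->
  \int[mu]_s (time_kernel a r s * time_kernel b r (t - s)) = time_kernel (a + b) r t.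
Proof.
move=> a0 b0 r0.
pose c k m := (rising (k%:R / 2) m * r ^+ m)%R.
have c0 k m : (0 <= c k m)%R.
  by apply: mulr_ge0; [rewrite rising_ge0// divr_ge0|exact: exprn_ge0].
pose u m l s := (pos_monomial (a.-1 + 2 * m) s * pos_monomial (b.-1 + 2 * l) (t - s))%R.
have u0 m l s : (0 <= u m l s)%R by rewrite mulr_ge0 ?pos_monomial_ge0.
have mu' m l : measurable_fun setT (u m l).
  apply: measurable_funM; first exact: measurable_pos_monomial.
  by apply: (measurableT_comp (measurable_pos_monomial _)); exact: measurable_funB.
pose f m l s := (c a m * c b l * u m l s)%:E.
have f0 m l s : 0 <= f m l s by rewrite lee_fin mulr_ge0// mulr_ge0.
have mf m l : measurable_fun setT (f m l).
  by apply/measurable_EFinP; exact: measurable_funM.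
transitivity (\int[mu]_s \sum_(m <oo) \sum_(l <oo) f m l s).
  apply: eq_integral => s _; rewrite -(fineK (time_kernel_fin_num (t - s) b0 r0)).
  rewrite muleC -nneseriesZl; last first.
    by move=> m _; rewrite lee_fin; exact: time_kernel_term_ge0.
  apply: eq_eseriesr => m _; rewrite muleC fineK ?time_kernel_fin_num//.
  rewrite -nneseriesZl; last first.
    by move=> l _; rewrite lee_fin; exact: time_kernel_term_ge0.
  by apply: eq_eseriesr => l _; rewrite -EFinM; congr EFin; rewrite /c /u; ring.
have mS m : measurable_fun setT (fun s => \sum_(l <oo) f m l s).
  apply: (ge0_emeasurable_sum (P := xpredT)) => //.
rewrite (integral_nneseries mu measurableT mS); last first.
  by move=> m s _; apply: nneseries_ge0.
transitivity (\sum_(m <oo) \sum_(l <oo)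
   (c a m * c b l * pos_monomial ((a + b).-1 + 2 * (m + l)) t)%:E).
  apply: eq_eseriesr => m _.
  rewrite (integral_nneseries mu measurableT (mf m)); last by move=> l s _; exact: f0.
  apply: eq_eseriesr => l _; rewrite (ge0_integralMl mu (mulr_ge0 (c0 _ _) (c0 _ _)) (u0 m l) (mu' m l)).
  rewrite pos_monomial_conv -EFinM; congr (_ * pos_monomial _ _)%:E.
  by move: a0 b0; clear; lia.
rewrite nneseries_diag; last first.
  by move=> m l; rewrite lee_fin; apply: mulr_ge0; [exact: mulr_ge0|exact: pos_monomial_ge0].
apply: eq_eseriesr => i _; rewrite sumEFin; congr EFin.
rewrite natrD mulrDl -rising_vandermonde !mulr_suml; apply: eq_bigr => -[m /=].
rewrite ltnS => mi _; rewrite subnKC// /c.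
have -> : (r ^+ i = r ^+ m * r ^+ (i - m))%R by rewrite -exprD subnKC.
by ring.
Qed.

End time_kernel.

(** * Integrals over the simplex as iterated convolutions *)

Section simplex_integral.
Local Open Scope ereal_scope.
Context (R : realType).
Local Notation mu := (@lebesgue_measure R).
Local Notation G := (half_gamma R).
Local Notation spi := (Num.sqrt (pi : R)).

Lemma prode_ge0 (I : Type) (r : seq I) (P : pred I) (F : I -> \bar R) :
  (forall i, P i -> 0 <= F i) -> 0 <= \prod_(i <- r | P i) F i.
Proof.
move=> F0; apply: (big_ind (fun x : \bar R => 0 <= x)) => //.
by move=> x y; exact: mule_ge0.
Qed.

Lemma emeasurable_prod d (T : measurableType d) n (F : 'I_n -> T -> \bar R) :
  (forall i, measurable_fun setT (F i)) ->
  measurable_fun setT (fun x => \prod_(i < n) F i x).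
Proof.
move=> mF.
rewrite (_ : (fun x => _) = \big[(fun f g x => f x * g x)/cst 1]_(i < n) F i); last first.
  by apply/funext => x; elim/big_ind2 : _ => //= f1 g1 f2 g2 <- <-.
by apply: big_ind => // f g; exact: emeasurable_funM.
Qed.

Lemma measurable_duration (t : R) n k :
  measurable_fun setT (fun s : n.-tuple R => duration t s k).
Proof.
rewrite /duration; case: (k < n)%N; first exact: measurable_tuple_nth.
by apply: measurable_funB => //; apply: measurable_sum => i; exact: measurable_tnth.
Qed.

Lemma duration_consp0 (t s0 : R) n (s : n.-tuple R) : duration t (consp (s0, s)) 0 = s0.
Proof. by []. Qed.

Lemma duration_conspS (t s0 : R) n (s : n.-tuple R) k :
  duration t (consp (s0, s)) k.+1 = duration (t - s0) s k.
Proof.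
rewrite /duration ltnS; case: ifP => // _.
rewrite big_ord_recl opprD addrA (tnth_nth 0%R)/=; congr (_ - _)%R.
by apply: eq_bigr => i _; rewrite !(tnth_nth 0%R).
Qed.

(** The convolution power of [h] with [n.+1] factors, at time [t]. The integral is over all of R^n:
    if [h] vanishes for [s <= 0], as the time kernels do, only the simplex contributes. *)
Definition simplex_integral (h : R -> \bar R) n (t : R) : \bar R :=
  \int[lebesgue_tuple n]_s \prod_(k < n.+1) h (duration t s k).

Lemma simplex_integral0 h t : (forall s, 0 <= h s) -> simplex_integral h 0 t = h t.
Proof.
move=> h0; rewrite /simplex_integral ge0_integral_lebesgue_tuple0.
  by rewrite big_ord1 /duration/= big_ord0 subr0.
by move=> s; apply: prode_ge0.
Qed.

Lemma measurable_simplex_integrand (h : R -> \bar R) n (t : R) : measurable_fun setT h ->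
  measurable_fun setT (fun s : n.-tuple R => \prod_(k < n.+1) h (duration t s k)).
Proof.
move=> mh; apply: emeasurable_prod => k.
by apply: (measurableT_comp mh); exact: measurable_duration.
Qed.

Lemma simplex_integralS (h : R -> \bar R) n (t : R) :
  (forall s, 0 <= h s) -> measurable_fun setT h ->
  simplex_integral h n.+1 t = \int[mu]_s (h s * simplex_integral h n (t - s)).
Proof.
move=> h0 mh.
rewrite [LHS]ge0_integral_lebesgue_tupleS; last 2 first.
- by move=> s; apply: prode_ge0.
- exact: measurable_simplex_integrand.
apply: eq_integral => s0 _.
rewrite /simplex_integral
  -(ge0_integralZl _ measurableT (@measurable_simplex_integrand h n (t - s0)%R mh) _ (h0 s0)); last first.
  by move=> s _; apply: prode_ge0.
congr (integral _ _ _); apply/funext => s.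
rewrite big_ord_recl duration_consp0; congr (_ * _).
by apply: eq_bigr => i _; rewrite -duration_conspS.
Qed.

(** With S the shift of [T], one more convolution multiplies (1 + x S)^(n+1) by 1 + x S; on
    coefficients this is Pascal's rule. *)
Lemma pascal_sum n (x : R) (T : nat -> R) :
  (\sum_(m < n.+2) 'C(n.+1, m)%:R * x ^+ m * (T m + x * T m.+1) =
   \sum_(m < n.+3) 'C(n.+2, m)%:R * x ^+ m * T m)%R.
Proof.
transitivity (\sum_(m < n.+2) 'C(n.+1, m)%:R * x ^+ m * T m +
  \sum_(m < n.+2) 'C(n.+1, m)%:R * x ^+ m.+1 * T m.+1)%R.
  by rewrite -big_split/=; apply: eq_bigr => m _; rewrite exprS; ring.
rewrite [RHS]big_ord_recl [in LHS]big_ord_recl/= !bin0 -addrA; congr (_ + _)%R.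
transitivity (\sum_(m < n.+2) 'C(n.+1, m.+1)%:R * x ^+ m.+1 * T m.+1 +
  \sum_(m < n.+2) 'C(n.+1, m)%:R * x ^+ m.+1 * T m.+1)%R.
  by congr (_ + _)%R; rewrite [RHS]big_ord_recr/= bin_small// !mul0r addr0.
rewrite -big_split/=; apply: eq_bigr => m _.
by rewrite /bump/= add1n (binS n.+1) natrD; ring.
Qed.

Section two_term.
Variables (a : nat) (r x : R).
Hypotheses (a0 : (0 < a)%N) (r0 : (0 <= r)%R) (x0 : (0 <= x)%R).

Definition two_term_kernel (s : R) : \bar R :=
  time_kernel a r s + x%:E * time_kernel (a + 2) r s.

Lemma two_term_kernel_ge0 s : 0 <= two_term_kernel s.
Proof.
apply: adde_ge0; first exact: time_kernel_ge0.
by apply: mule_ge0; [rewrite lee_fin|exact: time_kernel_ge0].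
Qed.

Lemma measurable_two_term_kernel : measurable_fun setT two_term_kernel.
Proof.
apply: emeasurable_funD; first exact: measurable_time_kernel.
by apply: measurable_funeM; exact: measurable_time_kernel.
Qed.

Lemma two_term_kernel_conv b t : (0 < b)%N ->
  \int[mu]_s (two_term_kernel s * time_kernel b r (t - s)) =
  time_kernel (a + b) r t + x%:E * time_kernel (a + b + 2) r t.
Proof.
move=> b0.
have mtt c : measurable_fun setT (fun s : R => time_kernel c r s * time_kernel b r (t - s)).
  apply: emeasurable_funM; first exact: measurable_time_kernel.
  by apply: (measurableT_comp (measurable_time_kernel b r0)); exact: measurable_funB.
have tt0 c (s : R) : [set: R] s -> 0 <= time_kernel c r s * time_kernel b r (t - s).
  by move=> _; apply: mule_ge0; exact: time_kernel_ge0.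
have xE : 0 <= x%:E by rewrite lee_fin.
transitivity (\int[mu]_s (time_kernel a r s * time_kernel b r (t - s) +
   x%:E * (time_kernel (a + 2) r s * time_kernel b r (t - s)))).
  apply: eq_integral => s _; rewrite /two_term_kernel ge0_muleDl ?muleA//.
  - exact: time_kernel_ge0.
  - by apply: mule_ge0 => //; exact: time_kernel_ge0.
rewrite (ge0_integralD mu measurableT (tt0 a) (mtt a) _ (measurable_funeM _ (mtt _))); last first.
  by move=> s sT; apply: mule_ge0 => //; exact: (tt0 _ s sT).
rewrite (ge0_integralZl mu measurableT (mtt _) (tt0 _) xE).
by rewrite !time_kernel_conv ?addn_gt0 ?a0// addnAC.
Qed.

Lemma simplex_integral_two_term n t :
  simplex_integral two_term_kernel n t =
  \sum_(m < n.+2) ('C(n.+1, m)%:R * x ^+ m)%:E * time_kernel (n.+1 * a + 2 * m) r t.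
Proof.
have kpos n' m : (0 < n'.+1 * a + 2 * m)%N by rewrite addn_gt0 muln_gt0 a0.
have T0 c (s : R) : 0 <= time_kernel c r s by exact: time_kernel_ge0.
have C0 n' m : 0 <= ('C(n', m)%:R * x ^+ m)%:E.
  by rewrite lee_fin mulr_ge0// exprn_ge0.
elim: n t => [|n IH] t.
  rewrite simplex_integral0; last exact: two_term_kernel_ge0.
  rewrite big_ord_recl big_ord1 /= bin0 binn expr0 expr1 !mul1r mul1e mul1n muln0 addn0.
  by rewrite muln1.
rewrite simplex_integralS; [|exact: two_term_kernel_ge0|exact: measurable_two_term_kernel].
have mT m : measurable_fun setT (fun s : R =>
    two_term_kernel s * time_kernel (n.+1 * a + 2 * m) r (t - s)).
  apply: emeasurable_funM; first exact: measurable_two_term_kernel.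
  by apply: (measurableT_comp (measurable_time_kernel _ r0)); exact: measurable_funB.
transitivity (\int[mu]_s \sum_(m < n.+2) ('C(n.+1, m)%:R * x ^+ m)%:E *
    (two_term_kernel s * time_kernel (n.+1 * a + 2 * m) r (t - s))).
  apply: eq_integral => s _; rewrite IH ge0_sume_distrr; last first.
    by move=> m _; apply: mule_ge0.
  by apply: eq_bigr => m _; rewrite muleCA.
rewrite ge0_integral_sum//; last 2 first.
- by move=> m; apply: measurable_funeM; exact: mT.
- move=> m s _; apply: mule_ge0 => //; apply: mule_ge0 => //.
  exact: two_term_kernel_ge0.
transitivity (\sum_(m < n.+2) ('C(n.+1, m)%:R * x ^+ m)%:E *
   (time_kernel (n.+2 * a + 2 * m) r t + x%:E * time_kernel (n.+2 * a + 2 * m.+1) r t)).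
  apply: eq_bigr => m _.
  rewrite (ge0_integralZl mu measurableT (mT m) _ (C0 _ _)); last first.
    by move=> s _; apply: mule_ge0 => //; exact: two_term_kernel_ge0.
  rewrite two_term_kernel_conv//.
  have -> : (a + (n.+1 * a + 2 * m) = n.+2 * a + 2 * m)%N by rewrite mulSn addnA.
  by have -> : (n.+2 * a + 2 * m + 2 = n.+2 * a + 2 * m.+1)%N by rewrite mulnS addnAC addnA.
pose T m := fine (time_kernel (n.+2 * a + 2 * m) r t).
have TE m : time_kernel (n.+2 * a + 2 * m) r t = (T m)%:E.
  by rewrite fineK// time_kernel_fin_num.
transitivity (\sum_(m < n.+2) ('C(n.+1, m)%:R * x ^+ m * (T m + x * T m.+1))%:E).
  by apply: eq_bigr => m _; rewrite !TE.
transitivity (\sum_(m < n.+3) ('C(n.+2, m)%:R * x ^+ m * T m)%:E); last first.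
  by apply: eq_bigr => m _; rewrite TE.
by rewrite !sumEFin pascal_sum.
Qed.

End two_term.

(** With d = m + 2, the factor d + 1 in front of p_d^2 is the ratio of the constants of
    [bessel_kernel_sqr] at the two indices, halved; the Gamma recurrence evaluates it. *)
Lemma sphere_kernel_time m (p : nat -> R) (s : R) : (0 < s)%R ->
  sphere_kernel m.+2 p (s ^+ 2) =
  (m.+2`!%:R * spi ^+ m.+2 / G m.+4)%:E *
  two_term_kernel m.+3 (sqp p m.+2) (m.+3%:R * p m.+1 ^+ 2) s.
Proof.
move=> s0; have r0 := sqp_ge0 p m.+2.
have k0 : (0 <= m.+3%:R * p m.+1 ^+ 2)%R by rewrite mulr_ge0// sqr_ge0.
rewrite /sphere_kernel !bessel_kernel_sqr// /two_term_kernel addn2.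
rewrite -[time_kernel m.+3 _ _]fineK ?time_kernel_fin_num//.
rewrite -[time_kernel m.+4.+1 _ _]fineK ?time_kernel_fin_num//.
set A := fine (time_kernel m.+3 _ _); set B := fine (time_kernel m.+4.+1 _ _).
transitivity ((spi ^+ m.+2 * (2 ^+ m.+2 * G m.+3 / spi * A +
    p m.+1 ^+ 2 / 2 * (2 ^+ m.+4 * G m.+4.+1 / spi * B)))%:E) => //.
transitivity ((m.+2`!%:R * spi ^+ m.+2 / G m.+4 *
    (A + m.+3%:R * p m.+1 ^+ 2 * B))%:E) => //; congr EFin.
have spi0 : spi != 0%R by rewrite gt_eqF// sqrtr_gt0 pi_gt0.
have G4 := half_gamma_neq0 R m.+3.
have G3 : (G m.+3 = spi * m.+2`!%:R / 2 ^+ m.+2 / G m.+4)%R.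
  by rewrite -half_gammaMS mulfK.
rewrite (half_gammaSS R m.+2) G3 (exprS 2 m.+3) (exprS 2 m.+2).
by field; rewrite spi0 G4 expf_neq0.
Qed.

End simplex_integral.

(** * Uniqueness of the Laplace transform *)

Section ray_approximation.
Context (R : realType).
Implicit Types (u x y : R).

Lemma bernoulli_sub u n : 0 <= u <= 1 -> 1 - n%:R * u <= (1 - u) ^+ n.
Proof.
move=> /andP[u0 u1]; elim: n => [|n IH]; first by rewrite mul0r subr0 expr0.
rewrite exprS; apply: (@le_trans _ _ ((1 - u) * (1 - n%:R * u))); last first.
  by rewrite ler_wpM2l// subr_ge0.
rewrite -subr_ge0 -natr1.
have -> : (1 - u) * (1 - n%:R * u) - (1 - (n%:R + 1) * u) = n%:R * u ^+ 2 by ring.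
by rewrite mulr_ge0// sqr_ge0.
Qed.

Lemma bernoulli_add u n : 0 <= u -> 1 + n%:R * u <= (1 + u) ^+ n.
Proof.
move=> u0; elim: n => [|n IH]; first by rewrite mul0r addr0 expr0.
rewrite exprS; apply: (@le_trans _ _ ((1 + u) * (1 + n%:R * u))); last first.
  by rewrite ler_wpM2l// addr_ge0.
rewrite -subr_ge0 -natr1.
have -> : (1 + u) * (1 + n%:R * u) - (1 + (n%:R + 1) * u) = n%:R * u ^+ 2 by ring.
by rewrite mulr_ge0// sqr_ge0.
Qed.

(** Writing y = u^2, one factor u^n absorbs [n] by Bernoulli's inequality for 1/u and the other
    tends to 0. *)
Lemma cvg_nat_expr y : 0 <= y < 1 -> (n%:R * y ^+ n) @[n --> \oo] --> (0 : R).
Proof.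
move=> /andP[]; rewrite le_eqVlt => /predU1P[<-|y0] y1.
  apply: cvg_near_cst; exists 1%N => // -[//|n] _ /=.
  by rewrite expr0n mulr0.
pose u := Num.sqrt y; have u0 : 0 < u by rewrite sqrtr_gt0.
have u1 : u < 1 by rewrite -sqrtr1 ltr_sqrt.
pose d := u^-1 - 1; have d0 : 0 < d by rewrite subr_gt0 invf_gt1.
have le n : n%:R * y ^+ n <= d^-1 * u ^+ n.
  have -> : y ^+ n = u ^+ n * u ^+ n by rewrite -exprMn -expr2 sqr_sqrtr// ltW.
  rewrite mulrA ler_pM2r ?exprn_gt0// -[leRHS]mul1r ler_pdivlMr// mulrAC.
  have := bernoulli_add n (ltW d0); rewrite {2}/d addrCA subrr addr0 => h.
  rewrite -ler_pdivlMr ?exprn_gt0// div1r -exprVn (le_trans _ h)//.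
  by rewrite -[leLHS]add0r lerD.
have lim : d^-1 * u ^+ n @[n --> \oo] --> (0 : R).
  rewrite -[X in _ --> X](mulr0 d^-1); apply: cvgM; first exact: cvg_cst.
  by apply: cvg_expr; rewrite ger0_norm// ltW.
apply: (@squeeze_cvgr _ _ _ _ (fun=> 0) (fun n => d^-1 * u ^+ n)).
- by apply: nearW => n; rewrite le mulr_ge0// exprn_ge0// ltW.
- exact: cvg_cst.
- exact: lim.
Qed.

(* [n * K ^ n * (y / K) ^+ n] is [n * y ^+ n], which tends to 0 when [y < 1] and
   to infinity otherwise. *)
Lemma cvg_ray_approx (K : nat) y : (0 < K)%N -> 0 <= y <= K%:R ->
  (1 - (y / K%:R) ^+ n) ^+ (n * K ^ n) @[n --> \oo] --> ((y < 1)%R%:R : R).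
Proof.
move=> K0 /andP[y0 yK].
have KR0 : 0 < K%:R :> R by rewrite ltr0n.
have z0 : 0 <= y / K%:R by rewrite divr_ge0.
have z1 : y / K%:R <= 1 by rewrite ler_pdivrMr// mul1r.
have zn0 n : 0 <= (y / K%:R) ^+ n by rewrite exprn_ge0.
have zn1 n : (y / K%:R) ^+ n <= 1 by rewrite exprn_ile1.
have q0 n m : 0 <= (1 - (y / K%:R) ^+ n) ^+ m by rewrite exprn_ge0// subr_ge0.
have q1 n m : (1 - (y / K%:R) ^+ n) ^+ m <= 1.
  by rewrite exprn_ile1 ?subr_ge0// gerBl.
have Kz n : (K ^ n)%:R * (y / K%:R) ^+ n = y ^+ n.
  by rewrite natrX -exprMn mulrCA divff ?mulr1// gt_eqF.
have [y1|y1] := ltP y 1.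
  have lim : 1 - n%:R * y ^+ n @[n --> \oo] --> (1 : R).
    rewrite -[X in _ --> X]subr0; apply: cvgB; first exact: cvg_cst.
    by apply: cvg_nat_expr; rewrite y0.
  apply: (@squeeze_cvgr _ _ _ _ (fun n => 1 - n%:R * y ^+ n) (fun=> 1));
    [|exact: lim|exact: cvg_cst].
  apply: nearW => n; rewrite q1 andbT.
  have zn : 0 <= (y / K%:R) ^+ n <= 1 by rewrite zn0 zn1.
  by apply: le_trans (bernoulli_sub (n * K ^ n) zn); rewrite natrM -mulrA Kz.
have lim : (n.+1%:R^-1 : R) @[n --> \oo] --> (0 : R) by exact: cvg_harmonic.
apply: (@squeeze_cvgr _ _ _ _ (fun=> 0) (fun n : nat => n.+1%:R^-1));
  [|exact: cvg_cst|exact: lim].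
apply: nearW => n; rewrite q0/=.
(* Since (1 - z)(1 + z) <= 1, an upper bound for the power of 1 - z follows from Bernoulli's lower
   bound for the power of 1 + z. *)
have w0 : 0 < 1 + (y / K%:R) ^+ n by rewrite ltr_wpDr.
apply: (@le_trans _ _ ((1 + (y / K%:R) ^+ n) ^+ (n * K ^ n))^-1).
  rewrite -[leRHS]mul1r ler_pdivlMr ?exprn_gt0// -exprMn exprn_ile1//.
    by apply: mulr_ge0; [rewrite subr_ge0|exact: ltW].
  by rewrite -subr_sqr expr1n gerBl exprn_ge0.
rewrite lef_pV2 ?posrE ?exprn_gt0 ?ltr0Sn//.
apply: le_trans (bernoulli_add (n * K ^ n) (zn0 n)).
by rewrite natrM -mulrA Kz -natr1 addrC lerD2l ler_peMr// exprn_ege1.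
Qed.

End ray_approximation.

Lemma measurable_box (R : realType) n (L : R) :
  measurable [set x : n.-tuple R | forall i : 'I_n, `|tnth x i| <= L].
Proof.
rewrite (_ : mkset _ = \bigcap_(i : 'I_n)
    ((fun x : n.-tuple R => `|tnth x i|) @^-1` `]-oo, L]%classic)).
  apply: fin_bigcap_measurable => [|i _]; first exact: finite_finset.
  rewrite -[X in measurable X]setTI.
  have : measurable_fun setT (fun x : n.-tuple R => `|tnth x i|).
    by apply: measurableT_comp => //; exact: measurable_tnth.
  by apply => //; exact: measurable_itv.
by apply/seteqP; split => x /= bx i; have := bx i; rewrite ?in_itv/=//; exact.
Qed.

Section laplace_uniqueness.
Local Open Scope ereal_scope.
Context (R : realType) (n : nat) (L : R).
Variables m1 m2 : {measure set (n.-tuple R) -> \bar R}.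
Hypotheses (m1oo : m1 setT < +oo) (m2oo : m2 setT < +oo).

Let box : set (n.-tuple R) := [set x | forall i : 'I_n, (`|tnth x i| <= L)%R].

Let box_measurable : measurable box. Proof. exact: measurable_box. Qed.

Let bound (p : nat -> R) : R := expR (\sum_(i < n) `|p i| * L)%R.

Let dotp_bound p x : box x -> (expR (dotp p x) <= bound p)%R.
Proof.
move=> bx; rewrite ler_expR; apply: ler_sum => i _.
rewrite (le_trans (ler_norm _))// normrM ler_wpM2l//.
by rewrite -(tnth_nth 0%R); exact: bx.
Qed.

(** The functions [f] for which [f m1] and [f m2] have the same transform at every [p]. Keeping all
    [p] in the condition is what makes the class stable under the operations below, which lead from
    the indicator of the box to those of rectangles in it. *)
Let good (f : n.-tuple R -> R) := [/\ forall x, (0 <= f x <= 1)%R,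
  forall x, ~ box x -> f x = 0%R, measurable_fun setT f &
  forall p, \int[m1]_x (f x * expR (dotp p x))%:E =
            \int[m2]_x (f x * expR (dotp p x))%:E].

Let measurable_fe (f : n.-tuple R -> R) (p : nat -> R) : measurable_fun setT f ->
  measurable_fun setT (fun x : n.-tuple R => f x * expR (dotp p x))%R.
Proof.
move=> mf; apply: measurable_funM => //.
by apply: measurableT_comp => //; exact: measurable_dotp.
Qed.

Let fe_bound (f : n.-tuple R -> R) (p : nat -> R) (x : n.-tuple R) :
  good f -> (0 <= f x * expR (dotp p x) <= bound p)%R.
Proof.
move=> [f01 fbox _ _]; have /andP[f0 f1] := f01 x.
rewrite mulr_ge0 ?expR_ge0//=.
have [bx|nbx] := pselect (box x); last by rewrite fbox// mul0r expR_ge0.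
by rewrite -[leRHS]mul1r ler_pM ?expR_ge0// dotp_bound.
Qed.

Let fe_lty (m : {measure set (n.-tuple R) -> \bar R}) (f : n.-tuple R -> R) (p : nat -> R) :
  m setT < +oo -> good f ->
  \int[m]_x (f x * expR (dotp p x))%:E < +oo.
Proof.
move=> moo gf; have [f01 fbox mf _] := gf.
apply: (@le_lt_trans _ _ (\int[m]_x (bound p)%:E)).
  apply: ge0_le_integral => //.
  - by move=> x _; rewrite lee_fin; have /andP[] := fe_bound p x gf.
  - by apply/measurable_EFinP; exact: measurable_fe.
  - by move=> x _; rewrite lee_fin; have /andP[] := fe_bound p x gf.
rewrite integral_cst//; apply: lte_mul_pinfty => //.
by rewrite lee_fin expR_ge0.
Qed.

Let dotp_shift (p : nat -> R) (N : nat) (i : 'I_n) (x : n.-tuple R) :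
  dotp (fun j => p j - (j == i)%:R * N%:R)%R x = (dotp p x - N%:R * x`_i)%R.
Proof.
rewrite /dotp; under eq_bigr do rewrite mulrBl.
rewrite sumrB; congr (_ - _)%R; rewrite (bigD1 i)//= eqxx mul1r big1 ?addr0//.
by move=> j ji; rewrite (_ : (j == i :> nat) = false) ?mul0r//; exact/negbTE.
Qed.

(** Multiplying by exp(-N x_i) only moves the i-th component of [p] by [N]. The integrals are finite
    because the measures are and the exponentials are bounded on the box, so the difference makes
    sense. *)
Let good_step (f : n.-tuple R -> R) (c : R) (N : nat) (i : 'I_n) : good f -> (0 <= c)%R ->
  (forall x, box x -> (c * expR (- (N%:R * x`_i)) <= 1)%R) ->
  good (fun x => f x * (1 - c * expR (- (N%:R * x`_i))))%R.
Proof.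
move=> gf c0 c1; have [f01 fbox mf fE] := gf.
have z0 x : (0 <= c * expR (- (N%:R * x`_i)))%R by rewrite mulr_ge0 ?expR_ge0.
have mz : measurable_fun setT (fun x : n.-tuple R => c * expR (- (N%:R * x`_i)))%R.
  apply: measurable_funM => //; apply: measurableT_comp => //.
  by apply: measurableT_comp => //; apply: measurable_funM => //; exact: measurable_tuple_nth.
have g01 x : (0 <= f x * (1 - c * expR (- (N%:R * x`_i))) <= 1)%R.
  have [bx|nbx] := pselect (box x); last by rewrite fbox// mul0r lexx/=.
  have /andP[f0 f1] := f01 x.
  by rewrite mulr_ge0 ?subr_ge0 ?c1//= mulr_ile1 ?subr_ge0 ?c1// gerBl.
have mg : measurable_fun setT (fun x => f x * (1 - c * expR (- (N%:R * x`_i))))%R.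
  by apply: measurable_funM => //; exact: measurable_funB.
split => // [x nbx|p]; first by rewrite fbox// mul0r.
pose p' j := (p j - (j == i)%:R * N%:R)%R.
have key (m : {measure set (n.-tuple R) -> \bar R}) : m setT < +oo ->
    \int[m]_x (f x * (1 - c * expR (- (N%:R * x`_i))) * expR (dotp p x))%:E =
    \int[m]_x (f x * expR (dotp p x))%:E - c%:E * \int[m]_x (f x * expR (dotp p' x))%:E.
  move=> moo.
  have mp q := measurable_fe q mf; have mgp := measurable_fe p mg.
  have fp0 q x : (0 <= f x * expR (dotp q x))%R by have /andP[] := fe_bound q x gf.
  have gp0 x : (0 <= f x * (1 - c * expR (- (N%:R * x`_i))) * expR (dotp p x))%R.
    by rewrite mulr_ge0 ?expR_ge0//; have /andP[] := g01 x.
  have Ifin : c%:E * \int[m]_x (f x * expR (dotp p' x))%:E \is a fin_num.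
    rewrite fin_numM// ge0_fin_numE ?fe_lty//.
    by apply: integral_ge0 => x _; rewrite lee_fin.
  have -> : \int[m]_x (f x * expR (dotp p x))%:E =
      \int[m]_x (f x * (1 - c * expR (- (N%:R * x`_i))) * expR (dotp p x))%:E +
      c%:E * \int[m]_x (f x * expR (dotp p' x))%:E.
    rewrite -(ge0_integralMl m c0 (fp0 p') (mp p')).
    have mcp : measurable_fun setT (fun x => c * (f x * expR (dotp p' x)))%R.
      by apply: measurable_funM => //; exact: mp.
    have cp0 x : (0 <= c * (f x * expR (dotp p' x)))%R by rewrite mulr_ge0.
    rewrite -(ge0_integralD_EFin m gp0 mgp cp0 mcp).
    apply: eq_integral => x _; congr EFin.
    by rewrite dotp_shift expRD; ring.
  by rewrite addeK.
by rewrite !key// !fE.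
Qed.

Let good_pow (f : n.-tuple R -> R) (c : R) (N M : nat) (i : 'I_n) : good f -> (0 <= c)%R ->
  (forall x, box x -> (c * expR (- (N%:R * x`_i)) <= 1)%R) ->
  good (fun x => f x * (1 - c * expR (- (N%:R * x`_i))) ^+ M)%R.
Proof.
move=> gf c0 c1; elim: M => [|M IH].
  rewrite (_ : (fun x => _) = f)//; apply/funext => x.
  by rewrite expr0 mulr1.
rewrite (_ : (fun x => _) = (fun x => (f x * (1 - c * expR (- (N%:R * x`_i))) ^+ M) *
  (1 - c * expR (- (N%:R * x`_i))))%R); first exact: good_step.
by apply/funext => x; rewrite exprSr mulrA.
Qed.

(** Dominated convergence: on the box the constant [bound p] is a majorant, integrable as the
    measures are finite. *)
Let good_lim (F : nat -> n.-tuple R -> R) (f : n.-tuple R -> R) :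
  (forall k, good (F k)) -> (forall x, (0 <= f x <= 1)%R) ->
  (forall x, ~ box x -> f x = 0%R) -> measurable_fun setT f ->
  (forall x, box x -> F k x @[k --> \oo] --> f x) -> good f.
Proof.
move=> gF f01 fbox mf cF; split => // p.
have key (m : {measure set (n.-tuple R) -> \bar R}) : m setT < +oo ->
    \int[m]_x (F k x * expR (dotp p x))%:E @[k --> \oo] -->
    \int[m]_x (f x * expR (dotp p x))%:E.
  move=> moo.
  have [|||||_ _] := @dominated_convergence _ _ _ m setT measurableT
    (fun k x => (F k x * expR (dotp p x))%:E) (fun x => (f x * expR (dotp p x))%:E)
    (cst (bound p)%:E).
  - by move=> k; apply/measurable_EFinP; apply: measurable_fe; have [] := gF k.
  - by apply/measurable_EFinP; exact: measurable_fe.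
  - apply: aeW => x _; apply: cvg_EFin; first exact: nearW.
    apply: cvgM; last exact: cvg_cst.
    have [bx|nbx] := pselect (box x); first exact: cF.
    rewrite fbox//; apply: cvg_near_cst; apply: nearW => k.
    by have [_ -> //] := gF k.
  - apply/integrableP; split => //.
    rewrite integral_cst//; apply: lte_mul_pinfty => //.
  - apply: aeW => x k _; rewrite abse_EFin lee_fin.
    by have /andP[F0 FB] := fe_bound p x (gF k); rewrite ger0_norm.
  exact.
apply: (cvg_unique _ (key m1 m1oo)) => //.
rewrite (_ : (fun k => _) = (fun k => \int[m2]_x (F k x * expR (dotp p x))%:E)).
  exact: key.
by apply/funext => k; have [_ _ _ ->] := gF k.
Qed.

Let measurable_ray (i : 'I_n) (b : R) :
  measurable_fun setT (fun x : n.-tuple R => (b < x`_i)%R%:R : R).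
Proof.
rewrite (_ : (fun x => _) = (fun x : n.-tuple R => if (b < x`_i)%R then 1%R else 0%R)).
  by apply: measurable_fun_ifT => //; apply: measurable_fun_ltr => //; exact: measurable_tuple_nth.
by apply/funext => x; case: ifP.
Qed.

(* For [y = expR (b - x`_i)] the polynomials in [y] of [cvg_ray_approx] are
   combinations of exponentials that tend to the indicator of [b < x`_i]. *)
Let good_ray (f : n.-tuple R -> R) (i : 'I_n) (b : R) :
  good f -> good (fun x => f x * (b < x`_i)%R%:R)%R.
Proof.
move=> gf; have [f01 fbox mf fE] := gf.
(* On the box [x_i >= - L], so the integer [K] bounds y = exp(b - x_i) there. *)
pose K := (Num.truncn (expR (b + L))).+1.
have KR0 : (0 < K%:R :> R)%R by rewrite ltr0n.
have yK x : box x -> (0 <= expR (b - x`_i) <= K%:R)%R.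
  move=> bx; rewrite expR_ge0/= (le_trans _ (ltW (truncnS_gt _)))//.
  rewrite ler_expR lerD2l lerNl.
  by have := bx i; rewrite (tnth_nth 0%R) ler_norml => /andP[].
pose c N := ((expR b / K%:R) ^+ N)%R.
have cE N x : (c N * expR (- (N%:R * x`_i)) = (expR (b - x`_i) / K%:R) ^+ N)%R.
  by rewrite /c -mulrN expRM_natl -exprMn expRD mulrAC.
apply: (@good_lim (fun N x => f x * (1 - c N * expR (- (N%:R * x`_i))) ^+ (N * K ^ N))%R).
- move=> N; apply: good_pow => //.
    by rewrite exprn_ge0// divr_ge0// expR_ge0.
  move=> x bx; rewrite cE; have /andP[y0 y1] := yK x bx.
  by rewrite exprn_ile1 ?divr_ge0// ler_pdivrMr// mul1r.
- by move=> x; case: (b < _)%R; rewrite ?mulr1 ?mulr0 ?lexx ?ler01.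
- by move=> x nbx; rewrite fbox// mul0r.
- by apply: measurable_funM => //; exact: measurable_ray.
- move=> x bx; apply: cvgM; first exact: cvg_cst.
  rewrite (_ : (b < x`_i)%R = (expR (b - x`_i) < 1)%R); last first.
    by rewrite -expR0 ltr_expR subr_lt0.
  under eq_fun do rewrite cE.
  exact: (cvg_ray_approx (ltn0Sn _) (yK x bx)).
Qed.

(** For fixed [p], the images under the i-th coordinate of [m1] and [m2] weighted by [f] and the
    exponential are finite measures on the line, and they agree on rays by [good_ray]. *)
Let good_borel (f : n.-tuple R -> R) (i : 'I_n) (B : set R) : measurable B -> good f ->
  good (fun x => f x * \1_B (x`_i))%R.
Proof.
move=> mB gf; have [f01 fbox mf fE] := gf.
have mi : measurable_fun setT (fun x : n.-tuple R => (x`_i : measurableTypeR R)).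
  exact: measurable_tuple_nth.
have mBi : measurable_fun setT (fun x : n.-tuple R => \1_B (x`_i) : R).
  by apply: measurableT_comp => //; exact: measurable_indic.
split.
- by move=> x; rewrite indicE; case: (_ \in _); rewrite ?mulr1 ?mulr0 ?lexx ?ler01.
- by move=> x nbx; rewrite fbox// mul0r.
- exact: measurable_funM.
move=> p.
have fp0 x : (0 <= f x * expR (dotp p x))%R by have /andP[] := fe_bound p x gf.
have mfp := measurable_fe p mf.
have [W1 W1E] := ex_weighted_measure m1 fp0 mfp.
have [W2 W2E] := ex_weighted_measure m2 fp0 mfp.
pose V1 : {measure set (measurableTypeR R) -> \bar R} :=
  measure_function_pushforward__canonical__measure_function_Measure W1 mi.
pose V2 : {measure set (measurableTypeR R) -> \bar R} :=
  measure_function_pushforward__canonical__measure_function_Measure W2 mi.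
have Vint (C : set R) (m : {measure set (n.-tuple R) -> \bar R}) :
    \int[m]_(x in (fun x : n.-tuple R => x`_i) @^-1` C) (f x * expR (dotp p x))%:E =
    \int[m]_x (f x * \1_C (x`_i) * expR (dotp p x))%:E.
  rewrite integral_mkcond; apply: eq_integral => x _; rewrite /patch indicE/=.
  have -> : (x \in (fun x : n.-tuple R => x`_i) @^-1` C) = (x`_i \in C).
    by apply/idP/idP; rewrite !inE.
  by case: ifP => _; rewrite ?mulr1 ?mulr0 ?mul0r.
have : V1 B = V2 B.
  apply: measure_eq_rays => //.
    move=> c; apply: (@le_lt_trans _ _ (W1 setT)).
      apply: (@le_measure _ _ _ W1); rewrite ?inE//.
      by rewrite -[X in measurable X]setTI; apply: (mi) => //; exact: measurable_itv.
    by rewrite W1E; exact: (fe_lty p m1oo gf).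
  move=> c; rewrite /V1 /V2 /= /pushforward W1E W2E !Vint.
  have [_ _ _ gE] := good_ray i c gf.
  have e x : (\1_(`]c, +oo[%classic : set R) (x`_i) = (c < x`_i)%R%:R :> R)%R.
    by rewrite indicE mem_setE in_itv/= andbT.
  under eq_integral do rewrite e.
  by rewrite gE; apply: eq_integral => x _; rewrite e.
by rewrite /V1 /V2 /= /pushforward W1E W2E !Vint.
Qed.

Hypotheses (m1box : m1 (~` box) = 0) (m2box : m2 (~` box) = 0).
Hypothesis m1m2 : forall p,
  \int[m1]_x (expR (dotp p x))%:E = \int[m2]_x (expR (dotp p x))%:E.

Let good_box : good \1_box.
Proof.
split.
- by move=> x; rewrite indicE; case: (_ \in _); rewrite ?lexx ?ler01.
- by move=> x nbx; rewrite indicE memNset.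
- exact: measurable_indic.
move=> p.
have key (m : {measure set (n.-tuple R) -> \bar R}) : m (~` box) = 0 ->
    \int[m]_x (\1_box x * expR (dotp p x))%:E = \int[m]_x (expR (dotp p x))%:E.
  move=> m0; apply: ge0_ae_eq_integral => //.
  - apply/measurable_EFinP; apply: measurable_fe; exact: measurable_indic.
  - by apply/measurable_EFinP; apply: measurableT_comp => //; exact: measurable_dotp.
  exists (~` box); split => //; first exact: measurableC.
  move=> x /=; apply: contra_not => bx _.
  by rewrite indicE mem_set ?mul1r//; exact: contrapT.
by rewrite !key.
Qed.

(** Rectangles are stable under intersection and generate the tuples' sigma-algebra. The indicator
    of a rectangle within the box is good, one side at a time, and [p = 0] then gives equality of
    masses. *)
Lemma laplace_measure_eq A : measurable A -> m1 A = m2 A.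
Proof.
pose rect (B : 'I_n -> set R) : set (n.-tuple R) := [set x | forall i, B i (tnth x i)].
pose G : set (set (n.-tuple R)) :=
  [set C | exists2 B, (forall i, measurable (B i)) & C = rect B].
have good_rect B (s : seq 'I_n) : (forall i, measurable (B i)) ->
    good (fun x => \1_box x * \prod_(i <- s) \1_(B i) (x`_i))%R.
  move=> mB; elim: s => [|i s IH].
    rewrite (_ : (fun x => _) = \1_box)//; apply/funext => x.
    by rewrite big_nil mulr1.
  rewrite (_ : (fun x => _) =
    (fun x => (\1_box x * \prod_(j <- s) \1_(B j) (x`_j)) * \1_(B i) (x`_i))%R).
    exact: good_borel.
  by apply/funext => x; rewrite big_cons mulrCA mulrC.
have mrect B : (forall i, measurable (B i)) -> measurable (rect B).
  move=> mB; rewrite (_ : rect B = \bigcap_(i : 'I_n) ((fun x : n.-tuple R => tnth x i) @^-1` B i)).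
    apply: fin_bigcap_measurable => [|i _]; first exact: finite_finset.
    by rewrite -[X in measurable X]setTI; exact: (@measurable_tnth _ R n i).
  by apply/seteqP; split => [x h i _|x h i]; [exact: h|exact: (h i Logic.I)].
apply: (measure_unique G (fun=> setT)) => //.
- apply/seteqP; split; last first.
    apply: smallest_sub; first exact: sigma_algebra_measurable.
    by move=> _ [B mB ->]; exact: mrect.
  apply: smallest_sub; first exact: smallest_sigma_algebra.
  (* The generators are preimages of Borel sets under one coordinate, that is, rectangles with a
     single constrained side. *)
  apply: subset_trans (@sub_gen_smallest _ _ _).
  apply: (big_ind (fun X : set (set (n.-tuple R)) => X `<=` G)) => //.
    by move=> X Y XG YG; rewrite subUset.
  move=> i _ _ [B mB <-]; exists (fun j => if j == i then B else setT).
    by move=> j; case: ifP.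
  rewrite setTI; apply/seteqP; split => x /=.
    by move=> Bx j; case: eqP => [->|//].
  by move=> /(_ i); rewrite eqxx.
- move=> _ _ [B mB ->] [C mC ->]; exists (fun i => B i `&` C i).
    by move=> i; exact: measurableI.
  by apply/seteqP; split => [x [hB hC] i|x h]; [split;
    [exact: hB|exact: hC]|split => i; have [] := h i].
- by move=> _; exists (fun=> setT) => //; apply/seteqP; split.
- by rewrite bigcup_const//; exists 0%N.
move=> _ [B mB ->].
have key (m : {measure set (n.-tuple R) -> \bar R}) : m (~` box) = 0 ->
    m (rect B) = \int[m]_x (\1_box x * \prod_(i <- enum 'I_n) \1_(B i) (x`_i) *
      expR (dotp (fun=> 0%R) x))%:E.
  have mRB : measurable (rect B `&` box) by apply: measurableI => //; exact: mrect.
  move=> m0; transitivity (m (rect B `&` box)).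
    apply/eqP; rewrite eq_le; apply/andP; split; last first.
      by apply: le_measure; rewrite ?inE//; exact: mrect.
    rewrite -[leRHS]adde0 -m0.
    apply: (@le_trans _ _ (m ((rect B `&` box) `|` ~` box))).
      apply: le_measure; rewrite ?inE//; first exact: mrect.
        by apply: measurableU => //; exact: measurableC.
      by move=> x Bx; have [bx|nbx] := pselect (box x); [left|right].
    by apply: measureU2 => //; exact: measurableC.
  rewrite -[LHS]/(m (_ `&` _)) -[X in m X]setIT -integral_indic//.
  apply: eq_integral => x _; congr EFin.
  rewrite [dotp _ _](_ : _ = 0%R); last by rewrite /dotp big1// => i _; rewrite mul0r.
  rewrite expR0 mulr1 !indicE in_setI mulrC.
  have -> : (\prod_(i <- enum 'I_n) \1_(B i) (x`_i) = (x \in rect B)%:R :> R)%R.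
    rewrite big_enum/=; have [xB|xB] := boolP (x \in rect B).
      rewrite big1// => i _; rewrite indicE mem_set// -tnth_nth.
      by move: xB; rewrite inE; exact.
    have [i Bi] : exists i, ~ B i (tnth x i).
      by apply/existsNP => h; move/negP: xB; apply; rewrite inE.
    by rewrite (bigD1 i)//= indicE memNset ?mul0r// -tnth_nth.
  by case: (x \in rect B); case: (x \in box); rewrite ?mulr1 ?mulr0 ?mul0r.
rewrite !key//; have [_ _ _ -> //] := good_rect B (enum 'I_n) mB.
Qed.

End laplace_uniqueness.

(** * Independence *)

Section independent_product.
Local Open Scope ereal_scope.
Context (R : realType) d0 d1 d2 (Omega : measurableType d0)
  (T1 : measurableType d1) (T2 : measurableType d2) (P : probability Omega R).

Lemma finite_sigma_finite_measure (m : {measure set T1 -> \bar R}) :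
  m setT < +oo -> exists s : {sigma_finite_measure set T1 -> \bar R}, m = s :> (set T1 -> \bar R).
Proof.
move=> moo; exists (mfrestr measurableT moo); apply/funext => A.
by rewrite /= /mfrestr /mrestr setIT.
Qed.

(** Under independence, the conditional expectation of [psi X Y] given [X = x]. It is made real by
    [fine], which loses nothing for bounded [psi]. *)
Definition average (Y : {RV P >-> T2}) (psi : T1 -> T2 -> R) (x : T1) : R :=
  fine (\int[distribution P Y]_y (psi x y)%:E).

Section average_bounded.
Context (Y : {RV P >-> T2}) (psi : T1 -> T2 -> R) (C : R).
Hypotheses (psi0C : forall x y, (0 <= psi x y <= C)%R)
  (mpsi : measurable_fun setT (fun z : T1 * T2 => psi z.1 z.2)).

Lemma integral_average x :
  \int[distribution P Y]_y (psi x y)%:E = (average Y psi x)%:E /\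
  (0 <= average Y psi x <= C)%R.
Proof.
have i0 : 0 <= \int[distribution P Y]_y (psi x y)%:E.
  by apply: integral_ge0 => y _; rewrite lee_fin; have /andP[] := psi0C x y.
have iC : \int[distribution P Y]_y (psi x y)%:E <= C%:E.
  apply: (@le_trans _ _ (\int[distribution P Y]_y (C%:E))).
    apply: ge0_le_integral => //.
    - by move=> y _; rewrite lee_fin; have /andP[] := psi0C x y.
    - by apply/measurable_EFinP; exact: (measurableT_comp mpsi (pair1_measurable x)).
    - by move=> y _; rewrite lee_fin; have /andP[] := psi0C x y.
  rewrite integral_cst// [X in _ * X](_ : _ = 1) ?mule1//.
  exact: probability_setT.
have fE : \int[distribution P Y]_y (psi x y)%:E = (average Y psi x)%:E.
  by rewrite /average fineK// ge0_fin_numE// (le_lt_trans iC)// ltry.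
by split => //; rewrite -!lee_fin -fE i0 iC.
Qed.

Lemma measurable_average : measurable_fun setT (average Y psi).
Proof.
have psi0 z : 0 <= (psi z.1 z.2)%:E.
  by rewrite lee_fin; have /andP[] := psi0C z.1 z.2.
have mpsi' : measurable_fun setT (fun z : T1 * T2 => (psi z.1 z.2)%:E).
  exact/measurable_EFinP.
apply/measurable_EFinP.
rewrite (_ : EFin \o _ = fubini_F (distribution P Y) (fun z => (psi z.1 z.2)%:E)).
  exact: measurable_fun_fubini_tonelli_F.
by apply/funext => x; rewrite /fubini_F /= (integral_average x).1.
Qed.

End average_bounded.

Section replacement.
Context (X : {RV P >-> T1}) (Y : {RV P >-> T2}) (W : Omega -> R) (V : T1 -> R) (K : R).
Hypotheses (W0 : forall w, (0 <= W w)%R) (mW : measurable_fun setT W)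
  (V0K : forall x, (0 <= V x <= K)%R) (mV : measurable_fun setT V).
Hypothesis XYW : forall A B, measurable A -> measurable B ->
  \int[P]_w (\1_A (X w) * (\1_B (Y w) * W w))%:E =
  \int[P]_w (\1_A (X w) * (fine (P (Y @^-1` B)) * V (X w)))%:E.

(* [XYW] says that under the weight [W] the pair [(X, Y)] has a product law. *)
Lemma replace_average (psi : T1 -> T2 -> R) (C : R) A :
  (forall x y, (0 <= psi x y <= C)%R) ->
  measurable_fun setT (fun z : T1 * T2 => psi z.1 z.2) -> measurable A ->
  \int[P]_w (\1_A (X w) * (psi (X w) (Y w) * W w))%:E =
  \int[P]_w (\1_A (X w) * (average Y psi (X w) * V (X w)))%:E.
Proof.
move=> psi0C mpsi mA.
have mX : measurable_fun setT X by [].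
have mY : measurable_fun setT Y by [].
have VX0 w : (0 <= V (X w))%R by have /andP[] := V0K (X w).
have mVX : measurable_fun setT (fun w => V (X w)) by exact: measurableT_comp.
have [NW NWE] := ex_weighted_measure P W0 mW.
have [NV NVE] := ex_weighted_measure P VX0 mVX.
have mXY : measurable_fun setT (fun w => (X w, Y w)) by exact: measurable_fun_pair.
pose mu : {measure set (T1 * T2) -> \bar R} :=
  measure_function_pushforward__canonical__measure_function_Measure NW mXY.
pose nu0 : {measure set T1 -> \bar R} :=
  measure_function_pushforward__canonical__measure_function_Measure NV mX.
have nu0oo : nu0 setT < +oo.
  rewrite /nu0 /= /pushforward preimage_setT NVE.
  apply: (@le_lt_trans _ _ (\int[P]_w (K%:E))).
    apply: ge0_le_integral => //.
    - by move=> w _; rewrite lee_fin.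
    - exact/measurable_EFinP.
    - by move=> w _; rewrite lee_fin; have /andP[] := V0K (X w).
  rewrite integral_cst// [X in _ * X](_ : _ = 1) ?mule1 ?ltry//.
  exact: probability_setT.
have [nu nuE] := finite_sigma_finite_measure nu0oo.
pose law := distribution P Y.
(* [XYW] is this equality on rectangles; uniqueness of the product measure extends it. *)
have mu_prod D : measurable D -> (nu \x law) D = mu D.
  apply: product_measure_unique => A' B mA' mB.
  rewrite -nuE /mu /nu0 /= /pushforward NWE NVE.
  have law_fin : P (Y @^-1` B) \is a fin_num by exact: (fin_num_measure law).
  have ind (S : set Omega) (g : Omega -> R) :
      \int[P]_(w in S) (g w)%:E = \int[P]_w (\1_S w * g w)%:E.
    rewrite integral_mkcond; apply: eq_integral => w _; rewrite /patch indicE.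
    by case: ifP => _; rewrite ?mul1r ?mul0r.
  rewrite [LHS]ind [X in _ = X * _]ind.
  transitivity (\int[P]_w (\1_A' (X w) * (\1_B (Y w) * W w))%:E).
    apply: eq_integral => w _; congr EFin; rewrite mulrA; congr (_ * _)%R.
    rewrite !indicE -natrM mulnb; congr (_%:R)%R; congr nat_of_bool.
    by apply/idP/andP; rewrite !inE.
  rewrite (XYW mA' mB) -[X in _ = _ * X](fineK law_fin) muleC.
  rewrite -(ge0_integralMl P) => //.
  - apply: eq_integral => w _; congr EFin; rewrite mulrCA; congr (_ * (_ * _))%R.
  - exact: fine_ge0.
  - by move=> w; rewrite mulr_ge0.
  - apply: measurable_funM => //; apply: measurable_indic.
    by rewrite -[X in measurable X]setTI; exact: (mX measurableT _ mA').
pose g (z : T1 * T2) := (\1_A z.1 * psi z.1 z.2)%R.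
have g0 z : 0 <= (g z)%:E.
  by rewrite lee_fin mulr_ge0//; have /andP[] := psi0C z.1 z.2.
have mg : measurable_fun setT (fun z => (g z)%:E).
  apply/measurable_EFinP; apply: measurable_funM => //.
  by apply: measurableT_comp => //; exact: measurable_indic.
have psiE x := (integral_average Y psi0C mpsi x).1.
have gF x : \int[law]_y (g (x, y))%:E = (\1_A x * average Y psi x)%:E.
  rewrite EFinM -psiE -(ge0_integralMl law)//.
  - by move=> y; have /andP[] := psi0C x y.
  - exact: (measurableT_comp mpsi (pair1_measurable x)).
have gF0 x : (0 <= \1_A x * average Y psi x)%R.
  by rewrite mulr_ge0//; have [_ /andP[]] := integral_average Y psi0C mpsi x.
have mgF : measurable_fun setT (fun x => (\1_A x * average Y psi x)%:E).
  apply/measurable_EFinP; apply: measurable_funM; first exact: measurable_indic.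
  exact: (measurable_average Y psi0C mpsi).
transitivity (\int[mu]_z (g z)%:E).
  rewrite ge0_integral_pushforward//.
  rewrite preimage_setT (ge0_integral_weighted W0 mW (fun A _ => NWE A)) => //.
  - by apply: eq_integral => w _; rewrite /= -EFinM mulrA.
  - by move=> w; exact: g0.
  - exact: (measurableT_comp mg mXY).
transitivity (\int[nu \x law]_z (g z)%:E).
  by apply: eq_measure_integral => D mD _; exact: (esym (mu_prod D mD)).
rewrite fubini_tonelli1//.
transitivity (\int[nu]_x (\1_A x * average Y psi x)%:E).
  by apply: eq_integral => x _; exact: gF.
transitivity (\int[nu0]_x (\1_A x * average Y psi x)%:E).
  by apply: eq_measure_integral => D mD _; rewrite nuE.
rewrite ge0_integral_pushforward//; last by move=> z _; rewrite lee_fin.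
rewrite preimage_setT (ge0_integral_weighted VX0 mVX (fun A _ => NVE A)) => //.
- by apply: eq_integral => w _; rewrite /= -EFinM mulrA.
- by move=> w; rewrite lee_fin.
- exact: (measurableT_comp mgF mX).
Qed.

End replacement.

Section bounded_product.
Context (m : nat) (X : {RV P >-> T1}) (Y : 'I_m -> {RV P >-> T2}).
Hypothesis XY : mutually_independent X Y.
Context (phi : 'I_m -> T1 -> T2 -> R) (C : R).
Hypotheses (C1 : (1 <= C)%R) (phi0C : forall k x y, (0 <= phi k x y <= C)%R)
  (mphi : forall k, measurable_fun setT (fun z : T1 * T2 => phi k z.1 z.2)).

(** The list [s] holds the indices already converted from indicators to [phi]. *)
Let mixed (s : seq 'I_m) (B : 'I_m -> set T2) k x y : R :=
  if k \in s then phi k x y else \1_(B k) y.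

Let mixed0C s B k x y : (0 <= mixed s B k x y <= C)%R.
Proof.
rewrite /mixed; case: ifP => // _; rewrite indicE.
by case: (_ \in _); rewrite ?lexx ?ler01/= ?C1// (le_trans ler01).
Qed.

Let measurable_mixed s B k : (forall k, measurable (B k)) ->
  measurable_fun setT (fun z : T1 * T2 => mixed s B k z.1 z.2).
Proof.
move=> mB; rewrite /mixed; case: (k \in s) => //.
by apply: measurableT_comp => //; exact: measurable_indic.
Qed.

Let average_indic k B x :
  measurable B -> average (Y k) (fun _ : T1 => \1_B) x = fine (P (Y k @^-1` B)).
Proof.
by move=> mB; rewrite /average integral_indic// setIT.
Qed.

Let indic_prod (B : 'I_m -> set T2) w :
  (\prod_k \1_(B k) (Y k w) = \1_(\bigcap_k (Y k @^-1` B k)) w :> R)%R.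
Proof.
rewrite indicE; have [wB|wB] := boolP (w \in _).
  rewrite big1// => k _; rewrite indicE mem_set//.
  by move: wB; rewrite inE => /(_ k); exact.
have [k Bk] : exists k, ~ B k (Y k w).
  by apply/existsNP => h; move/negP: wB; apply; rewrite inE => k _; exact: h.
by rewrite (bigD1 k)//= indicE memNset ?mul0r.
Qed.

(* Indicators of [Y k] are replaced by [phi k], one index at a time. *)
Let mixed_product s B A : (forall k, measurable (B k)) -> measurable A ->
  \int[P]_w (\1_A (X w) * \prod_k mixed s B k (X w) (Y k w))%:E =
  \int[P]_w (\1_A (X w) * \prod_k average (Y k) (mixed s B k) (X w))%:E.
Proof.
elim: s B A => [|i s IH] B A mB mA.
  have mXA : measurable (X @^-1` A) by rewrite -[X in measurable X]setTI; exact: measurable_funPT.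
  have mYB k : measurable (Y k @^-1` B k).
    by rewrite -[X in measurable X]setTI; exact: measurable_funPT.
  have mYBs : measurable (\bigcap_k (Y k @^-1` B k)).
    by apply: fin_bigcap_measurable => [|k _]; [exact: finite_finset|].
  (* With no index converted, all factors are indicators and the claim is the product rule
     itself. *)
  transitivity (P (X @^-1` A `&` \bigcap_k (Y k @^-1` B k))).
    rewrite -[X in P X]setIT -integral_indic//; last exact: measurableI.
    apply: eq_integral => w _; congr EFin; rewrite /mixed indic_prod.
    by rewrite !indicE in_setI -natrM mulnb; congr (_%:R)%R; rewrite !inE.
  rewrite XY//.
  have -> : \prod_(k < m) P (Y k @^-1` B k) = (\prod_(k < m) fine (P (Y k @^-1` B k)))%:E.
    rewrite -prodEFin; apply: eq_bigr => k _; rewrite fineK//.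
    exact: (fin_num_measure (distribution P (Y k))).
  rewrite muleC -[X in P X]setIT -integral_indic//.
  rewrite -(ge0_integralMl P) => //.
  - apply: eq_integral => w _; congr EFin; rewrite mulrC; congr (_ * _)%R.
    by apply: eq_bigr => k _; rewrite average_indic.
  - by apply: prodr_ge0 => k _; exact: fine_ge0.
have [si|si] := boolP (i \in s).
  have -> : mixed (i :: s) B = mixed s B; last exact: IH.
  apply/funext => k; apply/funext => x; apply/funext => y; rewrite /mixed inE.
  by case: eqP => [->|//]; rewrite si.
(* The other factors serve as a weight; [V] is the same product after averaging. *)
pose W (w : Omega) : R := (\prod_(j | j != i) mixed s B j (X w) (Y j w))%R.
pose V (x : T1) : R := (\prod_(j | j != i) average (Y j) (mixed s B j) x)%R.
have avgE k x := integral_average (Y k) (mixed0C s B k) (measurable_mixed s k mB) x.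
have mixE k : k != i -> mixed (i :: s) B k = mixed s B k.
  move=> ki; apply/funext => x; apply/funext => y.
  by rewrite /mixed inE (negbTE ki).
have mixi : mixed (i :: s) B i = phi i.
  by apply/funext => x; apply/funext => y; rewrite /mixed inE eqxx.
transitivity (\int[P]_w (\1_A (X w) * (phi i (X w) (Y i w) * W w))%:E).
  apply: eq_integral => w _; rewrite (bigD1 i)//= mixi; congr (_ * (_ * _))%:E.
  by apply: eq_bigr => j ji; rewrite mixE.
transitivity (\int[P]_w (\1_A (X w) * (average (Y i) (phi i) (X w) * V (X w)))%:E); last first.
  apply: eq_integral => w _; rewrite [in RHS](bigD1 i)//= mixi; congr (_ * (_ * _))%:E.
  by apply: eq_bigr => j ji; rewrite mixE.
apply: (@replace_average X (Y i) W V (\prod_(j | j != i) C)%R _ _ _ _ _ (phi i) C) => //.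
- move=> w; apply: prodr_ge0 => j _.
  by have /andP[] := mixed0C s B j (X w) (Y j w).
- rewrite /W; under eq_fun do rewrite -big_filter; apply: measurable_prod => j _.
  have mXY : measurable_fun setT (fun w => (X w, Y j w)) by exact: measurable_fun_pair.
  exact: (measurableT_comp (measurable_mixed s j mB) mXY).
- move=> x; apply/andP; split.
    by apply: prodr_ge0 => j _; have [_ /andP[]] := avgE j x.
  by apply: ler_prod => j _; have [] := avgE j x.
- rewrite /V; under eq_fun do rewrite -big_filter; apply: measurable_prod => j _.
  exact: (measurable_average (Y j) (mixed0C s B j) (measurable_mixed s j mB)).
move=> A' B' mA' mB'.
(* As [i] is not in [s], putting [B'] in place [i] makes that factor the indicator of [B']. The
   induction hypothesis, which holds for all families of sets, is then exactly the required product
   law. *)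
pose B2 k := if k == i then B' else B k.
have mB2 k : measurable (B2 k) by rewrite /B2; case: ifP.
have := IH B2 A' mB2 mA'.
have mix2 k : k != i -> mixed s B2 k = mixed s B k.
  move=> ki; apply/funext => x; apply/funext => y.
  by rewrite /mixed /B2 (negbTE ki).
have mix2i : mixed s B2 i = fun=> \1_B'.
  by apply/funext => x; apply/funext => y; rewrite /mixed /B2 (negbTE si) eqxx.
move=> h; transitivity (\int[P]_w (\1_A' (X w) * \prod_k mixed s B2 k (X w) (Y k w))%:E).
  apply: eq_integral => w _; rewrite [in RHS](bigD1 i)//= mix2i; congr (_ * (_ * _))%:E.
  by apply: eq_bigr => j ji; rewrite mix2.
rewrite h; apply: eq_integral => w _; rewrite (bigD1 i)//= mix2i average_indic//.
by congr (_ * (_ * _))%:E; apply: eq_bigr => j ji; rewrite mix2.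
Qed.

Lemma integral_independent_product :
  \int[P]_w (\prod_k phi k (X w) (Y k w))%:E =
  \int[P]_w (\prod_k average (Y k) (phi k) (X w))%:E.
Proof.
have := @mixed_product (enum 'I_m) (fun=> setT) setT (fun=> measurableT) measurableT.
rewrite (_ : mixed _ _ = phi); last first.
  apply/funext => k; apply/funext => x; apply/funext => y.
  by rewrite /mixed mem_enum.
under eq_integral do rewrite indicT mul1r.
by under [X in _ = X]eq_integral do rewrite indicT mul1r.
Qed.

End bounded_product.

End independent_product.

(** * The random flight *)

Section flight_laplace.
Local Open Scope ereal_scope.
Context (R : realType).
Local Notation G := (half_gamma R).
Local Notation spi := (Num.sqrt (pi : R)).

Lemma half_gamma_ge0 k : (0 <= G k.+1)%R.
Proof. exact: ltW (half_gamma_gt0 R k). Qed.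

Lemma gamma_fun_nat k : (gamma_fun k%:R = G (2 * k) :> R)%R.
Proof. by rewrite half_gammaE natrM mulrAC divff ?mul1r// pnatr_eq0. Qed.

Lemma gamma_fun_fact k : (gamma_fun k.+1%:R = k`!%:R :> R)%R.
Proof.
rewrite gamma_fun_nat; elim: k => [|k IH]; first by rewrite muln1 half_gamma2.
have -> : (2 * k.+2 = (2 * k).+1.+3)%N by clear; lia.
rewrite half_gammaSS factS natrM -IH.
have -> : ((2 * k).+2 = 2 * k.+1)%N by clear; lia.
by rewrite natrM (mulrC 2%:R) mulfK ?pnatr_eq0.
Qed.

Lemma powR_pi_half d : (pi `^ ((d.+1%:R - 1) / 2) = spi ^+ d :> R)%R.
Proof.
have pi0 : (0 <= pi :> R)%R by exact: pi_ge0.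
rewrite -natr1 addrK mulrC powRrM -powR12_sqrt// powR_mulrn//.
exact: powR_ge0.
Qed.

Lemma norm_direction_le1 d (th : d.-1.-tuple R) i : (`|direction th i| <= 1)%R.
Proof.
rewrite /direction normrM normr_prod mulr_ile1 ?prodr_ge0//; last first.
- by case: ifP => _; rewrite ?normr1// cos_max.
- by apply: prodr_ile1 => j _; rewrite normr_ge0 sin_max.
Qed.

Lemma norm_dir_dotp_le p m (th : m.+1.-tuple R) :
  (`|dir_dotp p th| <= \sum_(i < m.+2) `|p i|)%R.
Proof.
rewrite (le_trans (ler_norm_sum _ _ _))//; apply: ler_sum => i _.
by rewrite normrM -[leRHS]mulr1 ler_wpM2l// (@norm_direction_le1 m.+2).
Qed.

Section simplex.
Context (n : nat) (t : R).

(** Positivity of all [n.+1] durations, the last included, which treats the segments symmetrically;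
    [simplexE] matches it with the domain of the density. *)
Definition simplex : set (n.-tuple R) :=
  [set s | forall k : 'I_n.+1, (0 < duration t s k)%R].

Lemma measurable_simplex : measurable simplex.
Proof.
rewrite (_ : simplex = \bigcap_(k : 'I_n.+1)
    ((fun s : n.-tuple R => duration t s k) @^-1` `]0%R, +oo[%classic)).
  apply: fin_bigcap_measurable => [|k _]; first exact: finite_finset.
  rewrite -[X in measurable X]setTI.
  by apply: measurable_duration => //; exact: measurable_itv.
apply/seteqP; split => [s h k _ /=|s h k]; first by rewrite in_itv/= andbT; exact: h.
by have := h k Logic.I; rewrite /= in_itv/= andbT.
Qed.

Lemma simplexE (s : n.-tuple R) :
  simplex s = [forall i, 0 < tnth s i]%R && (\sum_(i < n) tnth s i < t)%R :> Prop.
Proof.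
apply/propext; split => [h|/andP[/forallP h1 h2] k].
  apply/andP; split.
    apply/forallP => i; have := h (widen_ord (leqnSn n) i).
    by rewrite /duration/= ltn_ord (tnth_nth 0%R).
  by have := h ord_max; rewrite /duration/= ltnn subr_gt0.
rewrite /duration; case: ifP => kn; last by rewrite subr_gt0.
by have := h1 (Ordinal kn); rewrite (tnth_nth 0%R).
Qed.

Lemma sum_duration (s : n.-tuple R) : (\sum_(k < n.+1) duration t s k = t)%R.
Proof.
rewrite big_ord_recr/= [X in (_ + X)%R]/duration ltnn.
rewrite (eq_bigr (tnth s)) ?subrKC// => k _.
by rewrite /duration/= ltn_ord (tnth_nth 0%R).
Qed.

Lemma duration_le (s : n.-tuple R) (k : 'I_n.+1) : simplex s -> (duration t s k <= t)%R.
Proof.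
move=> sS; rewrite -[leRHS](sum_duration s) (bigD1 k)//= lerDl.
by apply: sumr_ge0 => j _; apply: ltW; exact: sS.
Qed.

End simplex.

Section position.
Context d0 (Omega : measurableType d0) (P : probability Omega R) (m n : nat) (c t : R).
Context (T : {RV P >-> n.-tuple R}) (Theta : 'I_n.+1 -> {RV P >-> m.+1.-tuple R}).
Local Notation X := (@position R m.+2 n c t _ _ P T Theta).
Hypotheses (c0 : (0 < c)%R) (t0 : (0 < t)%R).
Hypothesis Tdens : has_density (distribution P T) (times_density m.+2 t).
Hypothesis Thetadens :
  forall k, has_density (distribution P (Theta k)) (@angles_density R m.+2).

Lemma dotp_position p w :
  dotp p (X w) = (\sum_(k < n.+1) c * duration t (T w) k * dir_dotp p (Theta k w))%R.
Proof.
rewrite /dotp; under eq_bigr do rewrite -tnth_nth tnth_mktuple mulrCA mulr_sumr.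
rewrite -mulr_sumr exchange_big/= mulr_sumr; apply: eq_bigr => k _.
rewrite -[RHS]mulrA; congr (_ * _)%R; rewrite /dir_dotp mulr_sumr; apply: eq_bigr => i _.
by rewrite mulrCA.
Qed.

Lemma times_density_simplex (s : n.-tuple R) : simplex t s ->
  times_density m.+2 t s = (gamma_fun (n.+1 * m.+3)%:R / m.+2`!%:R ^+ n.+1 *
    ((\prod_(k < n.+1) duration t s k ^+ m.+2) / t ^+ (n.+1 * m.+3).-1))%R.
Proof. by rewrite simplexE /times_density => ->; rewrite gamma_fun_fact. Qed.

Lemma times_density_notin (s : n.-tuple R) : ~ simplex t s -> times_density m.+2 t s = 0%R.
Proof. by rewrite simplexE /times_density => /negP/negbTE ->. Qed.

Lemma times_density_ge0 (s : n.-tuple R) : (0 <= times_density m.+2 t s)%R.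
Proof.
have [sS|sS] := pselect (simplex t s); last by rewrite times_density_notin.
rewrite times_density_simplex// gamma_fun_nat mulr_ge0//.
  by rewrite divr_ge0 ?exprn_ge0//; exact: half_gamma_ge0.
rewrite divr_ge0 ?exprn_ge0 ?(ltW t0)//; apply: prodr_ge0 => k _.
by rewrite exprn_ge0// ltW.
Qed.

Lemma times_simplex : P (~` (T @^-1` simplex t)) = 0.
Proof.
have [mf /(_ (~` simplex t))] := Tdens.
rewrite /distribution /= /pushforward preimage_setC => -> //; last first.
  by apply: measurableC; exact: measurable_simplex.
by apply: integral0_eq => s /times_density_notin ->.
Qed.

Lemma position_box : distribution P X
  (~` [set x | forall i : 'I_m.+2, (`|tnth x i| <= c * t)%R]) = 0.
Proof.
apply/eqP; rewrite eq_le measure_ge0 andbT -times_simplex /distribution /= /pushforward.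
apply: le_measure; rewrite ?inE.
- rewrite -[X in measurable X]setTI; apply: measurable_funPT => //.
  by apply: measurableC; exact: measurable_box.
- apply: measurableC; rewrite -[X in measurable X]setTI; apply: measurable_funPT => //.
  exact: measurable_simplex.
move=> w /=; apply: contra_not => wS i.
rewrite tnth_mktuple normrM (gtr0_norm c0) ler_pM2l//.
rewrite -[leRHS](sum_duration t (T w)) (le_trans (ler_norm_sum _ _ _))//.
apply: ler_sum => k _; rewrite normrM (gtr0_norm (wS k)) -[leRHS]mulr1.
by rewrite ler_pM2l ?(wS k)// (@norm_direction_le1 m.+2).
Qed.

(** As Gamma(3/2) is half the square root of pi, the constant of the density is Gamma(1 + d/2) /
    pi^(d/2). *)
Lemma angles_densityE th :
  @angles_density R m.+2 th = (G m.+4 / spi ^+ m.+2 * angles_weight th)%R.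
Proof.
have -> : angles_weight th = (if [forall j : 'I_m.+2.-1,
    (0 <= tnth th j <= if (j.+1 < m.+2.-1)%N then pi else 2 * pi)%R] then
    \prod_(j < m.+2.-1) sin (tnth th j) ^+ (m.+2 - j) else 0)%R by [].
rewrite /angles_density; case: ifP => _; last by rewrite mulr0.
congr (_ * _)%R; rewrite powR_pi_half -(half_gammaE R 3) (half_gammaSS R 0) half_gamma1.
have -> : (1 + m.+2%:R / 2 = m.+4%:R / 2 :> R)%R.
  by rewrite -[m.+4]addn2 natrD; field.
rewrite -half_gammaE (exprSr spi m.+1); congr (_ / _)%R.
by field.
Qed.

Local Notation kernel p :=
  (two_term_kernel m.+3 (sqp p m.+2) (m.+3%:R * p m.+1 ^+ 2)).

(** The power s^d is the one supplied by the Dirichlet density of the times, and the factor d! on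
    the right cancels its Gamma(d + 1). *)
Lemma integral_angles p k s : (0 < s)%R ->
  (s ^+ m.+2)%:E * \int[distribution P (Theta k)]_th (expR (s * dir_dotp p th))%:E =
  (m.+2`!%:R)%:E * kernel p s.
Proof.
move=> s0; have [mf fE] := Thetadens k.
have GS0 : (0 <= G m.+4 / spi ^+ m.+2)%R.
  by rewrite divr_ge0 ?spi_ge0//; exact: half_gamma_ge0.
have f0 (th : m.+1.-tuple R) : (0 <= @angles_density R m.+2 th)%R.
  by rewrite angles_densityE mulr_ge0//; exact: angles_weight_ge0.
have me : measurable_fun setT (fun th : m.+1.-tuple R => expR (s * dir_dotp p th)).
  by apply: measurableT_comp => //; apply: measurable_funM => //; exact: measurable_dir_dotp.
rewrite (ge0_integral_weighted f0 mf fE) => //; last exact/measurable_EFinP.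
have w0 (th : m.+1.-tuple R) : (0 <= angles_weight th * expR (s * dir_dotp p th))%R.
  by rewrite mulr_ge0 ?expR_ge0//; exact: angles_weight_ge0.
have mw : measurable_fun setT
    (fun th : m.+1.-tuple R => angles_weight th * expR (s * dir_dotp p th))%R.
  by apply: measurable_funM => //; exact: measurable_angles_weight.
transitivity ((s ^+ m.+2)%:E * \int[lebesgue_tuple m.+1]_th
    (G m.+4 / spi ^+ m.+2 * (angles_weight th * expR (s * dir_dotp p th)))%:E).
  congr (_ * _); apply: eq_integral => th _.
  by rewrite -EFinM angles_densityE mulrC mulrA.
rewrite (ge0_integralMl (lebesgue_tuple m.+1) GS0 w0 mw) muleCA.
rewrite integral_angles_weight// sphere_kernel_time// muleA -EFinM.
congr (_%:E * _); field.
by rewrite expf_neq0 ?half_gamma_neq0// gt_eqF// sqrtr_gt0 pi_gt0.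
Qed.

Hypothesis indep : mutually_independent T Theta.

(** The speed is moved into the parameter, since the exponent depends only on the products c p_i. *)
Lemma position_laplace p (q := fun i => (c * p i)%R) :
  \int[distribution P X]_x (expR (dotp p x))%:E =
  (gamma_fun (n.+1 * m.+3)%:R / t ^+ (n.+1 * m.+3).-1)%:E *
  \sum_(l < n.+2) ('C(n.+1, l)%:R * (m.+3%:R * q m.+1 ^+ 2) ^+ l)%:E *
    time_kernel (n.+1 * m.+3 + 2 * l) (sqp q m.+2) t.
Proof.
have r0 := sqp_ge0 q m.+2.
have x0 : (0 <= m.+3%:R * q m.+1 ^+ 2)%R by rewrite mulr_ge0// sqr_ge0.
rewrite -(simplex_integral_two_term _ r0 x0)//.
have mX : measurable_fun setT (fun x : m.+2.-tuple R => (expR (dotp p x))%:E).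
  by apply/measurable_EFinP; apply: measurableT_comp => //; exact: measurable_dotp.
rewrite ge0_integral_distribution//.
(* Off the simplex the durations are unbounded, so the indicator is built into each factor to get
   the uniform bound [C] needed for independence. The law of the times does not charge that set. *)
pose phi (k : 'I_n.+1) (s : n.-tuple R) (th : m.+1.-tuple R) : R :=
  (\1_(simplex t) s * expR (duration t s k * dir_dotp q th))%R.
have dotE (s : n.-tuple R) (k : 'I_n.+1) w : (duration t s k * dir_dotp q (Theta k w) =
    c * duration t s k * dir_dotp p (Theta k w))%R.
  rewrite (mulrC c) -mulrA; congr (_ * _)%R; rewrite /dir_dotp mulr_sumr.
  by apply: eq_bigr => i _; rewrite mulrA.
pose C := expR (t * \sum_(i < m.+2) `|q i|)%R.
have C1 : (1 <= C)%R.
  by rewrite -expR0 ler_expR mulr_ge0 ?(ltW t0)//; apply: sumr_ge0.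
have phi0C k s th : (0 <= phi k s th <= C)%R.
  rewrite /phi indicE; have [|_] := boolP (s \in _); last first.
    by rewrite mul0r lexx expR_ge0.
  rewrite inE mul1r => sS; rewrite expR_ge0 ler_expR/=.
  rewrite (le_trans (ler_norm _))// normrM (gtr0_norm (sS k)) ler_pM ?(ltW (sS k))//.
    exact: duration_le.
  exact: norm_dir_dotp_le.
have mphi k : measurable_fun setT
    (fun z : n.-tuple R * m.+1.-tuple R => phi k z.1 z.2).
  apply: measurable_funM.
    apply: measurableT_comp => //; apply: measurable_indic; exact: measurable_simplex.
  apply: measurableT_comp => //; apply: measurable_funM.
    exact: (measurableT_comp (measurable_duration t k) measurable_fst).
  exact: (measurableT_comp (@measurable_dir_dotp R q m) measurable_snd).
have mphiw k : measurable_fun setT (fun w => phi k (T w) (Theta k w)).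
  have mTT : measurable_fun setT (fun w => (T w, Theta k w)) by exact: measurable_fun_pair.
  exact: (measurableT_comp (mphi k) mTT).
transitivity (\int[P]_w (\prod_k phi k (T w) (Theta k w))%:E).
  apply: ge0_ae_eq_integral => //.
  - exact: (measurableT_comp mX).
  - by apply/measurable_EFinP; apply: measurable_prod => k _; exact: mphiw.
  - by move=> w _; rewrite lee_fin expR_ge0.
  - move=> w _; rewrite lee_fin; apply: prodr_ge0 => k _.
    by have /andP[] := phi0C k (T w) (Theta k w).
  exists (~` (T @^-1` simplex t)); split; last 2 first.
  - exact: times_simplex.
  - move=> w /=; apply: contra_not => wS _; congr EFin.
    rewrite dotp_position expR_sum; apply: eq_bigr => k _.
    by rewrite /phi indicE mem_set// mul1r dotE.
  apply: measurableC; rewrite -[X in measurable X]setTI; apply: measurable_funPT => //.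
  exact: measurable_simplex.
rewrite (integral_independent_product indep C1 phi0C mphi).
pose h s : R := (\prod_(k < n.+1) average (Theta k) (phi k) s)%R.
have h0 s : (0 <= h s)%R.
  apply: prodr_ge0 => k _.
  by have [_ /andP[]] := integral_average (Theta k) (phi0C k) (mphi k) s.
have mh : measurable_fun setT (fun s => (h s)%:E).
  apply/measurable_EFinP; apply: measurable_prod => k _.
  exact: measurable_average (phi0C k) (mphi k).
transitivity (\int[distribution P T]_s (h s)%:E).
  by rewrite ge0_integral_distribution.
have [mf fE] := Tdens.
rewrite (ge0_integral_weighted times_density_ge0 mf fE) => //.
have ttk0 s : 0 <= kernel q s by exact: two_term_kernel_ge0.
have mttk : measurable_fun setT (fun s : n.-tuple R =>
    \prod_(k < n.+1) kernel q (duration t s k)).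
  by apply: measurable_simplex_integrand; exact: measurable_two_term_kernel.
have K0 : 0 <= (gamma_fun (n.+1 * m.+3)%:R / t ^+ (n.+1 * m.+3).-1)%:E.
  rewrite lee_fin gamma_fun_nat divr_ge0 ?exprn_ge0 ?(ltW t0)//; exact: half_gamma_ge0.
rewrite /simplex_integral.
rewrite -(ge0_integralZl (lebesgue_tuple n) measurableT mttk _ K0); last first.
  by move=> s _; apply: prode_ge0.
(* Off the simplex the density is zero on one side, and on the other some duration is nonpositive,
   where the kernel vanishes. *)
apply: eq_integral => s _; have [sS|sS] := pselect (simplex t s); last first.
  rewrite times_density_notin// mule0.
  have [k ks] : exists k : 'I_n.+1, (duration t s k <= 0)%R.
    apply: contrapT => hk; apply: sS => k; rewrite ltNge; apply/negP => ks.
    by apply: hk; exists k.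
  rewrite (bigD1 k)//= {1}/two_term_kernel !time_kernel_le0// mule0 adde0.
  by rewrite mul0e mule0.
rewrite times_density_simplex//.
have avgE (k : 'I_n.+1) : (duration t s k ^+ m.+2 * average (Theta k) (phi k) s)%:E =
    (m.+2`!%:R)%:E * kernel q (duration t s k).
  rewrite EFinM -(integral_average (Theta k) (phi0C k) (mphi k) s).1.
  rewrite -(integral_angles q k (sS k)); congr (_ * _); apply: eq_integral => th _.
  by rewrite /phi indicE mem_set// mul1r.
have kE (k : 'I_n.+1) : kernel q (duration t s k) =
    (duration t s k ^+ m.+2 * average (Theta k) (phi k) s / m.+2`!%:R)%:E.
  by rewrite [in RHS]mulrC EFinM avgE muleA -EFinM mulVf ?mul1e.
rewrite (eq_bigr _ (fun k _ => kE k)) prodEFin -!EFinM; congr EFin.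
rewrite [in RHS]big_split/= [in RHS]big_split/= prodr_const card_ord -/(h s) exprVn.
by set A := (\prod_(_ < _) _)%R; ring.
Qed.

End position.

End flight_laplace.

(** * Identifying a law from a signed combination of transforms *)

Section signed_density.
Local Open Scope ereal_scope.
Context (R : realType) (m : nat) (L : R) (mu : {measure set (m.-tuple R) -> \bar R}).
Context (I : finType) (e : I -> R) (g : I -> m.-tuple R -> R).
Local Notation lm := (@lebesgue_tuple R m).
Hypotheses (muoo : mu setT < +oo)
  (mubox : mu (~` [set x | forall i : 'I_m, (`|tnth x i| <= L)%R]) = 0)
  (g0 : forall i x, (0 <= g i x)%R) (mg : forall i, measurable_fun setT (g i))
  (gbox : forall i x, ~ (forall j : 'I_m, (`|tnth x j| <= L)%R) -> g i x = 0%R)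
  (gfin : forall i p, \int[lm]_x (g i x * expR (dotp p x))%:E \is a fin_num)
  (muE : forall p, \int[mu]_x (expR (dotp p x))%:E =
    (\sum_i e i * fine (\int[lm]_x (g i x * expR (dotp p x))%:E))%R%:E).

Let mgp i p : measurable_fun setT (fun x : m.-tuple R => g i x * expR (dotp p x))%R.
Proof.
apply: measurable_funM => //.
by apply: measurableT_comp => //; exact: measurable_dotp.
Qed.

Let gp0 i p x : (0 <= g i x * expR (dotp p x))%R.
Proof. by rewrite mulr_ge0 ?expR_ge0. Qed.

Let combination (k : I -> R) p : (forall i, 0 <= k i)%R ->
  \int[lm]_x ((\sum_i k i * g i x) * expR (dotp p x))%:E =
  (\sum_i k i * fine (\int[lm]_x (g i x * expR (dotp p x))%:E))%R%:E.
Proof.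
move=> k0; transitivity (\int[lm]_x \sum_i (k i * (g i x * expR (dotp p x)))%:E).
  apply: eq_integral => x _; rewrite mulr_suml -sumEFin.
  by apply: eq_bigr => i _; rewrite mulrA.
rewrite ge0_integral_sum//; last 2 first.
- by move=> i; apply/measurable_EFinP; apply: measurable_funM.
- by move=> i x _; rewrite lee_fin mulr_ge0.
rewrite -sumEFin; apply: eq_bigr => i _.
by rewrite (ge0_integralMl lm (k0 i) (gp0 i p) (mgp i p)) EFinM fineK.
Qed.

(** Positive and negative parts are taken of the coefficients, not of the combined function, so that
    the transforms of [u] and [v] remain combinations of known ones. *)
Let pos i : R := Num.max (e i) 0%R.
Let neg i : R := Num.max (- e i)%R 0%R.
Let u x : R := (\sum_i pos i * g i x)%R.
Let v x : R := (\sum_i neg i * g i x)%R.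

Let pos0 i : (0 <= pos i)%R. Proof. by rewrite le_max lexx orbT. Qed.
Let neg0 i : (0 <= neg i)%R. Proof. by rewrite le_max lexx orbT. Qed.

Let posneg i : (pos i - neg i = e i)%R.
Proof.
rewrite /pos /neg; have [e0|e0] := lerP 0%R (e i).
  by rewrite max_r ?subr0// lerNl oppr0.
by rewrite max_l ?sub0r ?opprK// lerNr oppr0 ltW.
Qed.

Let u0 x : (0 <= u x)%R. Proof. by apply: sumr_ge0 => i _; rewrite mulr_ge0. Qed.
Let v0 x : (0 <= v x)%R. Proof. by apply: sumr_ge0 => i _; rewrite mulr_ge0. Qed.

Let mu_ : measurable_fun setT u.
Proof. by apply: measurable_sum => i; exact: measurable_funM. Qed.
Let mv_ : measurable_fun setT v.
Proof. by apply: measurable_sum => i; exact: measurable_funM. Qed.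

(** The transform at [p = 0] is the total mass. *)
Let fin_setT (k : I -> R) : (forall i, 0 <= k i)%R ->
  \int[lm]_x (\sum_i k i * g i x)%R%:E < +oo.
Proof.
move=> k0; have := combination (fun=> 0%R) k0.
under eq_integral => x _.
  rewrite [dotp _ _](_ : _ = 0%R); last by rewrite /dotp big1// => i _; rewrite mul0r.
  rewrite expR0 mulr1; over.
by move=> ->; rewrite ltry.
Qed.

Lemma signed_density A : measurable A -> mu A = \int[lm]_(x in A) (\sum_i e i * g i x)%R%:E.
Proof.
move=> mA.
have [U UE] := ex_weighted_measure lm u0 mu_.
have [V VE] := ex_weighted_measure lm v0 mv_.
have mbox : measurable [set x : m.-tuple R | forall i : 'I_m, (`|tnth x i| <= L)%R].
  exact: measurable_box.
have box0 (k : I -> R) :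
    \int[lm]_(x in ~` [set x | forall i : 'I_m, (`|tnth x i| <= L)%R])
      (\sum_i k i * g i x)%R%:E = 0.
  apply: integral0_eq => x nbx.
  by congr EFin; rewrite big1// => i _; rewrite gbox// mulr0.
have expm p : measurable_fun setT (fun x : m.-tuple R => (expR (dotp p x))%:E).
  by apply/measurable_EFinP; apply: measurableT_comp => //; exact: measurable_dotp.
pose S : {measure set (m.-tuple R) -> \bar R} := measure_add mu V.
have SE B : S B = mu B + V B by exact: measure_addE.
have muV : S A = U A.
  apply: (laplace_measure_eq (L := L)) => //.
  - by rewrite SE VE; apply: lte_add_pinfty => //; exact: fin_setT.
  - by rewrite UE; exact: fin_setT.
  - by rewrite SE VE mubox box0 adde0.
  - by rewrite UE box0.
  move=> p; rewrite ge0_integral_measure_add//.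
  rewrite muE (ge0_integral_weighted v0 mv_ (fun A _ => VE A)) => //.
  rewrite (ge0_integral_weighted u0 mu_ (fun A _ => UE A)) => //.
  under eq_integral do rewrite -EFinM mulrC.
  under [RHS]eq_integral do rewrite -EFinM mulrC.
  rewrite !combination// -EFinD -big_split; congr EFin; apply: eq_bigr => i _ /=.
  by rewrite -mulrDl -posneg subrK.
have VA : V A \is a fin_num.
  rewrite ge0_fin_numE//; apply: (@le_lt_trans _ _ (V setT)).
    by apply: le_measure; rewrite ?inE.
  by rewrite VE; exact: fin_setT.
have UA : U A < +oo.
  apply: (@le_lt_trans _ _ (U setT)); first by apply: le_measure; rewrite ?inE.
  by rewrite UE; exact: fin_setT.
have -> : mu A = U A - V A by rewrite -muV SE addeK.
rewrite UE VE -integralB_EFin//.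
- apply: eq_integral => x _; congr EFin; rewrite /u /v -sumrB.
  by apply: eq_bigr => i _; rewrite -mulrBl posneg.
- apply/integrableP; split; first by apply/measurable_EFinP; exact: measurable_funTS.
  by under eq_integral do rewrite gee0_abs ?lee_fin//; rewrite -UE.
- apply/integrableP; split; first by apply/measurable_EFinP; exact: measurable_funTS.
  under eq_integral do rewrite gee0_abs ?lee_fin//.
  by rewrite -VE -ge0_fin_numE.
Qed.

End signed_density.

(** * The density of the position *)

Section flight_density.
Local Open Scope ereal_scope.
Context (R : realType).
Local Notation G := (half_gamma R).
Local Notation spi := (Num.sqrt (pi : R)).

Lemma powR_sqr_half (c : R) k : (0 < c)%R -> ((c ^+ 2) `^ (k%:R / 2) = c ^+ k)%R.
Proof.
move=> c0; rewrite -powR_mulrn ?(ltW c0)// -powRrM.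
by rewrite mulrC divfK ?pnatr_eq0// powR_mulrn ?(ltW c0).
Qed.

(** Apart from a leading power of [w], the series depends on [r] and [w] through their product, so
    c^2 can pass from one to the other. This brings in the speed. *)
Lemma bessel_kernel_scale h (c r w : R) : (0 < c)%R -> (0 <= r)%R ->
  bessel_kernel h.+1 r (c ^+ 2 * w) = (c ^+ h)%:E * bessel_kernel h.+1 (c ^+ 2 * r) w.
Proof.
move=> c0 r0; have cr0 : (0 <= c ^+ 2 * r)%R by rewrite mulr_ge0// sqr_ge0.
rewrite /bessel_kernel -nneseriesZl; last first.
  by move=> k _; rewrite lee_fin exp_coeff_riesz_ge0.
apply: eq_eseriesr => k _; rewrite -EFinM; congr EFin.
rewrite rieszM ?exprn_gt0// (_ : (_ - 1)%R = (h + 2 * k)%:R :> R); last first.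
  by rewrite addSn -natr1 addrK.
rewrite powR_sqr_half// (exprD c) (exprM c) /exp_coeff/= -(mulrA (c ^+ 2)%R).
by rewrite (exprMn _ (c ^+ 2)%R); ring.
Qed.

Section density_terms.
Context (a : nat -> nat -> R) (m n : nat) (c t : R).
Hypotheses (n0 : (0 < n)%N) (c0 : (0 < c)%R) (t0 : (0 < t)%R).
Local Notation w := (c ^+ 2 * t ^+ 2)%R.
Local Notation A := (n.+1 * m.+3)%N.

(** [riesz] contributes the Gamma value in the denominator, the power with exponent n(d + 1)/2 - k,
    and the restriction to the open ball. *)
Definition flight_term k (x : m.+2.-tuple R) : R :=
  (x`_m.+1 ^+ (2 * k) * riesz ((n * m.+3).+1 - 2 * k) (w - sqn x))%R.

(** Here [M] stands for n + 1 - j. *)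
Definition flight_coeff M k : R :=
  (gamma_fun A%:R / (spi ^+ m.+1 * (2 * c * t) ^+ A.-1) *
   ((-1) ^+ M * 'C(n.+1, M)%:R * (m.+3%:R / 2) ^+ M / G (A + 2 * M)) *
   ((-1) ^+ k * a k M))%R.

(** Guarantees that no subtraction in the index of [riesz] is truncated. For [n = 0] and [M = 1] it
    would fail: this is where at least one change of direction is needed. *)
Lemma flight_degree M : (M <= n.+1)%N -> (2 * M <= (n * m.+3).+1)%N.
Proof. by move: n0; clear; nia. Qed.

Lemma enorm_lt (x : m.+2.-tuple R) : (enorm x < c * t)%R = (0 < w - sqn x)%R.
Proof.
rewrite subr_gt0 enormE -exprMn -[LHS]ltr_sqr ?nnegrE ?sqrtr_ge0//; last first.
  by apply: mulr_ge0; exact: ltW.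
by rewrite sqr_sqrtr ?sqn_ge0.
Qed.

Lemma position_density_terms x :
  (if enorm x < c * t then position_density a n c t x else 0)%R =
  (\sum_(j < n.+2) \sum_(k < (n.+1 - j).+1)
     flight_coeff (n.+1 - j)%N k * flight_term k x)%R.
Proof.
rewrite enorm_lt; case: ifPn => [wx|]; last first.
  rewrite -leNgt => wx; rewrite big1// => j _; rewrite big1// => k _.
  by rewrite /flight_term riesz_le0// !mulr0.
rewrite /position_density powR_pi_half mulr_sumr; apply: eq_bigr => j _.
have jn : (j <= n.+1)%N by rewrite -ltnS.
have -> : ((n.+1 * (m.+2 + 3))%:R / 2 - j%:R = (A + 2 * (n.+1 - j))%:R / 2 :> R)%R.
  have -> : (n.+1 * (m.+2 + 3) = (A + 2 * (n.+1 - j)) + 2 * j)%N by move: jn; clear; nia.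
  by rewrite [in LHS]natrD [in LHS](natrM _ 2 j); field.
rewrite -half_gammaE natr1 mulr_sumr mulr_sumr; apply: eq_bigr => k _.
have kD : (2 * k <= (n * m.+3).+1)%N.
  apply: flight_degree; rewrite (leq_trans _ (leq_subr j n.+1))//.
  by rewrite -ltnS.
set h := ((n * m.+3).+1 - 2 * k)%N.
have hE : ((n * m.+3)%:R = h%:R + 2 * k%:R - 1 :> R)%R.
  have : (h + 2 * k = (n * m.+3).+1)%N by rewrite subnK.
  move=> /(congr1 (fun i => i%:R : R)%R); rewrite natrD natrM -(natr1 (n * m.+3)) => ->.
  by rewrite addrK.
rewrite /flight_term /flight_coeff /riesz wx -/h.
have -> : ((n * m.+3)%:R / 2 - k%:R + 1 = h.+1%:R / 2 :> R)%R.
  by rewrite hE -natr1; field.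
have -> : ((n * m.+3)%:R / 2 - k%:R = (h%:R - 1) / 2 :> R)%R by rewrite hE; field.
rewrite -half_gammaE enormE sqr_sqrtr ?sqn_ge0//.
by rewrite bin_sub// -[m.+2.-1]/m.+1; ring.
Qed.

Lemma flight_term_ge0 k x : (0 <= flight_term k x)%R.
Proof. by rewrite mulr_ge0 ?riesz_ge0// exprM exprn_ge0// sqr_ge0. Qed.

Lemma measurable_flight_term k : measurable_fun setT (flight_term k).
Proof.
apply: measurable_funM; first by apply: measurable_funX; exact: measurable_tuple_nth.
by apply: measurable_riesz_comp; apply: measurable_funB => //; exact: measurable_sqn.
Qed.

Lemma flight_term_box k x :
  ~ (forall j : 'I_m.+2, (`|tnth x j| <= c * t)%R) -> flight_term k x = 0%R.
Proof.
move=> /existsNP[j /negP]; rewrite -ltNge => xj.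
rewrite /flight_term riesz_le0 ?mulr0// subr_le0 -exprMn.
apply: (@le_trans _ _ (x`_j ^+ 2)%R).
  rewrite -(real_normK (num_real x`_j)) ler_sqr ?nnegrE//.
    by rewrite -tnth_nth ltW.
  by apply: mulr_ge0; exact: ltW.
by rewrite /sqn (bigD1 j)//= lerDl; apply: sumr_ge0 => i _; rewrite sqr_ge0.
Qed.

(** After the outer sum is reversed, with l = n + 1 - j, the signs (-1)^l of the coefficient and of
    (-2)^l cancel, and (d + 1)/2 times 2 times p_d^2 / 4 gives the base of the l-th power. *)
Lemma flight_term_laplace p : flight_constants a ->
  (\sum_(j < n.+2) \sum_(k < (n.+1 - j).+1) flight_coeff (n.+1 - j)%N k *
     fine (\int[lebesgue_tuple m.+2]_x (flight_term k x * expR (dotp p x))%:E) =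
   \sum_(l < n.+2) gamma_fun A%:R / (2 * c * t) ^+ A.-1 *
     (spi * 'C(n.+1, l)%:R * (m.+3%:R * p m.+1 ^+ 2 / 4) ^+ l / G (A + 2 * l) *
     fine (bessel_kernel (A + 2 * l)%N (sqp p m.+2) w)))%R.
Proof.
move=> ha; rewrite (reindex_inj rev_ord_inj)/=; apply: eq_bigr => l _.
have ln : (l <= n.+1)%N by rewrite -ltnS.
rewrite subSS subKn//.
transitivity (gamma_fun A%:R / (spi ^+ m.+1 * (2 * c * t) ^+ A.-1) *
   ((-1) ^+ l * 'C(n.+1, l)%:R * (m.+3%:R / 2) ^+ l / G (A + 2 * l)) *
   \sum_(k < l.+1) (-1) ^+ k * a k l *
    fine (\int[lebesgue_tuple m.+2]_x (flight_term k x * expR (dotp p x))%:E))%R.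
  by rewrite mulr_sumr; apply: eq_bigr => k _; rewrite mulrA.
rewrite (flight_combination p m.+1 w ha (flight_degree ln)).
have -> : (((n * m.+3).+1 + m.+1 + 2 * l).+1 = A + 2 * l)%N by clear; nia.
set B := fine _; have spi0 : spi != 0%R by rewrite gt_eqF// sqrtr_gt0 pi_gt0.
have -> : ((m.+3%:R * p m.+1 ^+ 2 / 4) ^+ l =
    (-1) ^+ l * (m.+3%:R / 2) ^+ l * (- 2) ^+ l * (p m.+1 ^+ 2 / 4) ^+ l :> R)%R.
  by rewrite -!exprMn; congr (_ ^+ _)%R; field.
rewrite (exprSr spi m.+1); field.
have GA : G (A + 2 * l) != 0%R by exact: half_gamma_neq0.
have ct0 : (2 * c * t != 0)%R by rewrite gt_eqF// !mulr_gt0.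
by apply/and3P; split; [exact: GA|exact: expf_neq0|exact: expf_neq0].
Qed.

End density_terms.

Section flight.
Context d0 (Omega : measurableType d0) (P : probability Omega R) (m n : nat) (c t : R).
Context (a : nat -> nat -> R).
Context (T : {RV P >-> n.-tuple R}) (Theta : 'I_n.+1 -> {RV P >-> m.+1.-tuple R}).
Local Notation X := (@position R m.+2 n c t _ _ P T Theta).
Hypotheses (n0 : (0 < n)%N) (c0 : (0 < c)%R) (t0 : (0 < t)%R).
Hypothesis ha : flight_constants a.
Hypothesis Tdens : has_density (distribution P T) (times_density m.+2 t).
Hypothesis Thetadens :
  forall k, has_density (distribution P (Theta k)) (@angles_density R m.+2).
Hypothesis indep : mutually_independent T Theta.
Local Notation A := (n.+1 * m.+3)%N.
Local Notation w := (c ^+ 2 * t ^+ 2)%R.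

(** The time kernels are turned back into space kernels at w = c^2 t^2, the form in which the
    transform of the candidate density is available. *)
Lemma position_laplace_bessel p :
  \int[distribution P X]_x (expR (dotp p x))%:E =
  (\sum_(l < n.+2) gamma_fun A%:R / (2 * c * t) ^+ A.-1 *
     (spi * 'C(n.+1, l)%:R * (m.+3%:R * p m.+1 ^+ 2 / 4) ^+ l / G (A + 2 * l) *
     fine (bessel_kernel (A + 2 * l)%N (sqp p m.+2) w)))%R%:E.
Proof.
have r0 := sqp_ge0 p m.+2.
rewrite (position_laplace c t0 Tdens Thetadens indep).
have -> : sqp (fun i => c * p i)%R m.+2 = (c ^+ 2 * sqp p m.+2)%R.
  by rewrite /sqp mulr_sumr; apply: eq_bigr => i _; rewrite exprMn.
have cr0 : (0 <= c ^+ 2 * sqp p m.+2)%R by rewrite mulr_ge0// sqr_ge0.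
have spi0 : spi != 0%R by rewrite gt_eqF// sqrtr_gt0 pi_gt0.
have tkE l : time_kernel (A + 2 * l) (c ^+ 2 * sqp p m.+2) t =
    (spi / (2 ^+ (A.-1 + 2 * l) * G (A + 2 * l) * c ^+ (A.-1 + 2 * l)) *
     fine (bessel_kernel (A + 2 * l) (sqp p m.+2) w))%R%:E.
  have -> : (A + 2 * l = (A.-1 + 2 * l).+1)%N by [].
  set h := (A.-1 + 2 * l)%N; rewrite EFinM fineK ?bessel_kernel_fin_num//.
  rewrite bessel_kernel_scale// bessel_kernel_sqr// !muleA -!EFinM.
  rewrite [X in _ = X%:E * _](_ : _ = 1%R) ?mul1e//.
  by field; rewrite half_gamma_neq0 spi0 !expf_neq0// gt_eqF.
under eq_bigr do rewrite tkE -EFinM.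
rewrite sumEFin -EFinM; congr EFin; rewrite mulr_sumr; apply: eq_bigr => l _.
set B := fine _.
have GA : G (A + 2 * l) != 0%R by exact: half_gamma_neq0.
set N := A.-1; set y := ((m.+3%:R * p m.+1 ^+ 2 / 4) ^+ l)%R.
have -> : ((m.+3%:R * (c * p m.+1) ^+ 2) ^+ l = y * (c ^+ 2) ^+ l * 4 ^+ l)%R.
  by rewrite /y -!exprMn; congr (_ ^+ _)%R; field.
have e2 (z : R) : (z ^+ (N + 2 * l) = z ^+ N * (z ^+ 2) ^+ l)%R by rewrite exprD exprM.
have e4 : (2 ^+ 2 = 4 :> R)%R by rewrite -natrX.
rewrite !e2 e4 (exprMn N (2 * c)%R t) (exprMn N 2 c)%R.
field.
by rewrite GA !expf_neq0 ?gt_eqF.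
Qed.

Lemma position_has_density : has_density (distribution P X)
  (fun x => if (enorm x < c * t)%R then position_density a n c t x else 0%R).
Proof.
(* Dependent pairs flatten the double sum, whose inner range depends on j, into one finite sum. *)
pose I := {j : 'I_n.+2 & 'I_(n.+1 - j).+1}.
pose e (i : I) : R := flight_coeff a m n c t (n.+1 - tag i) (tagged i).
pose g (i : I) := @flight_term m n c t (tagged i).
rewrite (_ : (fun x => _) = (fun x => (\sum_(i : I) e i * g i x)%R)); last first.
  by apply/funext => x; rewrite position_density_terms// sig_big_dep.
split.
  apply: measurable_sum => i; apply: measurable_funM => //.
  exact: measurable_flight_term.
apply: (@signed_density R m.+2 (c * t) (distribution P X) I e g) => //.
- by rewrite [X in X < _](_ : _ = 1) ?ltry//; exact: probability_setT.
- exact: (position_box Theta c0 Tdens).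
- by move=> i x; exact: flight_term_ge0.
- by move=> i; exact: measurable_flight_term.
- by move=> i x; exact: flight_term_box.
- by move=> i p; exact: integral_riesz_tuple_fin_num.
move=> p; rewrite position_laplace_bessel -(flight_term_laplace _ n0 c0 t0 p ha).
by rewrite sig_big_dep.
Qed.

End flight.

Lemma measurable_enorm_ball m (r : R) :
  measurable [set x : m.-tuple R | (enorm x < r)%R].
Proof.
rewrite (_ : mkset _ = (@enorm R m) @^-1` `]-oo, r[%classic); last first.
  by apply/seteqP; split => x /=; rewrite in_itv.
rewrite -[X in measurable X]setTI.
have me : measurable_fun setT (@enorm R m).
  rewrite (_ : @enorm R m = Num.sqrt \o @sqn R m); last first.
    by apply/funext => x; exact: enormE.
  apply: measurableT_comp; last exact: measurable_sqn.
  by apply: continuous_measurable_fun; exact: sqrt_continuous.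
by apply: me => //; exact: measurable_itv.
Qed.

End flight_density.

Theorem theorem4 (R : realType) (disp : measure_display)
    (Omega : measurableType disp) (P : probability Omega R)
    (d n : nat) (c t : R) (a : nat -> nat -> R)
    (T : {RV P >-> n.-tuple R})
    (Theta : 'I_n.+1 -> {RV P >-> d.-1.-tuple R}) :
  (2 <= d)%N -> (1 <= n)%N -> 0 < c -> 0 < t ->
  flight_constants a ->
  has_density (distribution P T) (times_density d t) ->
  (forall k, has_density (distribution P (Theta k)) (@angles_density R d)) ->
  mutually_independent T Theta ->
  distribution P (position c t T Theta) [set x | enorm x < c * t] = 1%E /\
  has_density (distribution P (position c t T Theta))
    (fun x => if enorm x < c * t then position_density a n c t x else 0).
Proof.
case: d Theta => [|[|m]]// Theta _ n0 c0 t0 ha hT hTheta ind.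
have hX := position_has_density n0 c0 t0 ha hT hTheta ind.
split => //; have [mf densE] := hX.
have mB := @measurable_enorm_ball R m.+2 (c * t).
(* Concentration in the open ball is read off the density, which vanishes outside it. *)
have off_ball : distribution P (position c t T Theta) (~` [set x | enorm x < c * t]) = 0%E.
  rewrite densE; last exact: measurableC.
  by rewrite integral0_eq// => x /= /negP/negbTE ->.
rewrite -[X in distribution P _ X]setCK probability_setC; last exact: measurableC.
by rewrite [X in (_ - X)%E]off_ball sube0.
Qed.
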